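(* Let $D$ be either a totally real number field or a totally indefinite quaternion algebra over a totally real number field, and let $\dag$ be a positive involution of $D$. Let $V$ be a left $D$-vector space of dimension $m$, equipped with a non-degenerate $(D,\dag)$-skew-Hermitian form $\psi \colon V \times V \to D$. Let $L$ be a $\mathbb{Z}$-lattice of full rank in $V$ such that $\operatorname{Trd}_{D/\mathbb{Q}} \psi(L \times L) \subset \mathbb{Z}$, and let $R=\operatorname{Stab}_D(L)=\{a\in D: aL\subset L\}$. Then there exists a $D$-basis $v_1, \dotsc, v_m$ of $V$ such that: (i) $v_1, \dotsc, v_m \in L$; (ii) the basis is weakly symplectic (when $D$ is a field) or weakly unitary (when $D$ is a quaternion algebra) with respect to $\psi$; (iii) $[L:Rv_1 + \dotsb + Rv_m] \leq c_1 \lvert\operatorname{disc}(R)\rvert^{c_2} \lvert\operatorname{disc}(L)\rvert^{c_3}$; (iv) $\lvert\psi(v_i, v_j)\rvert_D \leq c_4 \lvert\operatorname{disc}(R)\rvert^{c_5} \lvert\operatorname{disc}(L)\rvert^{c_6}$ for all $1 \leq i, j \leq m$, where the positive constants $c_1,\dots,c_6$ depend only on $m$ and $\dim_\mathbb{Q}(D)$.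
   Context: An involution $\dag$ of a $\mathbb{Q}$-algebra $D$ is a $\mathbb{Q}$-linear map with $\dag\circ\dag=\mathrm{id}$ and $(ab)^\dag=b^\dag a^\dag$; it is positive if $(a,b)\mapsto \operatorname{Trd}_{D/\mathbb{Q}}(ab^\dag)$ is positive definite, where $\operatorname{Trd}_{D/\mathbb{Q}}=\operatorname{Tr}_{F/\mathbb{Q}}\circ\operatorname{Trd}_{D/F}$ ($F$ the centre of $D$, $\operatorname{Trd}_{D/F}$ the reduced trace). A $(D,\dag)$-skew-Hermitian form is a $\mathbb{Q}$-bilinear map $\psi\colon V\times V\to D$ with $\psi(y,x)=-\psi(x,y)^\dag$ and $\psi(ax,by)=a\psi(x,y)b^\dag$ for all $a,b\in D$, $x,y\in V$; it is non-degenerate if for every $x\neq 0$ there is $y$ with $\psi(x,y)\neq 0$. A $D$-basis $v_1,\dots,v_m$ is weakly symplectic if $\psi(v_i,v_j)=0$ for all $i,j$ except when $\{i,j\}=\{2k-1,2k\}$ for some integer $k$, and weakly unitary if $\psi(v_i,v_j)=0$ whenever $i\neq j$. For $a\in D_\mathbb{R}=D\otimes_\mathbb{Q}\mathbb{R}$, $\lvert a\rvert_D=\sqrt{\operatorname{Trd}_{D_\mathbb{R}/\mathbb{R}}(aa^\dag)}$. For an order $R$ of $D$, $\operatorname{disc}(R)$ is the determinant of the matrix $(\operatorname{Tr}_{D/\mathbb{Q}}(r_ir_j))_{i,j}$ for a $\mathbb{Z}$-basis $(r_i)$ of $R$, with $\operatorname{Tr}_{D/\mathbb{Q}}$ the non-reduced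 trace. $\operatorname{disc}(L)$ is the determinant of the Gram matrix of the bilinear form $\operatorname{Trd}_{D/\mathbb{Q}}\circ\psi$ on a $\mathbb{Z}$-basis of $L$. *)

(* Defs.v *)
From HB Require Import structures.
From mathcomp Require Import all_boot all_order all_algebra all_field.
From mathcomp Require Import complex.
From mathcomp Require Import all_classical reals exp.

Set Implicit Arguments.
Unset Strict Implicit.
Unset Printing Implicit Defensive.

Import Order.TTheory GRing.Theory Num.Theory.
Local Open Scope classical_set_scope.
Local Open Scope ring_scope.

(** * Traces

    A number field is a [F : fieldExtType rat]; the algebra [D] is a
    finite-dimensional [F]-algebra with centre [F].  Its [rat]-structure is the
    one induced by [F], so that the scalar [q : rat] acts as [q%:A : F]. *)

Definition regular_mx (K : fieldType) (A : falgType K) (x : A) :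
    'M[K]_(\dim {:A}) :=
  \matrix_(i, j) coord (vbasis {:A}) j (x * (vbasis {:A})`_i).

Definition alg_trace (K : fieldType) (A : falgType K) (x : A) : K :=
  \tr (regular_mx x).

(* The degree of a central simple algebra is the square root of its
   dimension. *)
Definition alg_degree (F : fieldType) (D : falgType F) : nat :=
  Nat.sqrt (\dim {:D}).

(* For a central simple algebra, [Tr_{D/F} = deg(D) Trd_{D/F}]; as [F] has
   characteristic zero this determines [Trd_{D/F}].  Lemmas [trd_center] and
   [trd_split] below check that this is the usual reduced trace. *)
Definition trd (F : fieldExtType rat) (D : falgType F) (x : D) : F :=
  (alg_degree D)%:R^-1 * alg_trace x.

Definition trdQ (F : fieldExtType rat) (D : falgType F) (x : D) : rat :=
  alg_trace (trd x).

Definition trQ (F : fieldExtType rat) (D : falgType F) (x : D) : rat :=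
  alg_trace (alg_trace x).

Definition dimQ (F : fieldExtType rat) (D : falgType F) : nat :=
  (\dim {:F} * \dim {:D})%N.

(** * The algebra D *)

Definition totally_real (R : realType) (F : fieldExtType rat) : Prop :=
  forall (s : {rmorphism F -> R[i]}) (x : F), complex.Im (s x) = 0.

(* [D] is the field [F] itself. *)
Definition is_center (F : fieldType) (D : falgType F) : Prop :=
  forall x : D, exists a : F, x = a%:A.

Definition quaternion_algebra (F : fieldType) (D : falgType F) : Prop :=
  exists (i j : D) (a b : F),
    [/\ a != 0 /\ b != 0, i * i = a%:A, j * j = b%:A, i * j = - (j * i)
      & basis_of {:D} [:: 1; i; j; i * j]].

Definition semilinear_along (F K : fieldType) (D : falgType F) (s : F -> K) (d : nat)
    (phi : D -> 'M[K]_d) : Prop :=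
  forall (a : F) (x : D), phi (a *: x) = s a *: phi x.

(* For every [s : F -> R], the algebra [D (x)_{F,s} R] is isomorphic to
   [M_2(R)]: giving such an isomorphism amounts to giving an [s]-semilinear
   ring morphism [D -> M_2(R)] mapping an [F]-basis to an [R]-basis. *)
Definition totally_indefinite (R : realType) (F : fieldExtType rat)
    (D : falgType F) : Prop :=
  forall s : {rmorphism F -> R}, exists phi : {rmorphism D -> 'M[R]_2},
    semilinear_along s phi /\
    basis_of {:'M[R]_2} [seq phi x | x <- vbasis {:D}].

(** * Involutions and skew-Hermitian forms *)

Definition involution (F : fieldExtType rat) (D : falgType F) (dag : D -> D) :
    Prop :=
  [/\ forall (q : rat) (x y : D),
        dag ((q%:A : F) *: x + y) = (q%:A : F) *: dag x + dag y,
      forall x, dag (dag x) = x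
    & forall x y, dag (x * y) = dag y * dag x].

Definition positive_involution (F : fieldExtType rat) (D : falgType F)
    (dag : D -> D) : Prop :=
  involution dag /\ forall x : D, x != 0 -> 0 < trdQ (x * dag x).

(* Homogeneity for the scalars in [rat] is the case [a, b : rat] of the third
   clause. *)
Definition skew_hermitian_form (F : fieldExtType rat) (D : falgType F)
    (dag : D -> D) (V : lmodType D) (psi : V -> V -> D) : Prop :=
  [/\ forall x x' y, psi (x + x') y = psi x y + psi x' y,
      forall x y y', psi x (y + y') = psi x y + psi x y',
      forall (a b : D) x y, psi (a *: x) (b *: y) = a * psi x y * dag b
    & forall x y, psi y x = - dag (psi x y)].

Definition nondegenerate_form (D : nzRingType) (V : lmodType D)
    (psi : V -> V -> D) : Prop :=
  forall x, x != 0 -> exists y, psi x y != 0.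

Definition dnorm (R : realType) (F : fieldExtType rat) (D : falgType F)
    (dag : D -> D) (x : D) : R :=
  Num.sqrt (ratr (trdQ (x * dag x))).

(** * Bases *)

Definition dbasis (D : nzRingType) (V : lmodType D) (m : nat)
    (v : 'I_m -> V) : Prop :=
  (forall x, exists a : 'I_m -> D, x = \sum_i a i *: v i) /\
  (forall a : 'I_m -> D, \sum_i a i *: v i = 0 -> forall i, a i = 0).

Definition has_dim (D : nzRingType) (V : lmodType D) (m : nat) : Prop :=
  exists v : 'I_m -> V, dbasis v.

(* Indices start at 0, so the pairs {2k-1, 2k} become {2k, 2k+1}. *)
Definition weakly_symplectic (D : nzRingType) (V : lmodType D)
    (psi : V -> V -> D) (m : nat) (v : 'I_m -> V) : Prop :=
  forall i j : 'I_m,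
    ~ (exists k : nat, (i = k.*2 :> nat /\ j = k.*2.+1 :> nat) \/
                       (i = k.*2.+1 :> nat /\ j = k.*2 :> nat)) ->
    psi (v i) (v j) = 0.

Definition weakly_unitary (D : nzRingType) (V : lmodType D)
    (psi : V -> V -> D) (m : nat) (v : 'I_m -> V) : Prop :=
  forall i j : 'I_m, i != j -> psi (v i) (v j) = 0.

(** * Lattices *)

Definition zbasis (M : zmodType) (S : set M) (n : nat) (b : 'I_n -> M) : Prop :=
  (forall x, S x <-> exists z : 'I_n -> int, x = \sum_i b i *~ z i) /\
  (forall z : 'I_n -> int, \sum_i b i *~ z i = 0 -> forall i, z i = 0).

(* [m * dimQ D] is the dimension over [rat] of a space of [D]-dimension [m]. *)
Definition full_lattice (F : fieldExtType rat) (D : falgType F)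
    (V : lmodType D) (m : nat) (L : set V) : Prop :=
  exists b : 'I_(m * dimQ D) -> V, zbasis L b.

(* The Gram determinant on a Z-basis does not depend on the basis when, as in
   the two uses below, the form is biadditive.  The value is 0 if there is no
   finite Z-basis. *)
Definition gram_disc (M : zmodType) (B : M -> M -> rat) (S : set M) : rat :=
  xget 0 [set d | exists n (b : 'I_n -> M),
                    zbasis S b /\ d = \det (\matrix_(i, j) B (b i) (b j))].

Definition disc_order (F : fieldExtType rat) (D : falgType F) (S : set D) :
    rat :=
  gram_disc (fun x y => trQ (x * y)) S.

Definition disc_lattice (F : fieldExtType rat) (D : falgType F)
    (V : lmodType D) (psi : V -> V -> D) (L : set V) : rat :=
  gram_disc (fun x y => trdQ (psi x y)) L.

Definition stab (D : nzRingType) (V : lmodType D) (L : set V) : set D :=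
  [set a | forall x, L x -> L (a *: x)].

Definition span_over (D : nzRingType) (V : lmodType D) (S : set D) (m : nat)
    (v : 'I_m -> V) : set V :=
  [set x | exists a : 'I_m -> D, (forall i, S (a i)) /\ x = \sum_i a i *: v i].

(* [f] is a system of representatives of the cosets of [N] in [L]. *)
Definition has_index (M : zmodType) (L N : set M) (k : nat) : Prop :=
  N `<=` L /\
  exists f : 'I_k -> M, (forall i, L (f i)) /\
    forall x, L x -> exists! i : 'I_k, N (x - f i).

(** * Consistency of [trd] with the usual reduced trace *)

Lemma regular_mxE (K : fieldType) (A : falgType K) (x : A)
    (i : 'I_(\dim {:A})) :
  x * (vbasis {:A})`_i = \sum_j regular_mx x i j *: (vbasis {:A})`_j.
Proof.
by rewrite {1}(coord_vbasis (memvf (x * _))); apply: eq_bigr => j _; rewrite mxE.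
Qed.

Lemma regular_mxM (K : fieldType) (A : falgType K) (x y : A) :
  regular_mx (x * y) = regular_mx y *m regular_mx x.
Proof.
apply/matrixP => i j; rewrite mxE -mulrA regular_mxE mulr_sumr linear_sum mxE.
by apply: eq_bigr => k _; rewrite -scalerAr linearZ /= [regular_mx x k j]mxE.
Qed.

Lemma alg_traceC (K : fieldType) (A : falgType K) (x y : A) :
  alg_trace (x * y) = alg_trace (y * x).
Proof. by rewrite /alg_trace !regular_mxM mxtrace_mulC. Qed.

Lemma alg_traceP (K : fieldType) (A : falgType K) (a : K) (x y : A) :
  alg_trace (a *: x + y) = a * alg_trace x + alg_trace y.
Proof.
rewrite /alg_trace /mxtrace mulr_sumr -big_split /=; apply: eq_bigr => i _.
by rewrite !mxE mulrDl linearD -scalerAl linearZ.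
Qed.

Lemma alg_trace1 (K : fieldType) (A : falgType K) :
  alg_trace (1 : A) = (\dim {:A})%:R.
Proof.
rewrite /alg_trace -[RHS]mxtrace1; congr (\tr _); apply/matrixP => i j.
by rewrite !mxE mul1r coord_free ?(basis_free (vbasisP _)) // eq_sym.
Qed.

Lemma trd_center (F : fieldExtType rat) (D : falgType F) (a : F) :
  is_center D -> trd (a%:A : D) = a.
Proof.
move=> hD; have d1 : \dim {:D} = 1%N.
  suff -> : fullv = <[1 : D]>%VS by rewrite dim_vline oner_eq0.
  apply/eqP; rewrite eqEsubv subvf andbT; apply/subvP => x _.
  by have [b ->] := hD x; rewrite memvZ ?memv_line.
rewrite /trd /alg_degree d1 invr1 mul1r -[a%:A]addr0 alg_traceP alg_trace1 d1.
have := alg_traceP 0 (0 : D) 0; rewrite scale0r add0r mul0r add0r => _.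
have := alg_traceP (-1) (0 : D) 0; rewrite scaler0 add0r mulN1r addNr => ->.
by rewrite mulr1 addr0.
Qed.

Lemma quaternion_trace (F : fieldExtType rat) (K : fieldType) (D : falgType F)
    (s : {rmorphism F -> K}) (t t' : D -> K) :
  quaternion_algebra D ->
  (forall a x y, t (a *: x + y) = s a * t x + t y) ->
  (forall x y, t (x * y) = t (y * x)) ->
  (forall a x y, t' (a *: x + y) = s a * t' x + t' y) ->
  (forall x y, t' (x * y) = t' (y * x)) ->
  t 1 = t' 1 -> t =1 t'.
Proof.
case=> i [j] [a] [b] [[a0 b0] ii jj ij bD] tP tC t'P t'C t1 x.
have tw : (2%:R : K) != 0.
  by rewrite -(rmorph_nat s) fmorph_eq0 -(rmorph_nat (in_alg F)) fmorph_eq0.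
have main u : (forall a x y, u (a *: x + y) = s a * u x + u y) ->
    (forall x y, u (x * y) = u (y * x)) ->
    [/\ u 0 = 0, u i = 0, u j = 0 & u (i * j) = 0].
  move=> uP uC.
  have u0 : u 0 = 0.
    by have := uP (-1) 0 0; rewrite scaler0 add0r rmorphN1 mulN1r addNr.
  have uZ c y : u (c *: y) = s c * u y by rewrite -[c *: y]addr0 uP u0 addr0.
  have uN y : u (- y) = - u y by rewrite -scaleN1r uZ rmorphN1 mulN1r.
  have z y : u y = - u y -> u y = 0.
    move=> h; apply/eqP; have /eqP : u y *+ 2 = 0 by rewrite mulr2n {1}h addNr.
    by rewrite -mulr_natl mulf_eq0 (negPf tw).
  have sc c y : c != 0 -> u (c *: y) = 0 -> u y = 0.
    by move=> c0 /eqP; rewrite uZ mulf_eq0 fmorph_eq0 (negPf c0) => /eqP.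
  split=> //.
  - apply: (sc b) => //; rewrite -{1}[ i ]mul1r scalerAl -jj -mulrA.
    by apply: z; rewrite {1}uC -mulrA -uN; congr u; rewrite ij ?mulrN.
  - apply: (sc a) => //; rewrite -{1}[j]mul1r scalerAl -ii -mulrA.
    apply: z; rewrite {1}uC -mulrA -uN; congr u.
    by rewrite -mulrN ij opprK.
  - by apply: z; rewrite {1}uC -uN ij opprK.
have [t0 ti tj tk] := main t tP tC; have [t0' ti' tj' tk'] := main t' t'P t'C.
have : x \in span [:: 1; i; j; i * j] by rewrite (span_basis bD) memvf.
rewrite !span_cons span_nil addv0.
case/memv_addP=> y0 /vlineP[x0 ->] [y1 hy1 ->].
case/memv_addP: hy1 => y2 /vlineP[x1 ->] [y3 hy3 ->].
case/memv_addP: hy3 => y4 /vlineP[x2 ->] [y5 /vlineP[x3 ->] ->].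
rewrite -[x3 *: _]addr0 !tP !t'P.
by rewrite t1 ti tj tk t0 ti' tj' tk' t0'.
Qed.

Lemma trd_split (F : fieldExtType rat) (K : fieldType) (D : falgType F)
    (s : {rmorphism F -> K}) (phi : {rmorphism D -> 'M[K]_2}) (x : D) :
  quaternion_algebra D -> semilinear_along s phi -> \tr (phi x) = s (trd x).
Proof.
move=> hD sl; apply: (@quaternion_trace _ _ _ s (fun x => \tr (phi x))
  (fun x => s (trd x))) => // {x}.
- by move=> a x y; rewrite rmorphD sl linearD linearZ.
- by move=> x y; rewrite !rmorphM mxtrace_mulC.
- move=> a x y; rewrite /trd alg_traceP mulrDr rmorphD; congr (_ + _).
  by rewrite -rmorphM; congr (s _); rewrite mulrCA.
- by move=> x y; rewrite /trd alg_traceC.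
have [i [j [a [b [_ _ _ _ bD]]]]] := hD.
have d4 : \dim {:D} = 4%N by case/andP: bD => /eqP <- /eqP ->.
rewrite rmorph1 mxtrace1 /trd /alg_degree alg_trace1 d4 /=.
rewrite -(rmorph_nat s); congr (s _).
have tw : (2%:R : F) != 0 by rewrite -(rmorph_nat (in_alg F)) fmorph_eq0.
have -> : 4%:R = 2%:R * 2%:R :> F by rewrite -natrM.
by rewrite mulKf.
Qed.

(* Main.v *)
Require Import Defs.
From HB Require Import structures.
From mathcomp Require Import all_boot all_order all_algebra all_field.
From mathcomp Require Import all_classical reals exp.
From mathcomp Require Import complex perm.
From mathcomp Require Import ring lra zify.

Set Implicit Arguments.
Unset Strict Implicit.
Unset Printing Implicit Defensive.

Import Order.TTheory GRing.Theory Num.Theory.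
Local Open Scope classical_set_scope.
Local Open Scope ring_scope.

(** Write E = trdQ o psi, O for the stabilizer of L, k and q for the absolute
    values of disc O and disc L.  The elements of L are measured by a positive
    definite form h built from a D-basis of V that is orthogonal (or hyperbolic)
    for psi and whose Gram entries are normalized by weak approximation at the
    real places of F: then [|psi(x, y)|^2 <= c h(x) h(y)], and E is close to
    unimodular with respect to h.  A Hermite-reduced Z-basis x_1, ..., x_r of L
    for h has a dual basis for E with denominator q; pairing the longest x_i with
    its dual vector gives some x_j with [h(x_j) h(x_l) <= c q^2] for all l.
    From x_j one gets a short hyperbolic pair when D is a field, and, after adding
    to a second vector a central multiple of x_j, a short anisotropic vector when
    D is a quaternion algebra.  A norm estimate in O bounds an integer M such that
    M L lies in the O-span of this block plus its orthogonal complement in L; the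
    complement is again O-stable with dual denominator M^2 q, so the theorem
    follows by induction on the rank. *)

(** * Subgroups and integral linear combinations *)

Definition subgroup (U : zmodType) (S : set U) : Prop :=
  S 0 /\ forall x y, S x -> S y -> S (x - y).

Section Subgroup.
Variables (U : zmodType) (S : set U).
Hypothesis sS : subgroup S.

Lemma subgroup0 : S 0. Proof. exact: sS.1. Qed.

Lemma subgroupB x y : S x -> S y -> S (x - y). Proof. exact: sS.2. Qed.

Lemma subgroupN x : S x -> S (- x).
Proof. by move=> Sx; rewrite -sub0r; apply: subgroupB => //; exact: subgroup0. Qed.

Lemma subgroupD x y : S x -> S y -> S (x + y).
Proof. by move=> Sx Sy; rewrite -[y]opprK; apply/subgroupB/subgroupN. Qed.

Lemma subgroup_sub_trans x y z : S (x - y) -> S (y - z) -> S (x - z).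
Proof. by move=> Sxy Syz; rewrite -(subrKA y); exact: subgroupD. Qed.

Lemma subgroup_subl x y z : S (x - y) -> S (x - z) -> S (y - z).
Proof. by move=> Sxy; apply: subgroup_sub_trans; rewrite -opprB; exact: subgroupN. Qed.

Lemma subgroup_sum (I : finType) (P : pred I) (f : I -> U) :
  (forall i, P i -> S (f i)) -> S (\sum_(i | P i) f i).
Proof. by move=> Sf; elim/big_ind: _ => //; [exact: subgroup0|exact: subgroupD]. Qed.

Lemma subgroupMn x n : S x -> S (x *+ n).
Proof. by move=> Sx; rewrite -[n]card_ord -sumr_const; exact: subgroup_sum. Qed.

Lemma subgroupMz x (z : int) : S x -> S (x *~ z).
Proof. by case: z => n Sx; [|apply: subgroupN]; apply: subgroupMn. Qed.

Lemma subgroup_absz x (z : int) : S (x *~ z) -> S (x *+ `|z|%N).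
Proof. by case: z => n // /subgroupN; rewrite NegzE mulrNz opprK. Qed.

End Subgroup.

Local Notation zcomb b z := (\sum_i b i *~ z i).

Definition zfree (U : zmodType) n (b : 'I_n -> U) : Prop :=
  forall z : 'I_n -> int, zcomb b z = 0 -> forall i, z i = 0.

Definition zspan (U : zmodType) n (b : 'I_n -> U) : set U :=
  [set x | exists z : 'I_n -> int, x = zcomb b z].

Definition in_zspan (U : zmodType) (S : set U) : Prop :=
  exists n (b : 'I_n -> U), S `<=` zspan b.

Lemma subgroup_zcomb (U : zmodType) (S : set U) n (b : 'I_n -> U) (z : 'I_n -> int) :
  subgroup S -> (forall i, S (b i)) -> S (zcomb b z).
Proof. by move=> sS Sb; apply: subgroup_sum => // i _; exact: subgroupMz. Qed.

Definition fam_cons (T : Type) n (x : T) (f : 'I_n -> T) (i : 'I_n.+1) : T :=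
  oapp f x (unlift ord0 i).

Lemma fam_cons0 (T : Type) n (x : T) (f : 'I_n -> T) : fam_cons x f ord0 = x.
Proof. by rewrite /fam_cons unlift_none. Qed.

Lemma fam_consS (T : Type) n (x : T) (f : 'I_n -> T) i :
  fam_cons x f (lift ord0 i) = f i.
Proof. by rewrite /fam_cons liftK. Qed.

Lemma fam_consP (T : Type) (P : T -> Prop) n (x : T) (f : 'I_n -> T) :
  P x -> (forall i, P (f i)) -> forall i, P (fam_cons x f i).
Proof. by move=> Px Pf i; rewrite /fam_cons; case: unlift. Qed.

Lemma zcomb_cons (U : zmodType) n (x : U) (f : 'I_n -> U) (z : 'I_n.+1 -> int) :
  zcomb (fam_cons x f) z = x *~ z ord0 + \sum_i f i *~ z (lift ord0 i).
Proof.
by rewrite big_ord_recl fam_cons0; under eq_bigr do rewrite fam_consS.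
Qed.

Section FamCat.
Variables p1 p2 : nat.

Definition fam_cat (T : Type) (f1 : 'I_p1 -> T) (f2 : 'I_p2 -> T) (i : 'I_(p1 + p2)) : T :=
  match fintype.split i with inl j => f1 j | inr j => f2 j end.

Definition tau_cat (tau1 : 'I_p1 -> 'I_p1) (tau2 : 'I_p2 -> 'I_p2) :
    'I_(p1 + p2) -> 'I_(p1 + p2) :=
  fam_cat (fun j => lshift p2 (tau1 j)) (fun j => rshift p1 (tau2 j)).

Lemma fam_catl (T : Type) (f1 : 'I_p1 -> T) f2 j : fam_cat f1 f2 (lshift p2 j) = f1 j.
Proof. by rewrite /fam_cat (unsplitK (inl _ j)). Qed.

Lemma fam_catr (T : Type) (f1 : 'I_p1 -> T) f2 j : fam_cat f1 f2 (rshift p1 j) = f2 j.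
Proof. by rewrite /fam_cat (unsplitK (inr _ j)). Qed.

Lemma tau_catl tau1 tau2 j : tau_cat tau1 tau2 (lshift p2 j) = lshift p2 (tau1 j).
Proof. exact: fam_catl. Qed.

Lemma tau_catr tau1 tau2 j : tau_cat tau1 tau2 (rshift p1 j) = rshift p1 (tau2 j).
Proof. exact: fam_catr. Qed.

Lemma ord_cat_ind (P : 'I_(p1 + p2) -> Prop) :
  (forall j, P (lshift p2 j)) -> (forall j, P (rshift p1 j)) -> forall i, P i.
Proof. by move=> Pl Pr i; case: (split_ordP i) => j ->. Qed.

End FamCat.

Section Zbasis.
Variables (U : zmodType) (S : set U) (n : nat) (b : 'I_n -> U).
Hypothesis bS : zbasis S b.

Lemma zbasis_free : zfree b. Proof. exact: bS.2. Qed.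

Lemma zbasis_subgroup : subgroup S.
Proof.
split=> [|u v /bS.1[s ->] /bS.1[t ->]].
  by apply/bS.1; exists (fun=> 0); rewrite big1.
apply/bS.1; exists (fun i => s i - t i).
by rewrite -sumrB; apply: eq_bigr => i _; rewrite mulrzBr.
Qed.

Lemma zcomb_delta i : zcomb b (fun j => (j == i)%:R) = b i.
Proof. by rewrite (bigD1 i) //= eqxx big1 ?addr0 // => j /negPf ->. Qed.

Lemma zbasis_mem i : S (b i).
Proof. by apply/bS.1; exists (fun j => (j == i)%:R); rewrite zcomb_delta. Qed.

Lemma zbasis_neq0 i : b i != 0.
Proof.
apply/eqP => bi; suff /eqP : (i == i)%:R = 0 :> int by rewrite eqxx.
by apply: (zbasis_free (z := fun j => (j == i)%:R)); rewrite zcomb_delta.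
Qed.

Lemma zbasis_in_zspan : in_zspan S.
Proof. by exists n, b => x /bS.1. Qed.

Lemma zbasis_coord : exists co : U -> 'I_n -> int, forall x, S x -> x = zcomb b (co x).
Proof.
have /choice[co coE] : forall x, exists z : 'I_n -> int, S x -> x = zcomb b z.
  move=> x; have [/bS.1[z ->]|nS] := pselect (S x); first by exists z.
  by exists (fun=> 0) => /nS.
by exists co.
Qed.

Lemma zbasis_inj (z w : 'I_n -> int) : zcomb b z = zcomb b w -> forall i, z i = w i.
Proof.
move=> e i; apply/eqP; rewrite -subr_eq0; apply/eqP.
apply: (zbasis_free (z := fun i => z i - w i)); under eq_bigr do rewrite mulrzBr.
by rewrite sumrB e subrr.
Qed.

End Zbasis.

Definition rank_le (U : zmodType) (s : nat) (S : set U) : Prop :=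
  forall l (f : 'I_l -> U), (forall i, S (f i)) -> zfree f -> (l <= s)%N.

Lemma rank_le_sub (U : zmodType) s (S S' : set U) :
  S' `<=` S -> rank_le s S -> rank_le s S'.
Proof. by move=> sub rk l f Sf; apply: rk => i; exact: sub. Qed.

Lemma rank_le_inj (U U' : zmodType) s (S : set U) (S' : set U') (f : {additive U -> U'}) :
  (forall x, f x = 0 -> x = 0) -> (forall x, S x -> S' (f x)) ->
  rank_le s S' -> rank_le s S.
Proof.
move=> f0 fS rk l g Sg fr; apply: (rk l (f \o g)) => [i|z zE]; first exact: fS.
apply/fr/f0; rewrite raddf_sum -[RHS]zE; apply: eq_bigr => i _.
by rewrite raddfMz.
Qed.

Definition torsion_free (U : zmodType) : Prop :=
  forall (x : U) n, (0 < n)%N -> x *+ n = 0 -> x = 0.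

Lemma torsion_free_mulrz (U : zmodType) (x : U) (z : int) :
  torsion_free U -> z != 0 -> x *~ z = 0 -> x = 0.
Proof.
move=> tf; case: z => [[|n]|n] // _; first exact: tf.
by rewrite NegzE mulrNz => /eqP; rewrite oppr_eq0 => /eqP; exact: tf.
Qed.

Lemma rank_le0 (U : zmodType) (S : set U) x :
  torsion_free U -> rank_le 0 S -> S x -> x = 0.
Proof.
move=> tf rk Sx; apply/eqP/negPn/negP => /eqP x0.
suff : (1 <= 0)%N by [].
apply: (rk _ (fun=> x)) => // z; rewrite big_ord1 => zx i; rewrite (ord1 i).
by apply: contrapT => /eqP z0; apply: x0; exact: torsion_free_mulrz zx.
Qed.

(** * Rational multiples *)

Definition inQ (U : zmodType) (S : set U) : set U :=
  [set x | exists2 N : nat, (0 < N)%N & S (x *+ N)].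

Section RationalSpan.
Variables (U : zmodType) (S : set U).
Hypothesis sS : subgroup S.

Lemma sub_inQ : S `<=` inQ S.
Proof. by move=> x Sx; exists 1%N. Qed.

Lemma inQ_family n (x : 'I_n -> U) : (forall i, inQ S (x i)) ->
  exists2 N : nat, (0 < N)%N & forall i, S (x i *+ N).
Proof.
move=> Sx; have /choice[M hM] i : exists M : nat, (0 < M)%N /\ S (x i *+ M).
  by have [M] := Sx i; exists M.
exists (\prod_i M i)%N; first by rewrite prodn_gt0 // => i; case: (hM i).
by move=> i; rewrite (bigD1 i) //= mulrnA; apply: (subgroupMn sS); case: (hM i).
Qed.

Lemma inQ_subgroup : subgroup (inQ S).
Proof.
split=> [|x y [M M0 Mx] [N N0 Ny]].
  by apply: sub_inQ; exact: subgroup0.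
exists (M * N)%N; first by rewrite muln_gt0 M0.
rewrite mulrnBl; apply: (subgroupB sS); first by rewrite mulrnA; apply: subgroupMn.
by rewrite mulnC mulrnA; apply: subgroupMn.
Qed.

Lemma rank_le_inQ s : rank_le s S -> rank_le s (inQ S).
Proof.
move=> rk l f /inQ_family[K K0 KS] fr; apply: (rk l _ KS) => z zE i.
have /fr/(_ i)/eqP : zcomb f (fun i => K%:Z * z i) = 0.
  by rewrite -[RHS]zE; apply: eq_bigr => j _; rewrite mulrzA -pmulrn.
by rewrite mulf_eq0 eqz_nat eqn0Ngt K0 => /eqP.
Qed.

End RationalSpan.

Lemma zbasis_full (U : zmodType) (S : set U) n (b : 'I_n -> U) :
  zbasis S b -> rank_le n [set: U] -> forall x, inQ S x.
Proof.
move=> bS rk x; have sS := zbasis_subgroup bS.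
suff [z [z0 zE]] : exists z : 'I_n.+1 -> int, z ord0 != 0 /\ zcomb (fam_cons x b) z = 0.
  exists `|z ord0|%N; first by rewrite absz_gt0.
  apply: (subgroup_absz sS); move/eqP: zE; rewrite zcomb_cons addr_eq0 => /eqP ->.
  by apply: (subgroupN sS); apply: (subgroup_zcomb _ sS) => i; exact: (zbasis_mem bS).
apply: contrapT => nz; suff /(rk _ (fam_cons x b) (fun=> I)) : zfree (fam_cons x b).
  by rewrite ltnn.
move=> z zE; have z0 : z ord0 = 0 by apply: contrapT => /eqP z0; apply: nz; exists z.
move=> i; case: (unliftP ord0 i) => [j|] -> //; move: j.
by apply: (zbasis_free bS); rewrite -[RHS]zE zcomb_cons z0 mulr0z add0r.
Qed.

Lemma common_denominator (I : finType) (q : I -> rat) :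
  exists (N : nat) (z : I -> int), (0 < N)%N /\ forall i, q i * N%:R = (z i)%:~R.
Proof.
pose N := \prod_i `|denq (q i)|%N.
have N0 : (0 < N)%N by rewrite prodn_gt0 // => i; rewrite absz_gt0 denq_neq0.
exists N, (fun i => numq (q i) * (\prod_(j | j != i) `|denq (q j)|%N)%:Z); split=> // i.
rewrite /N (bigD1 i) //= natrM mulrA intrM; congr (_ * _).
have -> : `|denq (q i)|%N%:R = (denq (q i))%:~R :> rat.
  by rewrite natr_absz gtr0_norm ?denq_gt0.
by rewrite -{1}[q i]divq_num_den divfK // intr_eq0 denq_neq0.
Qed.

Lemma int_kernel l n (A : 'M[rat]_(l, n)) : (n < l)%N ->
  exists2 z : 'I_l -> int, (exists i, z i != 0)
    & forall j, \sum_i (z i)%:~R * A i j = 0.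
Proof.
move=> nl; have : kermx A != 0.
  by rewrite kermx_eq0 -row_leq_rank -ltnNge (leq_ltn_trans (rank_leq_col A)).
move=> /eqP /matrixP /existsNP[i0] /existsNP[j0]; rewrite [X in _ <> X]mxE => k0.
pose u := row i0 (kermx A).
have uA : u *m A = 0 by apply/sub_kermxP; exact: row_sub.
have [N [z [N0 zE]]] := common_denominator (fun i => u 0 i).
have Nn : N%:R != 0 :> rat by rewrite pnatr_eq0 -lt0n.
exists z.
  exists j0; apply/eqP => zj; apply: k0; move: (zE j0); rewrite zj mulr0z.
  by move/eqP; rewrite mulf_eq0 (negPf Nn) orbF mxE => /eqP.
move=> j; under eq_bigr do rewrite -zE mulrAC.
rewrite -mulr_suml; have /matrixP/(_ 0 j) := uA; rewrite !mxE => ->.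
by rewrite mul0r.
Qed.

(** * Biadditive maps *)

Definition biadditive (U V A : zmodType) (h : U -> V -> A) : Prop :=
  (forall y, zmod_morphism (h^~ y)) /\ (forall x, zmod_morphism (h x)).

Section Biadditive.
Variables (U V A : zmodType) (h : U -> V -> A).
Hypothesis hB : biadditive h.

Let hl y : {additive U -> A} :=
  HB.pack (h^~ y) (GRing.isZmodMorphism.Build U A (h^~ y) (hB.1 y)).
Let hr x : {additive V -> A} :=
  HB.pack (h x) (GRing.isZmodMorphism.Build V A (h x) (hB.2 x)).

Lemma biadd0l y : h 0 y = 0. Proof. exact: (raddf0 (hl y)). Qed.

Lemma biaddDl x x' y : h (x + x') y = h x y + h x' y.
Proof. exact: (raddfD (hl y)). Qed.

Lemma biaddDr x y y' : h x (y + y') = h x y + h x y'.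
Proof. exact: (raddfD (hr x)). Qed.

Lemma biaddBl x x' y : h (x - x') y = h x y - h x' y. Proof. exact: hB.1. Qed.

Lemma biaddBr x y y' : h x (y - y') = h x y - h x y'. Proof. exact: hB.2. Qed.

Lemma biaddMnl x y n : h (x *+ n) y = h x y *+ n.
Proof. exact: (raddfMn (hl y)). Qed.

Lemma biaddMnr x y n : h x (y *+ n) = h x y *+ n.
Proof. exact: (raddfMn (hr x)). Qed.

Lemma biaddMzl x y (z : int) : h (x *~ z) y = h x y *~ z.
Proof. exact: (raddfMz (hl y)). Qed.

Lemma biaddMzr x y (z : int) : h x (y *~ z) = h x y *~ z.
Proof. exact: (raddfMz (hr x)). Qed.

Lemma biadd_suml (I : finType) (P : pred I) (f : I -> U) y :
  h (\sum_(i | P i) f i) y = \sum_(i | P i) h (f i) y.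
Proof. exact: (raddf_sum (hl y)). Qed.

Lemma biadd_sumr (I : finType) (P : pred I) x (f : I -> V) :
  h x (\sum_(i | P i) f i) = \sum_(i | P i) h x (f i).
Proof. exact: (raddf_sum (hr x)). Qed.

End Biadditive.

Section BiadditiveRing.
Variables (U V : zmodType) (A : pzRingType) (h : U -> V -> A).
Hypothesis hB : biadditive h.

Lemma biadd_zcombl n (b : 'I_n -> U) (z : 'I_n -> int) y :
  h (zcomb b z) y = \sum_i (z i)%:~R * h (b i) y.
Proof.
by rewrite (biadd_suml hB); apply: eq_bigr => i _; rewrite (biaddMzl hB) mulrzl.
Qed.

Lemma biadd_zcombr n (b : 'I_n -> V) (z : 'I_n -> int) x :
  h x (zcomb b z) = \sum_i (z i)%:~R * h x (b i).
Proof.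
by rewrite (biadd_sumr hB); apply: eq_bigr => i _; rewrite (biaddMzr hB) mulrzl.
Qed.

End BiadditiveRing.

Definition symmetric_form (U : zmodType) (A : zmodType) (h : U -> U -> A) : Prop :=
  biadditive h /\ forall x y, h x y = h y x.

Lemma symmetric_formI (U A : zmodType) (h : U -> U -> A) :
  (forall x x' y, h (x + x') y = h x y + h x' y) -> (forall x y, h x y = h y x) ->
  symmetric_form h.
Proof.
move=> hD hC; split=> //; have hB x x' y : h (x - x') y = h x y - h x' y.
  by apply/eqP; rewrite eq_sym subr_eq -hD subrK.
by split=> [y x x'|x y y'] //; rewrite hC hB !(hC x).
Qed.

Lemma form_mulz (U : zmodType) (A : pzRingType) (h : U -> U -> A) x (z : int) : biadditive h ->
  h (x *~ z) (x *~ z) = z%:~R ^+ 2 * h x x.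
Proof. by move=> hB; rewrite (biaddMzl hB) (biaddMzr hB) -mulrzA -mulrzl intrM expr2. Qed.

Lemma form_mulrn (U : zmodType) (A : pzRingType) (h : U -> U -> A) x n : biadditive h ->
  h (x *+ n) (x *+ n) = n%:R ^+ 2 * h x x.
Proof. by move=> hB; rewrite !pmulrn form_mulz. Qed.

Lemma form_sum_le (U : zmodType) (A : realFieldType) (h : U -> U -> A) n (g : 'I_n -> U) :
  symmetric_form h -> (forall x, 0 <= h x x) ->
  h (\sum_i g i) (\sum_i g i) <= n%:R * \sum_i h (g i) (g i).
Proof.
move=> [hB hC] h0.
have le2 x y : h x y <= (h x x + h y y) / 2%:R.
  have := h0 (x - y); rewrite (biaddBl hB) !(biaddBr hB) (hC y x).
  by move: (h x x) (h x y) (h y y) => a b c; lra.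
rewrite (biadd_suml hB); under eq_bigr do rewrite (biadd_sumr hB).
apply: (@le_trans _ _ (\sum_i \sum_j (h (g i) (g i) + h (g j) (g j)) / 2%:R)).
  by apply: ler_sum => i _; apply: ler_sum => j _; exact: le2.
under eq_bigr do rewrite -mulr_suml big_split /= sumr_const card_ord.
rewrite -mulr_suml big_split /= sumr_const card_ord sumrMnl -mulr_natl.
by set S := \sum_i _; lra.
Qed.

Lemma sum_sqr_le (A : realFieldType) n (a : 'I_n -> A) :
  (\sum_i a i) ^+ 2 <= n%:R * \sum_i a i ^+ 2.
Proof.
have hS : symmetric_form (fun x y : A => x * y).
  by apply: symmetric_formI => *; [rewrite mulrDl|rewrite mulrC].
by apply: (form_sum_le a hS) => x; rewrite -expr2 sqr_ge0.
Qed.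
(** * Hermite reduction *)

Lemma round_half (A : archiRealFieldType) (x : A) :
  exists z : int, (x + z%:~R) ^+ 2 <= 4%:R^-1.
Proof.
exists (- Num.floor (x + 2%:R^-1)).
have := floor_le (x + 2%:R^-1); have := floorD1_gt (x + 2%:R^-1).
rewrite intrD intrN; set z := (_%:~R) => h1 h2; nra.
Qed.

Section AlmostMinimum.
Variables (U : Type) (A : archiRealFieldType) (S : set U) (f : U -> A) (c : A).
Hypothesis c_gt0 : 0 < c.
Hypothesis f_discrete : forall x, S x -> f x = 0 \/ c <= f x.

Lemma almost_minimum x : S x -> 0 < f x ->
  exists y, [/\ S y, 0 < f y & forall z, S z -> 0 < f z -> f y <= 2%:R * f z].
Proof.
move=> Sx fx.
have [N hN] : exists N : nat, f x <= 2%:R ^+ N * c.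
  exists (Num.bound (f x / c)); rewrite -ler_pdivrMr //.
  apply: (le_trans (ltW (archi_boundP _))); first by rewrite divr_ge0 ?ltW.
  by rewrite -natrX ler_nat ltnW // ltn_expl.
elim: N x Sx fx hN => [|N IH] x Sx fx hN.
  exists x; split=> // z Sz fz; have [hz|hz] := f_discrete Sz; first by rewrite hz ltxx in fz.
  by move: hN; rewrite expr0; lra.
have [H|/existsNP[y]] := pselect (forall z, S z -> 0 < f z -> f x <= 2%:R * f z).
  by exists x.
move=> /not_implyP[Sy] /not_implyP[fy] /negP; rewrite -ltNge => lt.
apply: (IH y) => //; move: hN; rewrite exprS; set a := _ ^+ N; nra.
Qed.

End AlmostMinimum.

Fixpoint hermite_const (s : nat) : nat :=
  if s is s'.+1 then (s'.+1 * (s' * hermite_const s').+1 + 2 * hermite_const s')%N else 1.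

Lemma hermite_const_gt0 s : (0 < hermite_const s)%N.
Proof. by case: s => //= s; rewrite addn_gt0. Qed.

Section Forms.
Variables (U : zmodType) (A : numDomainType) (h : U -> U -> A).

Definition hermite_reduced (C : A) r (x : 'I_r -> U) : Prop :=
  forall (z : 'I_r -> int) i,
    (z i)%:~R ^+ 2 * h (x i) (x i) <= C * h (zcomb x z) (zcomb x z).

Definition discrete_form (c : A) (S : set U) : Prop :=
  forall x, S x -> h x x = 0 \/ c <= h x x.

Definition form_rank_le (s : nat) (S : set U) : Prop :=
  forall l (f : 'I_l -> U), (forall i, S (f i)) ->
    (forall z : 'I_l -> int, h (zcomb f z) (zcomb f z) = 0 -> forall i, z i = 0) ->
    (l <= s)%N.

End Forms.

Lemma form_cauchy_schwarz (U : zmodType) (S : set U) (h : U -> U -> rat) x y :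
  subgroup S -> symmetric_form h -> (forall u, S u -> 0 <= h u u) ->
  S x -> S y -> 0 < h x x -> h x y ^+ 2 <= h x x * h y y.
Proof.
move=> sS [hB hC] h0 Sx Sy hx.
have [N [z [N0 zE]]] := common_denominator (fun b : bool => if b then h x x else h x y).
have := h0 (y *~ z true - x *~ z false) (subgroupB sS (subgroupMz sS _ Sy) (subgroupMz sS _ Sx)).
rewrite (biaddBl hB) !(biaddBr hB) !(biaddMzl hB) !(biaddMzr hB) -!mulrzA -!(mulrzl (h _ _)) !intrM.
rewrite -(zE true) -(zE false) (hC y x).
have : 0 < N%:R ^+ 2 :> rat by rewrite exprn_gt0 ?ltr0n.
move: hx; move: (h x x) (h x y) (h y y) (N%:R) => a b e n a0 n0 H.
rewrite -subr_ge0 -(pmulr_rge0 _ (mulr_gt0 n0 a0)); apply: le_trans H _.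
by rewrite le_eqVlt; apply/orP; left; apply/eqP; ring.
Qed.

Section HermiteStep.
Variables (U : zmodType) (S : set U) (h : U -> U -> rat) (c : rat) (x1 : U).
Hypothesis sS : subgroup S.
Hypothesis hS : symmetric_form h.
Hypothesis c_gt0 : 0 < c.
Hypothesis h_discrete : discrete_form h c S.
Hypothesis Sx1 : S x1.
Hypothesis hx1_gt0 : 0 < h x1 x1.
Hypothesis hx1_min : forall z, S z -> 0 < h z z -> h x1 x1 <= 2%:R * h z z.

Let hB := hS.1.
Let hC := hS.2.

Definition proj_coef (x : U) : rat := h x1 x / h x1 x1.

Definition orth_form (x y : U) : rat := h x y - proj_coef x * proj_coef y * h x1 x1.

Lemma proj_coef_is_zmod_morphism : zmod_morphism proj_coef.
Proof. by move=> x y; rewrite /proj_coef (biaddBr hB) mulrBl. Qed.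

HB.instance Definition _ :=
  GRing.isZmodMorphism.Build U rat proj_coef proj_coef_is_zmod_morphism.

Lemma proj_coef_shift z x : proj_coef (x1 *~ z + x) = z%:~R + proj_coef x.
Proof.
by rewrite raddfD raddfMz /= /proj_coef divff ?gt_eqF.
Qed.

Lemma orth_form_symmetric : symmetric_form orth_form.
Proof.
apply: symmetric_formI => [x x' y|x y]; last by rewrite /orth_form hC; ring.
by rewrite /orth_form raddfD (biaddDl hB) /=; ring.
Qed.

Lemma orth_form_shift z x : orth_form (x1 *~ z + x) (x1 *~ z + x) = orth_form x x.
Proof.
have hx : h x1 x = proj_coef x * h x1 x1 by rewrite divfK ?gt_eqF.
rewrite /orth_form proj_coef_shift (biaddDl hB) !(biaddDr hB).
by rewrite !(biaddMzl hB) !(biaddMzr hB) (hC x) -!(mulrzl (h _ _)) hx; ring.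
Qed.

Lemma form_pythagoras x : h x x = orth_form x x + proj_coef x ^+ 2 * h x1 x1.
Proof. by rewrite expr2 subrK. Qed.

Lemma discrete_form_ge0 x : S x -> 0 <= h x x.
Proof. by move=> /h_discrete[->|]//; apply: le_trans; exact: ltW. Qed.

Lemma shift_mem z x : S x -> S (x1 *~ z + x).
Proof. by move=> Sx; apply: (subgroupD sS) => //; exact: subgroupMz. Qed.

Lemma size_reduction x : S x ->
  exists2 z, S (x1 *~ z + x) & proj_coef (x1 *~ z + x) ^+ 2 <= 4%:R^-1.
Proof.
move=> Sx; have [z hz] := round_half (proj_coef x); exists z; first exact: shift_mem.
by rewrite proj_coef_shift addrC.
Qed.

Lemma proj_coef_null x : S x -> h x x = 0 -> proj_coef x = 0.
Proof.
move=> Sx hx.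
have := form_cauchy_schwarz sS hS discrete_form_ge0 Sx1 Sx hx1_gt0.
rewrite hx mulr0 => h0; suff e : h x1 x = 0 by rewrite /proj_coef e mul0r.
by apply/eqP; rewrite -sqrf_eq0 eq_le h0 sqr_ge0.
Qed.

Lemma orth_form_discrete : discrete_form orth_form (h x1 x1 / 4%:R) S.
Proof.
move=> x /size_reduction[z Sz tz]; rewrite -(orth_form_shift z).
have [hy|hy] := h_discrete Sz.
  by left; have := form_pythagoras (x1 *~ z + x); rewrite proj_coef_null // hy; lra.
right; have := hx1_min Sz (lt_le_trans c_gt0 hy); have := form_pythagoras (x1 *~ z + x).
by move: tz hx1_gt0; set p := _ ^+ 2; nra.
Qed.

Lemma orth_form_ge0 x : S x -> 0 <= orth_form x x.
Proof.
by move=> /orth_form_discrete[->|]//; apply: le_trans; rewrite divr_ge0 ?ltW.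
Qed.

Lemma orth_form_rank s : form_rank_le h s.+1 S -> form_rank_le orth_form s S.
Proof.
move=> rk l f Sf fr; rewrite -ltnS.
apply: (rk _ (fam_cons x1 f)) => [|z]; first exact: fam_consP.
rewrite zcomb_cons; set y := \sum_i _ => hX.
have Sy : S y by exact: subgroup_zcomb.
have hy : orth_form y y = 0.
  have := form_pythagoras (x1 *~ z ord0 + y).
  by rewrite hX proj_coef_null ?orth_form_shift //; [lra|exact: shift_mem].
have z0 := fr _ hy; move=> i; case: (unliftP ord0 i) => [j|] ->; first exact: z0.
move: hX; have -> : y = 0 by rewrite /y big1 // => j _; rewrite z0.
rewrite addr0 (form_mulz _ _ hB) => /eqP.
by rewrite mulf_eq0 (gt_eqF hx1_gt0) orbF expf_eq0 intr_eq0 => /eqP.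
Qed.

Section SizeReduced.
Variables (r s : nat) (C : rat) (y : 'I_r -> U).
Hypothesis r_le : (r <= s)%N.
Hypothesis C_ge1 : 1 <= C.
Hypothesis Sy : forall i, S (y i).
Hypothesis y_reduced : hermite_reduced orth_form C y.
Hypothesis y_gt0 : forall i, 0 < orth_form (y i) (y i).
Hypothesis y_size : forall i, proj_coef (y i) ^+ 2 <= 4%:R^-1.

Lemma orth_form_ge i : h x1 x1 / 4%:R <= orth_form (y i) (y i).
Proof. by have [e|//] := orth_form_discrete (Sy i); have := y_gt0 i; rewrite e ltxx. Qed.

Lemma proj_coef_le_orth_form i : proj_coef (y i) ^+ 2 * h x1 x1 <= orth_form (y i) (y i).
Proof. by have := orth_form_ge i; have := y_size i; have := hx1_gt0; nra. Qed.

Lemma hermite_reduced_head (z : 'I_r.+1 -> int) :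
  (z ord0)%:~R ^+ 2 * h x1 x1 <= s.+1%:R * (1 + s%:R * C) *
    h (zcomb (fam_cons x1 y) z) (zcomb (fam_cons x1 y) z).
Proof.
set z' := fun i => z (lift ord0 i); set X := zcomb _ _.
have XE : X = x1 *~ z ord0 + zcomb y z' by exact: zcomb_cons.
have SX : S X by apply: subgroup_zcomb => //; exact: fam_consP.
have hX := form_pythagoras X; have hX0 := orth_form_ge0 SX.
pose a := fam_cons (proj_coef X) (fun i => - (proj_coef (y i) * (z' i)%:~R)).
have -> : (z ord0)%:~R = \sum_i a i.
  rewrite big_ord_recl /a fam_cons0; under eq_bigr do rewrite fam_consS.
  rewrite XE proj_coef_shift raddf_sum sumrN /=.
  by under eq_bigr do rewrite raddfMz /= -mulrzr; rewrite addrK.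
have tail : (\sum_i a (lift ord0 i) ^+ 2) * h x1 x1 <= s%:R * (C * orth_form X X).
  have CX : 0 <= C * orth_form X X by rewrite mulr_ge0 // (le_trans ler01).
  apply: (@le_trans _ _ (\sum_(i < r) C * orth_form X X)).
    rewrite mulr_suml; apply: ler_sum => i _; rewrite /a fam_consS sqrrN.
    apply: (@le_trans _ _ ((z' i)%:~R ^+ 2 * orth_form (y i) (y i))).
      by rewrite exprMn mulrAC mulrC ler_wpM2l ?sqr_ge0 ?proj_coef_le_orth_form.
    by apply: (le_trans (y_reduced z' i)); rewrite XE orth_form_shift.
  by rewrite sumr_const card_ord -[leLHS]mulr_natl ler_wpM2r ?ler_nat.
have rs : r.+1%:R <= s.+1%:R :> rat by rewrite ler_nat.
have s0 : 0 <= s%:R :> rat by [].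
have sq0 : 0 <= \sum_i a i ^+ 2 by apply: sumr_ge0 => i _; exact: sqr_ge0.
have := sum_sqr_le a; rewrite [\sum_i a i ^+ 2]big_ord_recl {2}/a fam_cons0 => sq.
rewrite big_ord_recl {1}/a fam_cons0 in sq0.
apply: (le_trans (ler_wpM2r (ltW hx1_gt0) sq)); rewrite -!mulrA.
apply: ler_pM => //; first by rewrite mulr_ge0 // ltW.
rewrite mulrDl (mulrDl 1) mul1r; apply: lerD; first by rewrite hX lerDr.
rewrite (le_trans tail) // -[leRHS]mulrA ler_wpM2l // ler_wpM2l ?(le_trans ler01) //.
by rewrite hX lerDl mulr_ge0 ?sqr_ge0 ?ltW.
Qed.

Lemma hermite_reduced_tail (z : 'I_r.+1 -> int) j :
  (z (lift ord0 j))%:~R ^+ 2 * h (y j) (y j) <= 2%:R * C *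
    h (zcomb (fam_cons x1 y) z) (zcomb (fam_cons x1 y) z).
Proof.
have hy : h (y j) (y j) <= 2%:R * orth_form (y j) (y j).
  by rewrite [leLHS]form_pythagoras; have := proj_coef_le_orth_form j; lra.
apply: (le_trans (ler_wpM2l (sqr_ge0 _) hy)); rewrite mulrCA -mulrA ler_wpM2l //.
apply: (le_trans (y_reduced (fun i => z (lift ord0 i)) j)).
rewrite ler_wpM2l ?(le_trans ler01) // -(orth_form_shift (z ord0)) -zcomb_cons.
by rewrite [leRHS]form_pythagoras lerDl mulr_ge0 ?sqr_ge0 ?ltW.
Qed.

Lemma hermite_reduced_cons : C = (hermite_const s)%:R ->
  hermite_reduced h (hermite_const s.+1)%:R (fam_cons x1 y).
Proof.
move=> CE z i; set X := zcomb _ _.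
have X0 : 0 <= h X X.
  by apply: discrete_form_ge0; apply: subgroup_zcomb => //; exact: fam_consP.
have -> : (hermite_const s.+1)%:R = s.+1%:R * (1 + s%:R * C) + 2%:R * C.
  by rewrite CE /= natrD !natrM -(natr1 (s * _)) natrM [_ + 1]addrC.
have C0 := le_trans ler01 C_ge1; rewrite mulrDl.
case: (unliftP ord0 i) => [j|] ->; rewrite ?fam_consS ?fam_cons0.
  by rewrite ler_wpDl ?hermite_reduced_tail // (mulr_ge0 _ X0) ?mulr_ge0 ?addr_ge0 ?mulr_ge0.
by rewrite ler_wpDr ?hermite_reduced_head // (mulr_ge0 _ X0) ?mulr_ge0.
Qed.

End SizeReduced.

Lemma size_reduced_family r (x : 'I_r -> U) : (forall i, S (x i)) ->
  exists y : 'I_r -> U,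
    [/\ forall i, S (y i), forall i, proj_coef (y i) ^+ 2 <= 4%:R^-1,
        forall i, exists t, y i = x1 *~ t + x i
      & forall z, exists t, zcomb y z = x1 *~ t + zcomb x z].
Proof.
move=> Sx; have /choice[t ht] i : exists t,
    S (x1 *~ t + x i) /\ proj_coef (x1 *~ t + x i) ^+ 2 <= 4%:R^-1.
  by have [t] := size_reduction (Sx i); exists t.
exists (fun i => x1 *~ t i + x i); split=> [i|i|i|z].
- by case: (ht i).
- by case: (ht i).
- by exists (t i).
exists (\sum_i t i * z i); rewrite mulrz_sumr -big_split /=; apply: eq_bigr => i _.
by rewrite mulrzDl mulrzA.
Qed.

Lemma fam_cons_generates r (y : 'I_r -> U) : (forall i, S (y i)) ->
  (forall u, S u -> exists z, orth_form (u - zcomb y z) (u - zcomb y z) = 0) ->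
  forall u, S u ->
  exists z, h (u - zcomb (fam_cons x1 y) z) (u - zcomb (fam_cons x1 y) z) = 0.
Proof.
move=> Sy gen u Su; have [z hz] := gen u Su.
have Sv : S (u - zcomb y z) by apply: (subgroupB sS) => //; exact: subgroup_zcomb.
have [t St t_size] := size_reduction Sv.
exists (fam_cons (- t) z); rewrite zcomb_cons fam_cons0.
under eq_bigr do rewrite fam_consS.
rewrite opprD mulrNz opprK addrCA; set v := _ + _ in St t_size *.
have hv : h v v = proj_coef v ^+ 2 * h x1 x1.
  by rewrite form_pythagoras /v orth_form_shift hz add0r.
have [//|hcv] := h_discrete St; have := hx1_min St (lt_le_trans c_gt0 hcv).
by rewrite hv; move: t_size hx1_gt0; set p := _ ^+ 2; nra.
Qed.

End HermiteStep.

Theorem hermite_reduction (U : zmodType) (S : set U) s (h : U -> U -> rat) (c : rat) :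
  subgroup S -> symmetric_form h -> 0 < c -> discrete_form h c S -> form_rank_le h s S ->
  exists r (x : 'I_r -> U),
    [/\ (r <= s)%N, forall i, S (x i) /\ 0 < h (x i) (x i),
       forall y, S y -> exists z, h (y - zcomb x z) (y - zcomb x z) = 0
     & hermite_reduced h (hermite_const s)%:R x].
Proof.
move=> sS; elim: s h c => [|s IH] h c hS c0 hc rk.
all: have [h0|] := pselect (forall x, S x -> h x x = 0).
1,3: exists 0%N, (fun=> 0); split=> [//|[]//|y Sy|? []//].
1,2: by exists (fun=> 0); rewrite big_ord0 subr0 h0.
all: move=> /existsNP[x0] /not_implyP[Sx0 hx0].
all: have {}hx0 : 0 < h x0 x0 by case: (hc _ Sx0) => // ?; apply: lt_le_trans c0 _.
  suff : (1 <= 0)%N by [].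
  apply: (rk _ (fun=> x0)) => // z; rewrite big_ord1 (form_mulz _ _ hS.1) => /eqP.
  rewrite mulf_eq0 (gt_eqF hx0) orbF expf_eq0 intr_eq0 => /eqP z0 i.
  by rewrite (ord1 i).
have [x1 [Sx1 h1 min1]] := almost_minimum c0 hc Sx0 hx0.
have h'S := orth_form_symmetric x1 hS.
have h'c := orth_form_discrete sS hS c0 hc Sx1 h1 min1.
have [||r [x [rs Sx gx Hx]]] := IH (orth_form h x1) _ h'S _ h'c; first by rewrite divr_gt0.
  exact: (orth_form_rank sS hS c0 hc Sx1 h1).
have [y [Sy y_size yE y_sum]] := size_reduced_family sS hS Sx1 h1 (fun i => (Sx i).1).
have shift := orth_form_shift hS h1.
have y_red : hermite_reduced (orth_form h x1) (hermite_const s)%:R y.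
  by move=> z i; have [t ->] := yE i; have [w ->] := y_sum z; rewrite !shift; exact: Hx.
have y0 i : 0 < orth_form h x1 (y i) (y i).
  by have [t ->] := yE i; rewrite shift; case: (Sx i).
have C1 : 1 <= (hermite_const s)%:R :> rat by rewrite ler1n hermite_const_gt0.
exists r.+1, (fam_cons x1 y); split=> //.
- apply: (fam_consP (P := fun u => S u /\ 0 < h u u)) => // i; split=> //.
  by rewrite (form_pythagoras x1 hS) ltr_pwDl ?y0 // mulr_ge0 ?sqr_ge0 ?ltW.
- apply: (fam_cons_generates sS hS c0 hc) => // u /gx[z hz]; exists z.
  by have [t ->] := y_sum z; rewrite opprD addrCA -mulrNz shift.
- exact: (hermite_reduced_cons sS hS c0 hc Sx1 h1 min1 rs C1 Sy).
Qed.

Lemma discrete_zspan (U : zmodType) (h : U -> U -> rat) (S : set U) :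
  biadditive h -> in_zspan S -> (forall x, S x -> 0 <= h x x) ->
  exists2 c : rat, 0 < c & discrete_form h c S.
Proof.
move=> hB [n [b sub]] pos.
have [N [w [N0 wE]]] := common_denominator (fun p : 'I_n * 'I_n => h (b p.1) (b p.2)).
have Np : 0 < N%:R :> rat by rewrite ltr0n.
exists N%:R^-1 => [|x Sx]; first by rewrite invr_gt0.
have [z xE] := sub _ Sx.
have [v vE] : exists v : int, h x x * N%:R = v%:~R.
  exists (\sum_i \sum_j z i * z j * w (i, j)).
  rewrite {1}xE (biadd_zcombl hB) mulr_suml rmorph_sum; apply: eq_bigr => i _.
  rewrite xE (biadd_zcombr hB) mulr_sumr mulr_suml rmorph_sum; apply: eq_bigr => j _.
  by rewrite /= !intrM -(wE (i, j)) !mulrA.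
have := pos _ Sx; rewrite le_eqVlt => /orP[/eqP <-|hx]; first by left.
right; rewrite -[_^-1]mul1r ler_pdivrMr // vE.
have : 0 < v%:~R :> rat by rewrite -vE mulr_gt0.
by rewrite ltr0z => v0; rewrite -[1]/(1%:~R) ler_int.
Qed.

(* A subgroup of a finitely generated group of rank at most [s]; it is given by
   containment so that subgroups inherit it for free. *)
Definition zlattice (U : zmodType) (s : nat) (S : set U) : Prop :=
  [/\ subgroup S, in_zspan S & rank_le s S].

Lemma zlattice_le (U : zmodType) s s' (S : set U) : (s <= s')%N -> zlattice s S -> zlattice s' S.
Proof. by move=> ss' [sS Sspan rk]; split=> // l f Sf fr; exact: leq_trans (rk _ _ Sf fr) ss'. Qed.

Theorem hermite_basis (U : zmodType) (h : U -> U -> rat) (S : set U) s :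
  symmetric_form h -> zlattice s S -> (forall x, S x -> x != 0 -> 0 < h x x) ->
  exists r (x : 'I_r -> U),
    [/\ (r <= s)%N, zbasis S x, forall i, 0 < h (x i) (x i)
     & hermite_reduced h (hermite_const s)%:R x].
Proof.
move=> hS [sS sub rk] pos; have hB := hS.1.
have h0 x : S x -> h x x = 0 -> x = 0.
  by move=> Sx hx; apply/eqP/negPn/negP => /(pos _ Sx); rewrite hx ltxx.
have pos0 x : S x -> 0 <= h x x.
  by move=> Sx; have [->|/(pos _ Sx)/ltW//] := eqVneq x 0; rewrite (biadd0l hB).
have [c c0 hc] := discrete_zspan hB sub pos0.
have [|r [x [rs Sx gx Hx]]] := hermite_reduction sS hS c0 hc (s := s).
  by move=> l f Sf fr; apply: (rk l f Sf) => z zE; apply: fr; rewrite zE (biadd0l hB).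
have Ssum z : S (zcomb x z) by apply: subgroup_zcomb => // i; case: (Sx i).
exists r, x; split=> // [|i]; last by case: (Sx i).
split=> [y|z zE i].
  split=> [Sy|[z ->]]; last exact: Ssum.
  have [z hz] := gx y Sy; exists z; apply/eqP; rewrite -subr_eq0; apply/eqP.
  by apply: h0 => //; apply: (subgroupB sS).
have := Hx z i; rewrite zE (biadd0l hB) mulr0 => hz.
apply/eqP; rewrite -(@intr_eq0 rat) -sqrf_eq0.
by rewrite eq_le sqr_ge0 andbT -(pmulr_lle0 _ (Sx i).2).
Qed.
(** * Dual vectors and discriminants *)

Lemma hermite_reduced_dual_le (U : zmodType) (A : realFieldType) (h : U -> U -> A) (C c : A)
    r (x : 'I_r -> U) (z : 'I_r -> int) i : biadditive h -> 0 <= C -> hermite_reduced h C x ->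
  (forall l, h (zcomb x z) (x l) = c * (i == l)%:R) -> 0 <= h (zcomb x z) (zcomb x z) ->
  h (zcomb x z) (zcomb x z) * h (x i) (x i) <= C * c ^+ 2.
Proof.
move=> hB C0 red dual; set u := zcomb x z; have huE : h u u = (z i)%:~R * c.
  rewrite {2}/u (biadd_zcombr hB) (bigD1 i) //= dual eqxx mulr1 big1 ?addr0 // => l.
  by rewrite dual eq_sym => /negPf ->; rewrite !mulr0.
rewrite le_eqVlt => /orP[/eqP <-|u0]; first by rewrite mul0r mulr_ge0 ?sqr_ge0.
have hx := red z i; rewrite -/u in hx.
rewrite -(ler_pM2l u0); apply: (@le_trans _ _ (c ^+ 2 * (C * h u u))); last first.
  by rewrite le_eqVlt; apply/orP; left; apply/eqP; ring.
apply: le_trans (ler_wpM2l (sqr_ge0 c) hx); rewrite huE.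
by rewrite le_eqVlt; apply/orP; left; apply/eqP; ring.
Qed.

Lemma hermite_reduced_exists_le (U : zmodType) (A : realFieldType) (h : U -> U -> A) (C : A)
    r (x : 'I_r -> U) (z : 'I_r -> int) : hermite_reduced h C x -> (forall i, 0 <= h (x i) (x i)) ->
  zcomb x z != 0 -> exists j, h (x j) (x j) <= C * h (zcomb x z) (zcomb x z).
Proof.
move=> red x0 zx0; have [j zj] : exists j, z j != 0.
  apply: contrapT => none; move/eqP: zx0; apply; apply: big1 => j _.
  suff -> : z j = 0 by rewrite mulr0z.
  by apply/eqP/negPn/negP => zj; apply: none; exists j.
exists j; apply: le_trans (red z j); rewrite ler_peMl // -rmorphXn /= -[1]/(1%:~R) ler_int.
by rewrite -[leRHS]real_normK ?num_real // exprn_ege1 // -gtz0_ge1 normr_gt0.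
Qed.

Definition additive_on (U A : zmodType) (S : set U) (f : U -> A) : Prop :=
  forall x y, S x -> S y -> f (x + y) = f x + f y.

Section AdditiveOn.
Variables (U A : zmodType) (S : set U) (f : U -> A).
Hypothesis sS : subgroup S.
Hypothesis fS : additive_on S f.

Lemma additive_on_sum (I : finType) (g : I -> U) :
  (forall i, S (g i)) -> f (\sum_i g i) = \sum_i f (g i).
Proof.
move=> Sg; have f0 : f 0 = 0.
  by apply: (addrI (f 0)); rewrite -fS ?addr0 //; exact: subgroup0.
suff [] : S (\sum_i g i) /\ f (\sum_i g i) = \sum_i f (g i) by [].
elim/big_rec2: _ => [|i a x _ [Sx <-]]; first by split; [exact: subgroup0|].
by split; [exact: subgroupD|exact: fS].
Qed.

Lemma additive_onMn x n : S x -> f (x *+ n) = f x *+ n.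
Proof. by move=> Sx; rewrite -[n]card_ord -!sumr_const additive_on_sum. Qed.

Lemma additive_onMz x (z : int) : S x -> f (x *~ z) = f x *~ z.
Proof.
move=> Sx; case: z => n; first exact: additive_onMn.
have Sn : S (x *+ n.+1) by exact: subgroupMn.
rewrite !NegzE !mulrNz -!pmulrn -additive_onMn //.
apply: (addIr (f (x *+ n.+1))); rewrite -fS //; last exact: subgroupN.
by rewrite !addNr -(mulr0n (0 : U)) additive_onMn ?mulr0n //; exact: subgroup0.
Qed.

Lemma additive_on_zcomb n (b : 'I_n -> U) (z : 'I_n -> int) :
  (forall i, S (b i)) -> f (zcomb b z) = \sum_i f (b i) *~ z i.
Proof.
move=> Sb; rewrite additive_on_sum => [|i]; last exact: subgroupMz.
by apply: eq_bigr => i _; rewrite additive_onMz.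
Qed.

Lemma zbasis_additive_neq0 n (b : 'I_n -> U) :
  zbasis S b -> (exists2 x, S x & f x != 0) -> exists i, f (b i) != 0.
Proof.
move=> bS [_ /bS.1[z ->] fz]; apply: contrapT => none; move/eqP: fz; apply.
rewrite additive_on_zcomb => [|i]; last exact: (zbasis_mem bS).
apply: big1 => i _; suff -> : f (b i) = 0 by rewrite mul0rz.
by apply/eqP/negPn/negP => fbi; apply: none; exists i.
Qed.

End AdditiveOn.

Lemma zbasis_coord_additive (U : zmodType) (S : set U) n (b : 'I_n -> U)
    (co : U -> 'I_n -> int) i :
  zbasis S b -> (forall x, S x -> x = zcomb b (co x)) -> additive_on S (co^~ i).
Proof.
move=> bS coE x y Sx Sy; have Sxy := subgroupD (zbasis_subgroup bS) Sx Sy.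
apply: (zbasis_inj bS (z := co (x + y)) (w := fun i => co x i + co y i)).
rewrite -coE // {1}(coE x Sx) {1}(coE y Sy) -big_split /=.
by apply: eq_bigr => j _; rewrite mulrzDr.
Qed.

(* The integer [q] kills the cokernel of the map from [S] to its integral dual. *)
Definition dual_exponent (U : zmodType) (E : U -> U -> rat) (S : set U) (q : nat) : Prop :=
  forall lam : U -> int, additive_on S lam ->
  exists2 w, S w & forall x, S x -> E w x = q%:R * (lam x)%:~R.

Lemma dual_exponent_basis (U : zmodType) (E : U -> U -> rat) (S : set U) q n (b : 'I_n -> U) :
  zbasis S b -> dual_exponent E S q ->
  exists w : 'I_n -> U, forall i,
    S (w i) /\ forall z : 'I_n -> int, E (w i) (zcomb b z) = q%:R * (z i)%:~R.
Proof.
move=> bS dS; have [co coE] := zbasis_coord bS.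
have /choice[w wP] i : exists u, S u /\ forall x, S x -> E u x = q%:R * (co x i)%:~R.
  by have [u] := dS _ (zbasis_coord_additive i bS coE); exists u.
exists w => i; have [Sw wE] := wP i; split=> // z.
have Sz : S (zcomb b z) by apply/bS.1; exists z.
by rewrite wE // (zbasis_inj bS (z := co (zcomb b z)) (w := z)) -?coE.
Qed.

Definition integral_on (U : zmodType) (E : U -> U -> rat) (S : set U) : Prop :=
  forall x y, S x -> S y -> E x y \is a Num.int.

Section GramDiscriminant.
Variables (U : zmodType) (E : U -> U -> rat) (L : set U).
Hypothesis EB : biadditive E.
Hypothesis Eint : integral_on E L.
Hypothesis Enondeg : forall x, L x -> (forall y, L y -> E x y = 0) -> x = 0.

Lemma gram_det_dual_exponent r (c : 'I_r -> U) : zbasis L c ->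
  exists q : nat, [/\ (0 < q)%N, `|\det (\matrix_(i, j) E (c i) (c j))| = q%:R
    & dual_exponent E L q].
Proof.
move=> cL; have sL := zbasis_subgroup cL; have Lc i : L (c i) := zbasis_mem cL i.
have /choice[g gE] (p : 'I_r * 'I_r) : exists z : int, E (c p.1) (c p.2) = z%:~R.
  by have /intrP := Eint (Lc p.1) (Lc p.2).
pose G := \matrix_(i, j) g (i, j).
have detG : \det (\matrix_(i, j) E (c i) (c j)) = (\det G)%:~R.
  by rewrite -det_map_mx; congr (\det _); apply/matrixP => i j; rewrite !mxE; exact: (gE (i, j)).
have EG (z : 'rV_r) j : E (\sum_i c i *~ z 0 i) (c j) = ((z *m G) 0 j)%:~R.
  rewrite (biadd_zcombl EB) mxE rmorph_sum; apply: eq_bigr => i _.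
  by rewrite rmorphM /= !mxE -(gE (i, j)).
have Lcomb z : L (zcomb c z) by exact: subgroup_zcomb.
have G0 : \det G != 0.
  apply/det0P => -[v /rV0Pn[i vi] vG]; move/eqP: vi; apply.
  apply: (zbasis_free cL (z := fun i => v 0 i)); apply: Enondeg => // y /cL.1[w ->].
  by rewrite (biadd_zcombr EB) big1 // => j _; rewrite EG vG mxE mulr0.
exists `|\det G|%N; split; first by rewrite absz_gt0.
  by rewrite detG -intr_norm natr_absz.
move=> lam lamS; pose z := sgz (\det G) *: (\row_i lam (c i) *m \adj G).
have zG j : (z *m G) 0 j = `|\det G|%N%:Z * lam (c j).
  by rewrite -scalemxAl -mulmxA mul_adj_mx mul_mx_scalar scalerA -abszEsg !mxE.
exists (\sum_i c i *~ z 0 i) => // x /cL.1[w ->].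
rewrite (biadd_zcombr EB) (additive_on_zcomb sL lamS) // rmorph_sum mulr_sumr /=.
by apply: eq_bigr => j _; rewrite EG zG intrM -[lam _ *~ _]mulrzr intz intrM mulrC -mulrA.
Qed.

Lemma gram_disc_dual_exponent r (c : 'I_r -> U) : zbasis L c ->
  exists q : nat, [/\ (0 < q)%N, `|gram_disc E L| = q%:R & dual_exponent E L q].
Proof.
move=> cL; rewrite /gram_disc; set P := [set d | _].
have [s [b [bL ->]]] : P (xget 0 P).
  by apply: (xgetPex 0); exists (\det (\matrix_(i, j) E (c i) (c j))), r, c.
exact: gram_det_dual_exponent.
Qed.

End GramDiscriminant.

Lemma int_det_le (K : realFieldType) r (A : 'M[int]_r) (d : 'I_r -> K) (B : K) :
  1 <= B -> (forall i, 0 < d i) ->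
  (forall i j, (A i j)%:~R ^+ 2 * d j <= B * d i) ->
  `|\det A|%:~R <= r`!%:R * B ^+ r.
Proof.
move=> B1 d0 AB.
have prod_le (s : 'S_r) : `|\prod_i A i (s i)|%:~R <= B ^+ r.
  have dd : 0 < \prod_i d i by apply: prodr_gt0 => i _; exact: d0.
  apply: (@le_trans _ _ ((\prod_i A i (s i))%:~R ^+ 2)).
    rewrite -rmorphXn /= ler_int -[leRHS]real_normK ?num_real //.
    by move: `|_| (normr_ge0 (\prod_i A i (s i))) => v v0; rewrite expr2; nia.
  rewrite -(ler_pM2r dd).
  have {1}-> : \prod_i d i = \prod_i d (s i) by rewrite [LHS](reindex_inj (@perm_inj _ s)).
  rewrite rmorph_prod -prodrXl.
  rewrite -big_split /= -[r in B ^+ r]card_ord -prodr_const -big_split /=.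
  apply: ler_prod => i _; rewrite AB andbT.
  by rewrite mulr_ge0 ?sqr_ge0 // ltW.
have : `|\det A|%:~R <= \sum_(s : 'S_r) `|\prod_i A i (s i)|%:~R :> K.
  rewrite -rmorph_sum ler_int (le_trans (ler_norm_sum _ _ _)) //; apply: ler_sum => s _.
  by rewrite normrM normrX normrN1 expr1n mul1r.
move/le_trans; apply; apply: (@le_trans _ _ (\sum_(s : 'S_r) B ^+ r)).
  by apply: ler_sum => s _; exact: prod_le.
by rewrite sumr_const card_Sn -[leLHS]mulr_natl.
Qed.

(** * Index of a subgroup *)

Lemma has_index_of_cover (U : zmodType) (L N : set U) (T : finType) (f : T -> U) :
  subgroup N -> N `<=` L -> (forall t, L (f t)) ->
  (forall x, L x -> exists t, N (x - f t)) ->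
  exists2 k : nat, has_index L N k & (k <= #|T|)%N.
Proof.
move=> sN NL Lf cover.
pose eqN t := [pred u | `[< N (f t - f u) >]].
pose rep t := odflt t [pick u | eqN t u].
have N_rep t : N (f t - f (rep t)).
  rewrite /rep; case: pickP => [u /asboolP//|_] /=.
  by rewrite subrr; exact: subgroup0.
have rep_eq t u : N (f t - f u) -> rep t = rep u.
  move=> tu; suff eq_tu : eqN t =1 eqN u.
    rewrite /rep (eq_pick eq_tu); case: pickP => //= /(_ u) /asboolP[].
    by rewrite subrr; exact: subgroup0.
  move=> w; apply/asboolP/asboolP => Nw.
    exact: subgroup_subl tu Nw.
  exact: subgroup_sub_trans tu Nw.
have rep_rep t : rep (rep t) = rep t by rewrite -(rep_eq _ _ (N_rep t)).
pose K := [pred t | rep t == t].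
exists #|K|; last exact: max_card.
split=> //; exists (fun i => f (enum_val i)); split=> // x Lx.
have [t xt] := cover x Lx; have Kt : rep t \in K by rewrite inE rep_rep.
exists (enum_rank_in Kt (rep t)); split=> [|j xj].
  by rewrite enum_rankK_in //; exact: subgroup_sub_trans xt (N_rep t).
apply: enum_val_inj; rewrite enum_rankK_in //.
have /eqP <- : rep (enum_val j) == enum_val j := enum_valP j; apply: rep_eq.
exact: subgroup_subl xt xj.
Qed.

Lemma has_index_le (U : zmodType) (L N : set U) l (b : 'I_l -> U) (M : nat) :
  zbasis L b -> subgroup N -> N `<=` L -> (0 < M)%N -> (forall x, L x -> N (x *+ M)) ->
  exists2 k : nat, has_index L N k & (k <= M ^ l)%N.
Proof.
move=> bL sN NL; case: M => // M _ MN.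
pose r (g : {ffun 'I_l -> 'I_M.+1}) := \sum_i b i *~ (g i)%:Z.
have [|x /bL.1[c ->]|k kN kM] := has_index_of_cover (f := r) sN NL.
- by move=> g; apply/bL.1; exists (fun i => (g i)%:Z).
- exists [ffun i => inord `|(c i %% M.+1%:Z)%Z|].
  have -> : zcomb b c - r [ffun i => inord `|(c i %% M.+1%:Z)%Z|]
     = (\sum_i b i *~ (c i %/ M.+1%:Z)%Z) *+ M.+1.
    rewrite -sumrB -sumrMnl; apply: eq_bigr => i _.
    have mod_ge0 : 0 <= (c i %% M.+1%:Z)%Z by rewrite modz_ge0.
    have mod_lt : (`|(c i %% M.+1%:Z)%Z| < M.+1)%N.
      by rewrite -ltz_nat gez0_abs // ltz_pmod.
    rewrite ffunE inordK // gez0_abs // -mulrzBr {1}(divz_eq (c i) M.+1%:Z) addrK.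
    by rewrite mulrzA -pmulrn.
  by apply: MN; apply/bL.1; eexists.
by exists k => //; rewrite (leq_trans kM) // card_ffun !card_ord.
Qed.
(** * Traces and real embeddings *)

Section AlgTrace.
Variables (K : fieldType) (A : falgType K).

Lemma alg_trace_is_zmod_morphism : zmod_morphism (@alg_trace K A).
Proof. by move=> x y; rewrite -scaleN1r addrC alg_traceP mulN1r addrC. Qed.

HB.instance Definition _ :=
  GRing.isZmodMorphism.Build A K (@alg_trace K A) alg_trace_is_zmod_morphism.

Lemma alg_traceZ (a : K) (x : A) : alg_trace (a *: x) = a * alg_trace x.
Proof. by rewrite -[a *: x]addr0 alg_traceP raddf0 addr0. Qed.

End AlgTrace.

Lemma alg_trace_natl (F : fieldExtType rat) n (a : F) :
  alg_trace (n%:R * a) = n%:R * alg_trace a.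
Proof. by rewrite !mulr_natl raddfMn. Qed.

Lemma exists_rmorphism (A B : pzRingType) (f : A -> B) :
  {morph f : x y / x - y} -> {morph f : x y / x * y} -> f 1 = 1 ->
  exists g : {rmorphism A -> B}, g =1 f.
Proof.
move=> fB fM f1.
pose g := HB.pack_for {rmorphism A -> B} f
  (GRing.isZmodMorphism.Build A B f fB)
  (GRing.isMonoidMorphism.Build A B f (conj f1 fM)).
by exists g.
Qed.

Section Embeddings.
Variable F : fieldExtType rat.
Local Notation inF := (map_poly (in_alg F)).

Definition primitive_poly (t : F) (p : {poly rat}) : Prop :=
  (forall x : F, exists q, x = (inF q).[t]) /\ (forall q, (inF q).[t] = 0 -> p %| q).

Lemma exists_primitive_poly : exists (t : F) (p : {poly rat}),
  [/\ primitive_poly t p, size p = (\dim {:F}).+1 & separable_poly p].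
Proof.
have pcharF : [pchar F] =i pred0 := ftrans (pchar_lalg F) (@pchar_num _).
pose t := separable_generator 1%AS {:F}%AS.
have sepF : separable 1%AS {:F}%AS.
  by apply/separableP => u _; apply: pcharf0_separable.
have defF : {:F}%VS = <<1; t>>%VS :> {vspace F}.
  by rewrite (eq_adjoin_separable_generator sepF (sub1v _)).
have /polyOver1P[p Dp] := minPolyOver 1%AS t.
exists t, p; split; [split=> [x|q q0]| |].
- have : x \in <<1; t>>%VS by rewrite -defF memvf.
  by case/Fadjoin_polyP => q /polyOver1P[q' ->] ->; exists q'.
- rewrite -(dvdp_map (in_alg F)) -Dp minPoly_dvdp //; last exact/rootP.
  by apply/polyOver1P; exists q.
- by rewrite -(size_map_poly (in_alg F)) -Dp size_minPoly defF dim_Fadjoin dimv1 muln1.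
- by rewrite -(separable_map (in_alg F)) -Dp; exact: pcharf0_separable.
Qed.

Lemma root_embedding (K : fieldType) (iota : {rmorphism rat -> K}) t p z :
  primitive_poly t p -> root (map_poly iota p) z -> exists g : {rmorphism F -> K}, g t = z.
Proof.
move=> [/choice[P PE] dvd] rz; pose f x := (map_poly iota (P x)).[z].
have fE (x : F) q : x = (inF q).[t] -> f x = (map_poly iota q).[z].
  move=> xE; have /dvdpP[r rE] : p %| P x - q.
    by apply: dvd; rewrite rmorphB hornerD hornerN -xE -PE subrr.
  apply/eqP; rewrite -subr_eq0 /f -hornerN -hornerD -rmorphN -rmorphD /= rE.
  by rewrite rmorphM hornerM (rootP rz) mulr0.
have [||| g gE] := @exists_rmorphism F K f.
- move=> x y; rewrite (fE (x - y) (P x - P y)).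
    by rewrite rmorphB hornerD hornerN.
  by rewrite rmorphB hornerD hornerN -!PE.
- move=> x y; rewrite (fE (x * y) (P x * P y)).
    by rewrite rmorphM hornerM.
  by rewrite rmorphM hornerM -!PE.
- by rewrite (fE 1 1) ?rmorph1 ?hornerC.
by exists g; rewrite gE (fE t 'X) map_polyX hornerX.
Qed.

Lemma exists_closed_embeddings (K : closedFieldType) (iota : {rmorphism rat -> K}) :
  exists (t : F) (sig : 'I_(\dim {:F}) -> {rmorphism F -> K}),
    injective (fun s => sig s t).
Proof.
have [t [p [tp size_p sep_p]]] := exists_primitive_poly.
have [rs rsE] := closed_field_poly_normal (map_poly iota p).
have lead0 : lead_coef (map_poly iota p) != 0.
  by rewrite lead_coef_eq0 map_poly_eq0 -size_poly_eq0 size_p.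
have size_rs : size rs = \dim {:F}.
  apply: succn_inj; rewrite -size_p -(size_map_poly iota) rsE size_scale //.
  by rewrite size_prod_XsubC.
have uniq_rs : uniq rs.
  rewrite -separable_prod_XsubC; move: sep_p; rewrite -(separable_map iota) rsE.
  by rewrite (eqp_separable (eqp_scale _ lead0)).
have root_rs (s : 'I_(\dim {:F})) : root (map_poly iota p) rs`_s.
  by rewrite rsE rootZ // root_prod_XsubC mem_nth // size_rs.
have /choice[sig sigE] s := root_embedding tp (root_rs s).
exists t, sig => s1 s2; rewrite !sigE => /eqP.
by rewrite nth_uniq ?size_rs // => /eqP/val_inj.
Qed.

Definition real_embeddings (R : realType) (sig : 'I_(\dim {:F}) -> {rmorphism F -> R}) :
    Prop :=
  exists t : F, injective (fun s => sig s t).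

Lemma exists_real_embeddings (R : realType) : totally_real R F ->
  exists sig : 'I_(\dim {:F}) -> {rmorphism F -> R}, real_embeddings sig.
Proof.
move=> realF; have [t [sig inj]] := @exists_closed_embeddings R[i] (@ratr R[i]).
have ReE s x : sig s x = (complex.Re (sig s x))%:C%C.
  by have := realF (sig s) x; case: (sig s x) => a b /= ->.
have emb s : exists g : {rmorphism F -> R}, forall x, sig s x = (g x)%:C%C.
  have [||| g gE] := @exists_rmorphism F R (fun x => complex.Re (sig s x)).
  - by move=> x y; rewrite rmorphB; case: (sig s x) (sig s y) => a b [].
  - by move=> x y; rewrite rmorphM (ReE s x) (ReE s y) /= mulr0 subr0.
  - by rewrite rmorph1.
  by exists g => x; rewrite gE.
have /choice[g gE] := emb.
by exists g, t => s1 s2 e; apply: inj; rewrite /= !gE e.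
Qed.

End Embeddings.

Section RealEmbeddings.
Variables (R : realType) (F : fieldExtType rat).
Local Notation d := (\dim {:F}).
Variable sig : 'I_d -> {rmorphism F -> R}.
Hypothesis sigP : real_embeddings sig.
Local Notation b := (vbasis {:F}).

Let dimF_gt0 : (0 < d)%N. Proof. exact: (adim_gt0 {:F}%AS). Qed.

Lemma embeddingZ s (q : rat) x : sig s (q *: x) = ratr q * sig s x.
Proof.
by rewrite -mulr_algl rmorphM -(fmorph_eq_rat (sig s \o in_alg F)).
Qed.

Definition embedding_mx : 'M[R]_d := \matrix_(i, s) sig s b`_i.

Lemma embedding_mx_unit : embedding_mx \in unitmx.
Proof.
rewrite -unitmx_tr -row_free_unit; apply: inj_row_free => v v0.
have vsum x : \sum_s v 0 s * sig s x = 0.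
  rewrite (coord_vbasis (memvf x)).
  under eq_bigr do rewrite rmorph_sum mulr_sumr.
  rewrite exchange_big big1 //= => i _.
  under eq_bigr do rewrite embeddingZ mulrCA.
  rewrite -mulr_sumr; have /matrixP/(_ 0 i) := v0; rewrite !mxE.
  by under eq_bigr do rewrite !mxE; move=> ->; rewrite mulr0.
have [t inj_t] := sigP; pose W := Vandermonde d (\row_s sig s t).
have Wu : W \in unitmx.
  rewrite unitmxE unitfE det_Vandermonde; apply/prodf_neq0 => i _.
  apply/prodf_neq0 => j ij; rewrite !mxE subr_eq0; apply/eqP => /inj_t ji.
  by rewrite ji ltnn in ij.
have : W *m v^T = 0.
  apply/matrixP => i j; rewrite !mxE -[RHS](vsum (t ^+ i)).
  by apply: eq_bigr => s _; rewrite !mxE ord1 rmorphXn mulrC.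
move/(congr1 (mulmx (invmx W))); rewrite mulKmx // mulmx0.
by move/(congr1 trmx); rewrite trmxK trmx0.
Qed.

Lemma alg_trace_sum_embeddings (x : F) : ratr (alg_trace x) = \sum_s sig s x.
Proof.
pose Dg := diag_mx (\row_s sig s x).
have e : map_mx ratr (regular_mx x) *m embedding_mx = embedding_mx *m Dg.
  apply/matrixP => i s; rewrite mxE.
  under eq_bigr do rewrite !mxE -embeddingZ.
  rewrite -rmorph_sum /= -coord_vbasis ?memvf // rmorphM mul_mx_diag !mxE.
  by rewrite mulrC.
have -> : ratr (alg_trace x) = \tr (map_mx (@ratr R) (regular_mx x)).
  by rewrite /alg_trace trace_map_mx.
rewrite -[map_mx _ _](mulmxK embedding_mx_unit) e -mulmxA mxtrace_mulC -mulmxA.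
rewrite mulVmx ?embedding_mx_unit // mulmx1 mxtrace_diag.
by apply: eq_bigr => s _; rewrite mxE.
Qed.

Lemma embeddings_dense (tau : 'I_d -> R) (e : R) : 0 < e ->
  exists u : F, forall s, `|sig s u - tau s| <= e.
Proof.
move=> e0; pose c := (\row_s tau s) *m invmx embedding_mx.
have cE s : \sum_(i < d) c 0 i * sig s b`_i = tau s.
  have : (c *m embedding_mx) 0 s = tau s by rewrite mulmxKV ?embedding_mx_unit // mxE.
  by rewrite mxE => <-; apply: eq_bigr => i _; rewrite [embedding_mx _ _]mxE.
pose B := 1 + \sum_(s < d) \sum_(i < d) `|sig s b`_i|.
have B0 : 0 < B by rewrite ltr_pwDl // sumr_ge0 // => s _; rewrite sumr_ge0.
have /choice[q qE] i : exists q : rat, `|ratr q - c 0 i| <= e / B.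
  have [|q] := @rat_in_itvoo R (c 0 i - e / B) (c 0 i + e / B).
    by have := divr_gt0 e0 B0; lra.
  rewrite in_itv /= => /andP[h1 h2]; exists q; rewrite ler_norml; apply/andP; split; lra.
exists (\sum_(i < d) q i *: b`_i) => s.
rewrite rmorph_sum -(cE s) -sumrB /=.
under eq_bigr do rewrite embeddingZ -mulrBl.
apply: (le_trans (ler_norm_sum _ _ _)).
apply: (@le_trans _ _ (\sum_(i < d) e / B * `|sig s b`_i|)).
  by apply: ler_sum => i _; rewrite normrM ler_wpM2r.
rewrite -mulr_sumr mulrAC ler_pdivrMr // ler_wpM2l ?ltW //.
rewrite /B [X in _ < 1 + X](bigD1 s) //= addrCA ltrDl ltr_pwDl // sumr_ge0 // => i _.
by rewrite sumr_ge0.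
Qed.

Lemma embeddings_gt0_neq0 (a : F) : (forall s, 0 < sig s a) -> a != 0.
Proof.
by move=> ap; apply: contraTneq (ap (Ordinal dimF_gt0)) => ->; rewrite rmorph0 ltxx.
Qed.

Lemma alg_trace_ge0 (a : F) : (forall s, 0 <= sig s a) -> 0 <= alg_trace a.
Proof.
by move=> a0; rewrite -(ler_rat R) rmorph0 alg_trace_sum_embeddings sumr_ge0.
Qed.

Lemma alg_trace_le (a : F) (c : nat) :
  (forall s, sig s a <= c%:R) -> alg_trace a <= (d * c)%:R.
Proof.
move=> ac; rewrite -(ler_rat R) alg_trace_sum_embeddings ratr_nat.
apply: (@le_trans _ _ (\sum_(s < d) c%:R)); first exact: ler_sum.
by rewrite sumr_const card_ord mulnC natrM mulr_natr.
Qed.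

Lemma alg_trace_sqr_gt0 (x : F) : x != 0 -> 0 < alg_trace (x * x).
Proof.
move=> x0; rewrite -(ltr_rat R) rmorph0 alg_trace_sum_embeddings.
rewrite (bigD1 (Ordinal dimF_gt0)) //= ltr_pwDl //.
  by rewrite rmorphM -expr2 exprn_even_gt0 //= fmorph_eq0.
by rewrite sumr_ge0 // => s _; rewrite rmorphM -expr2 sqr_ge0.
Qed.

Lemma alg_trace_mul_le (a c : F) :
  (forall s, 0 <= sig s a) -> (forall s, 0 <= sig s c) ->
  alg_trace (a * c) <= alg_trace a * alg_trace c.
Proof.
move=> a0 c0; rewrite -(ler_rat R) rmorphM /= !alg_trace_sum_embeddings mulr_suml.
apply: ler_sum => s _; rewrite rmorphM ler_wpM2l // (bigD1 s) //= lerDl.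
by rewrite sumr_ge0.
Qed.

(* If [sig s0 a < 0], weak approximation gives [f] close to 1 at [s0] and to 0 at
   the other places, so that [Tr (f ^ 2 a) < 0]. *)
Lemma embeddings_ge0 (a : F) :
  (forall f : F, 0 <= alg_trace (f * f * a)) -> forall s, 0 <= sig s a.
Proof.
move=> pos s0; rewrite leNgt; apply/negP => neg.
pose A := \sum_(s | s != s0) `|sig s a|.
have A0 : 0 <= A by rewrite sumr_ge0.
pose e : R := Num.min 2%:R^-1 (- sig s0 a / (4%:R * (A + 1))).
have e_half : e <= 2%:R^-1 by rewrite /e ge_min lexx.
have e_small : e * (4%:R * (A + 1)) <= - sig s0 a.
  rewrite -ler_pdivlMr; last by rewrite mulr_gt0 // ltr_wpDl.
  by rewrite /e ge_min lexx orbT.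
have e0 : 0 < e.
  rewrite /e lt_min invr_gt0 ltr0n divr_gt0 ?oppr_gt0 //.
  by rewrite mulr_gt0 // ltr_wpDl.
have [f hf] := embeddings_dense (fun s => (s == s0)%:R) e0.
have := pos f; rewrite -(ler_rat R) rmorph0 alg_trace_sum_embeddings (bigD1 s0) //=.
have f0 : 4%:R^-1 <= sig s0 f * sig s0 f.
  have := hf s0; rewrite eqxx mulr1n ler_norml => /andP[].
  by move: (sig s0 f) => g; clear -e_half e0; clearbody e => *; nra.
have others : \sum_(s | s != s0) sig s (f * f * a) <= e ^+ 2 * A.
  rewrite /A mulr_sumr; apply: ler_sum => s ss0.
  have := hf s; rewrite (negPf ss0) subr0 => hs.
  apply: (le_trans (ler_norm _)); rewrite !rmorphM !normrM ler_wpM2r //.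
  by rewrite expr2 ler_pM.
rewrite !rmorphM /=; have e2A : e ^+ 2 * A <= e * A.
  by rewrite ler_wpM2r // expr2 -{3}[e]mulr1 ler_wpM2l ?ltW //; lra.
move: f0 others; move: (sig s0 f * sig s0 f) (\sum_(s | _) _) => g S; nra.
Qed.

Lemma approx_fourth_root (a : F) : (forall s, 0 < sig s a) ->
  exists u : F, forall s, 2%:R^-1 <= sig s (u ^+ 4 * a) <= 2%:R.
Proof.
move=> a0; pose r s := Num.sqrt (Num.sqrt (sig s a)).
have r0 s : 0 < r s by rewrite !sqrtr_gt0.
have rE s : sig s a = r s ^+ 4.
  by rewrite (exprM _ 2 2) !sqr_sqrtr ?sqrtr_ge0 ?ltW.
pose B := 1 + \sum_s r s.
have rB s : r s <= B.
  by rewrite /B (bigD1 s) //= addrCA lerDl addr_ge0 // sumr_ge0 // => i _; rewrite ltW.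
have B0 : 0 < B by rewrite ltr_pwDl // sumr_ge0 // => s _; rewrite ltW.
have [|u hu] := @embeddings_dense (fun s => (r s)^-1) (10%:R * B)^-1.
  by rewrite invr_gt0 mulr_gt0.
exists u => s; rewrite rmorphM rmorphXn rE -exprMn.
set w := sig s u * r s.
have : `|w - 1| <= 10%:R^-1.
  have -> : w - 1 = (sig s u - (r s)^-1) * r s.
    by rewrite mulrBl mulVf ?gt_eqF.
  rewrite normrM (gtr0_norm (r0 s)).
  apply: (@le_trans _ _ ((10%:R * B)^-1 * B)); first by rewrite ler_pM // ltW.
  by rewrite invfM -mulrA mulVf ?mulr1 // gt_eqF.
rewrite ler_norml => /andP[w_ge w_le].
have w2_ge : 3%:R / 4%:R <= w * w by nra.
have w2_le : w * w <= 5%:R / 4%:R by nra.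
rewrite (exprM _ 2 2) !expr2; move: (w * w) w2_ge w2_le => v v1 v2.
apply/andP; split; nra.
Qed.

End RealEmbeddings.
(** * Reduced traces and quaternion algebras *)

Section ReducedTrace.
Variables (F : fieldExtType rat) (D : falgType F).

Lemma trdZ (a : F) (x : D) : trd (a *: x) = a * trd x.
Proof. by rewrite /trd alg_traceZ mulrCA. Qed.

Lemma trd_is_zmod_morphism : zmod_morphism (@trd F D).
Proof. by move=> x y; rewrite /trd raddfB mulrBr. Qed.

HB.instance Definition _ :=
  GRing.isZmodMorphism.Build D F (@trd F D) trd_is_zmod_morphism.

Lemma trdC (x y : D) : trd (x * y) = trd (y * x).
Proof. by rewrite /trd alg_traceC. Qed.

Lemma trdQ_is_zmod_morphism : zmod_morphism (@trdQ F D).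
Proof. by move=> x y; rewrite /trdQ !raddfB. Qed.

HB.instance Definition _ :=
  GRing.isZmodMorphism.Build D rat (@trdQ F D) trdQ_is_zmod_morphism.

Lemma trdQC (x y : D) : trdQ (x * y) = trdQ (y * x).
Proof. by rewrite /trdQ trdC. Qed.

Lemma natF_neq0 n : (0 < n)%N -> n%:R != 0 :> F.
Proof. by move=> n0; rewrite -(rmorph_nat (in_alg F)) fmorph_eq0 pnatr_eq0 -lt0n. Qed.

Lemma alg_degree_gt0 : (0 < alg_degree D)%N.
Proof.
have dD : (0 < \dim {:D})%N by exact: (adim_gt0 {:D}%AS).
rewrite /alg_degree; case: (\dim _) dD => // n _.
have := PeanoNat.Nat.sqrt_le_mono 1 n.+1 (le_n_S _ _ (PeanoNat.Nat.le_0_l n)).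
by rewrite PeanoNat.Nat.sqrt_1 => /ssrnat.leP.
Qed.

Lemma trQ_trdQ (x : D) : trQ x = (alg_degree D)%:R * trdQ x.
Proof.
have deg0 := natF_neq0 alg_degree_gt0.
by rewrite -alg_trace_natl /trd mulVKf.
Qed.

Lemma falg_torsion_free : torsion_free D.
Proof.
move=> x n n0; rewrite -scaler_nat => /eqP.
by rewrite scaler_eq0 (negPf (natF_neq0 n0)) => /eqP.
Qed.

Lemma in_algM (a c : F) : a%:A * c%:A = (a * c)%:A :> D.
Proof. by rewrite mulr_algl scalerA. Qed.

End ReducedTrace.

Definition anticommute (A : pzRingType) (x y : A) : Prop := x * y = - (y * x).

Section Anticommute.
Variable A : pzRingType.

Lemma anticommute_sym (x y : A) : anticommute x y -> anticommute y x.
Proof. by rewrite /anticommute => ->; rewrite opprK. Qed.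

Lemma anticommuteD (x y z : A) :
  anticommute x y -> anticommute x z -> anticommute x (y + z).
Proof. by rewrite /anticommute mulrDr mulrDl opprD => -> ->. Qed.

Lemma anticommuteM (x y : A) : anticommute x y -> anticommute x (x * y).
Proof. by rewrite /anticommute -[x * y * x]mulrA => xy; rewrite {1}xy !mulrN. Qed.

Lemma sqr_anticommuteD (x y : A) :
  anticommute x y -> (x + y) * (x + y) = x * x + y * y.
Proof. by move=> xy; rewrite mulrDl !mulrDr xy addrA subrK. Qed.

End Anticommute.

Lemma anticommuteZ (K : comPzRingType) (A : algType K) (x y : A) (a b : K) :
  anticommute x y -> anticommute (a *: x) (b *: y).
Proof.
by rewrite /anticommute -!scalerAl -!scalerAr !scalerA => ->; rewrite scalerN mulrC.
Qed.

Section Quaternion.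
Variables (F : fieldExtType rat) (D : falgType F).
Hypothesis quatD : quaternion_algebra D.

Lemma dim_quaternion : \dim {:D} = 4%N.
Proof. by case: quatD => i [j] [a] [b] [_ _ _ _] /andP[/eqP <- /eqP ->]. Qed.

Lemma alg_degree_quaternion : alg_degree D = 2%N.
Proof. by rewrite /alg_degree dim_quaternion. Qed.

Lemma trd1_quaternion : trd (1 : D) = 2%:R.
Proof.
rewrite /trd alg_degree_quaternion alg_trace1 dim_quaternion.
have -> : 4%:R = 2%:R * 2%:R :> F by rewrite -natrM.
by rewrite mulKf // natF_neq0.
Qed.

Lemma trd_alg_quaternion (a : F) : trd (a%:A : D) = 2%:R * a.
Proof. by rewrite trdZ trd1_quaternion mulrC. Qed.

Lemma trdQ_alg_quaternion (a : F) : trdQ (a%:A : D) = 2%:R * alg_trace a.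
Proof. by rewrite /trdQ trd_alg_quaternion alg_trace_natl. Qed.

Let two_neq0 : 2%:R != 0 :> F. Proof. exact: natF_neq0. Qed.

Lemma trd_anticommute (x y : D) (c : F) :
  c != 0 -> y * y = c%:A -> anticommute x y -> trd x = 0.
Proof.
move=> c0 yy xy; have : trd (x * (y * y)) = - trd (x * (y * y)).
  by rewrite {1}mulrA xy mulNr raddfN /= -mulrA [in LHS]trdC -mulrA.
rewrite yy -scalerAr mulr1 trdZ => /eqP; rewrite -addr_eq0 -mulr2n -mulr_natl.
by rewrite mulf_eq0 (negPf two_neq0) mulf_eq0 (negPf c0) => /eqP.
Qed.

Definition pure_quaternion (i j : D) (x1 x2 x3 : F) : D :=
  x1 *: i + (x2 *: j + x3 *: (i * j)).

Definition standard_generators (i j : D) (a b : F) : Prop :=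
  [/\ a != 0 /\ b != 0, i * i = a%:A, j * j = b%:A, anticommute i j
    & forall x, exists x0 x1 x2 x3, x = x0%:A + pure_quaternion i j x1 x2 x3].

Lemma exists_standard_generators : exists i j a b, standard_generators i j a b.
Proof.
case: quatD => i [j] [a] [b] [ab0 ii jj ij bD]; exists i, j, a, b; split=> // x.
have : x \in span [:: 1; i; j; i * j] by rewrite (span_basis bD) memvf.
rewrite !span_cons span_nil addv0.
case/memv_addP=> _ /vlineP[x0 ->] [_ /memv_addP[_ /vlineP[x1 ->]] [y23 y23E ->] ->].
case/memv_addP: y23E => _ /vlineP[x2 ->] [_ /vlineP[x3 ->] ->].
by exists x0, x1, x2, x3.
Qed.

Section StandardGenerators.
Variables (i j : D) (a b : F).
Hypothesis ijP : standard_generators i j a b.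

Lemma trd_central_mul_pure (c : D) x1 x2 x3 : (forall x, c * x = x * c) ->
  trd (c * pure_quaternion i j x1 x2 x3) = 0.
Proof.
have [[a0 b0] ii jj ij _] := ijP => cC.
have anti u v : anticommute u v -> anticommute (c * u) v.
  by rewrite /anticommute -mulrA => ->; rewrite mulrN !mulrA cC.
have ti : trd (c * i) = 0 by exact: trd_anticommute b0 jj (anti _ _ ij).
have tj : trd (c * j) = 0.
  by apply: trd_anticommute a0 ii (anti _ _ _); exact: anticommute_sym.
have tk : trd (c * (i * j)) = 0.
  by apply: trd_anticommute a0 ii (anti _ _ _); apply/anticommute_sym/anticommuteM.
by rewrite /pure_quaternion !mulrDr -!scalerAr !raddfD /= !trdZ ti tj tk !mulr0 !addr0.
Qed.

Lemma sqr_pure_quaternion x1 x2 x3 :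
  exists c : F, pure_quaternion i j x1 x2 x3 * pure_quaternion i j x1 x2 x3 = c%:A.
Proof.
have [_ ii jj ij _] := ijP; have ji := anticommute_sym ij.
have kk : i * j * (i * j) = (- (a * b))%:A.
  rewrite mulrA -[i * j * i]mulrA ji mulrN mulNr mulrA ii -mulrA jj.
  by rewrite in_algM scaleNr.
have jk : anticommute j (i * j).
  by rewrite /anticommute mulrA ji mulNr.
have sqZ (u : D) (e g : F) : u * u = g%:A -> (e *: u) * (e *: u) = (e * e * g)%:A.
  by move=> uu; rewrite -scalerAl -scalerAr uu !scalerA.
exists (x1 * x1 * a + (x2 * x2 * b + x3 * x3 * - (a * b))).
rewrite /pure_quaternion sqr_anticommuteD; last first.
  by apply: anticommuteD; apply: anticommuteZ => //; exact: anticommuteM.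
rewrite sqr_anticommuteD; last exact: anticommuteZ.
by rewrite (sqZ _ _ _ ii) (sqZ _ _ _ jj) (sqZ _ _ _ kk) !scalerDl.
Qed.

End StandardGenerators.

Lemma trd_central_mul (c x : D) : (forall y, c * y = y * c) ->
  2%:R * trd (c * x) = trd c * trd x.
Proof.
move=> cC; have [i [j [a [b ijP]]]] := exists_standard_generators.
have [_ _ _ _ /(_ x)[x0 [x1 [x2 [x3 ->]]]]] := ijP.
have := trd_central_mul_pure ijP x1 x2 x3; move: (pure_quaternion _ _ _ _ _) => w tw.
have w0 : trd w = 0 by rewrite -[w]mul1r tw // => y; rewrite mul1r mulr1.
rewrite mulrDr !raddfD /= tw // w0 !addr0 -scalerAr mulr1 trdZ trd_alg_quaternion.
by rewrite mulrA mulrC.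
Qed.

Definition quaternion_conj (x : D) : D := (trd x)%:A - x.

Lemma quaternion_conj_is_zmod_morphism : zmod_morphism quaternion_conj.
Proof. by move=> x y; rewrite /quaternion_conj raddfB /= scalerBl !opprD addrACA. Qed.

HB.instance Definition _ :=
  GRing.isZmodMorphism.Build D D quaternion_conj quaternion_conj_is_zmod_morphism.

Lemma trd_quaternion_conj x : trd (quaternion_conj x) = trd x.
Proof.
by rewrite /quaternion_conj raddfB /= trd_alg_quaternion mulr_natl mulr2n addrK.
Qed.

Lemma quaternion_conjK : involutive quaternion_conj.
Proof. by move=> x; rewrite {1}/quaternion_conj trd_quaternion_conj subKr. Qed.

Lemma trd_mul_quaternion_conj x y :
  trd (x * quaternion_conj y) = trd x * trd y - trd (x * y).
Proof. by rewrite mulrBr mulr_algr [trd _]raddfB /= trdZ mulrC. Qed.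

Lemma mul_quaternion_conj x : exists c : F, x * quaternion_conj x = c%:A.
Proof.
have [i [j [a [b ijP]]]] := exists_standard_generators.
have [_ _ _ _ /(_ x)[x0 [x1 [x2 [x3 xE]]]]] := ijP.
have [c cE] := sqr_pure_quaternion ijP x1 x2 x3.
have tw := trd_central_mul_pure ijP x1 x2 x3 (c := 1).
move: xE cE tw; move: (pure_quaternion _ _ _ _ _) => w xE ww tw.
exists (x0 * x0 - c); rewrite /quaternion_conj.
have -> : trd x = 2%:R * x0.
  by rewrite xE raddfD /= trd_alg_quaternion -[w]mul1r tw ?addr0 // => y; rewrite mul1r mulr1.
have -> : (2%:R * x0)%:A - x = x0%:A - w.
  by rewrite xE mulr_natl mulr2n scalerDl opprD addrA addrK.
rewrite xE mulrDl !mulrBr in_algM ww mulr_algl mulr_algr scalerBl.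
by rewrite -addrA addKr.
Qed.

Lemma quaternion_conj_polar x y :
  x * quaternion_conj y + y * quaternion_conj x = (trd x * trd y - trd (x * y))%:A.
Proof.
have [s sE] : exists s : F, x * quaternion_conj y + y * quaternion_conj x = s%:A.
  have [c cE] := mul_quaternion_conj (x + y).
  have [[p pE] [q qE]] := (mul_quaternion_conj x, mul_quaternion_conj y).
  exists (c - (p + q)); rewrite scalerBl scalerDl -cE -pE -qE.
  rewrite [quaternion_conj (_ + _)]raddfD /=.
  move: (quaternion_conj x) (quaternion_conj y) => u v.
  by rewrite mulrDl !mulrDr [y * u + _]addrC addrACA [RHS]addrC addKr.
rewrite sE; congr (_%:A); apply: (mulfI two_neq0).
rewrite -trd_alg_quaternion -sE [trd _]raddfD /= !trd_mul_quaternion_conj.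
by rewrite (trdC y x) (mulrC (trd y)) mulr_natl mulr2n.
Qed.

Lemma quaternion_conjM x y :
  quaternion_conj (x * y) = quaternion_conj y * quaternion_conj x.
Proof.
have := quaternion_conj_polar (quaternion_conj y) x.
rewrite quaternion_conjK trd_quaternion_conj (trdC _ x) trd_mul_quaternion_conj.
rewrite (mulrC (trd y)) subKr.
by move=> e; rewrite {1}/quaternion_conj -e addrK.
Qed.

End Quaternion.

(* An anticommuting pair of trace zero matrices with negative squares would span
   a negative definite plane for [X |-> X ^ 2], which has signature (2, 1). *)
Lemma mx2_no_definite_anticommute (K : realFieldType) (X Y : 'M[K]_2) (p q : K) :
  0 < p -> 0 < q -> X * X = - p%:A -> Y * Y = - q%:A -> ~ anticommute X Y.
Proof.
have entries (M N : 'M[K]_2) i j : (M * N) i j = M i 0 * N 0 j + M i 1 * N 1 j.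
  have ord1E : lift ord0 ord0 = 1 :> 'I_2 by exact: val_inj.
  by rewrite -mulmxE mxE !big_ord_recl big_ord0 addr0 ord1E.
have traceless (M : 'M[K]_2) r : 0 < r -> M * M = - r%:A ->
    M 1 1 = - M 0 0 /\ M 0 1 * M 1 0 = - (M 0 0 ^+ 2 + r).
  move=> r0 MM.
  have := congr1 (fun N : 'M_2 => N 0 0) MM; have := congr1 (fun N : 'M_2 => N 0 1) MM.
  rewrite !entries !mxE /= mulr1n mulr0n mulr1 mulr0 oppr0 => e01 e00.
  have b0 : M 0 1 != 0.
    by apply/eqP => b0; move: e00; rewrite b0 mul0r; nra.
  split; last by lra.
  by apply: (mulfI b0); lra.
move=> p0 q0 /(traceless _ _ p0)[Xd Xbc] /(traceless _ _ q0)[Yd Ybc].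
move=> /(congr1 (fun N : 'M_2 => N 0 0)); rewrite [in RHS]mxE !entries.
move: (X 0 0) (X 0 1) (X 1 0) (Y 0 0) (Y 0 1) (Y 1 0) Xbc Ybc => a b c d e f bc ef h.
have bf_ec : b * f * (e * c) = (a ^+ 2 + p) * (d ^+ 2 + q).
  by rewrite -[RHS]mulrNN -bc -ef; ring.
have : (b * f + e * c) ^+ 2 = 4%:R * (a ^+ 2 * d ^+ 2).
  by rewrite (_ : b * f + e * c = - (2%:R * (a * d))); [ring|lra].
have := sqr_ge0 (b * f - e * c); have := mulr_gt0 p0 q0.
have := mulr_ge0 (sqr_ge0 a) (ltW q0); have := mulr_ge0 (sqr_ge0 d) (ltW p0).
move: bf_ec; move: (b * f) (e * c) => u v; nra.
Qed.
(** * Lattices in [D]-modules *)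

Section RationalScalars.
Variables (F : fieldExtType rat) (D : falgType F).

Definition ratD (q : rat) : D := (q%:A : F)%:A.

HB.instance Definition _ := GRing.RMorphism.copy ratD (in_alg D \o in_alg F).

Lemma mul_ratD q (x : D) : ratD q * x = (q%:A : F) *: x.
Proof. exact: mulr_algl. Qed.

Lemma ratD_natV n : (0 < n)%N -> ratD n%:R^-1 * n%:R = 1.
Proof.
by move=> n0; rewrite -(rmorph_nat ratD) -rmorphM mulVf ?rmorph1 ?pnatr_eq0 -?lt0n.
Qed.

Variable V : lmodType D.

Lemma scale_ratD_mulrn n (x : V) : (0 < n)%N -> ratD n%:R^-1 *: (x *+ n) = x.
Proof. by move=> n0; rewrite -scaler_nat scalerA ratD_natV // scale1r. Qed.

Lemma lmod_torsion_free : torsion_free V.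
Proof. by move=> x n n0 xn; rewrite -(scale_ratD_mulrn x n0) xn scaler0. Qed.

Definition rat_basis (I : finType) (g : I -> V) : Prop :=
  (forall x, exists u : I -> rat, x = \sum_i ratD (u i) *: g i) /\
  (forall u : I -> rat, \sum_i ratD (u i) *: g i = 0 -> forall i, u i = 0).

Lemma rat_basis_inj (I : finType) (g : I -> V) (u w : I -> rat) : rat_basis g ->
  \sum_i ratD (u i) *: g i = \sum_i ratD (w i) *: g i -> u =1 w.
Proof.
move=> [_ fr] e i; apply/eqP; rewrite -subr_eq0; apply/eqP.
apply: (fr (fun i => u i - w i)).
by under eq_bigr do rewrite rmorphB scalerBl; rewrite sumrB e subrr.
Qed.

Lemma rat_basis_zfree (I : finType) (g : I -> V) :
  rat_basis g -> zfree (fun k : 'I_#|I| => g (enum_val k)).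
Proof.
move=> [_ fr] z zE k; apply: (@intr_inj rat).
rewrite -(enum_valK k); apply: (fr (fun i => (z (enum_rank i))%:~R)).
rewrite -[RHS]zE (reindex_onto enum_rank enum_val) /= => [|i _]; last exact: enum_valK.
by apply: eq_big => [i|i _]; rewrite enum_rankK ?eqxx // rmorph_int scaler_int.
Qed.

Lemma rat_basis_rank_le (I : finType) (g : I -> V) :
  rat_basis g -> rank_le #|I| [set: V].
Proof.
move=> [/choice[co coE] _] l f _ fr; rewrite leqNgt; apply/negP => Il.
have [z [i zi] zA] := int_kernel (\matrix_(i < l, j < #|I|) co (f i) (enum_val j)) Il.
move/eqP: zi; apply; apply: fr.
rewrite (eq_bigr (fun i => \sum_j ratD ((z i)%:~R * co (f i) j) *: g j)).
  rewrite exchange_big big1 //= => j _; rewrite -scaler_suml -rmorph_sum /=.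
  rewrite (_ : \sum_k _ = 0) ?rmorph0 ?scale0r // -[RHS](zA (enum_rank j)).
  by apply: eq_bigr => k _; rewrite mxE enum_rankK.
move=> {}i _; rewrite {1}(coE (f i)) -scaler_int scaler_sumr.
by apply: eq_bigr => j _; rewrite scalerA rmorphM rmorph_int.
Qed.

Lemma zbasis_rat_basis (L : set V) n (b : 'I_n -> V) :
  zbasis L b -> (forall x, inQ L x) -> rat_basis b.
Proof.
move=> bL LQ; split=> [x|u u0 i].
  have [K K0 /bL.1[z zE]] := LQ x; exists (fun i => (z i)%:~R / K%:R).
  rewrite -(scale_ratD_mulrn x K0) zE scaler_sumr; apply: eq_bigr => i _.
  by rewrite mulrC rmorphM rmorph_int -scalerA scaler_int.
have [K [z [K0 zE]]] := common_denominator u.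
have /(zbasis_free bL)/(_ i) z0 : zcomb b z = 0.
  transitivity (ratD K%:R *: \sum_i ratD (u i) *: b i); last by rewrite u0 scaler0.
  rewrite scaler_sumr; apply: eq_bigr => j _.
  by rewrite scalerA -rmorphM mulrC zE rmorph_int scaler_int.
move/eqP: (zE i); rewrite z0 mulf_eq0 pnatr_eq0 eqn0Ngt K0 orbF.
by move=> /eqP.
Qed.

Definition rat_linear (g : V -> V) : Prop :=
  forall q x y, g (ratD q *: x + y) = ratD q *: g x + g y.

Lemma rat_linear_sum (g : V -> V) (I : finType) (u : I -> rat) (x : I -> V) :
  rat_linear g -> g (\sum_i ratD (u i) *: x i) = \sum_i ratD (u i) *: g (x i).
Proof.
move=> gL; have g0 : g 0 = 0.
  by have := gL (-1) 0 0; rewrite scaler0 add0r rmorphN1 scaleN1r addNr.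
by elim/big_rec2: _ => [|i y1 y2 _ <-]; [exact: g0|exact: gL].
Qed.

Lemma rat_trace_basis_indep (I J : finType) (e : I -> V) (f : J -> V) (g : V -> V)
    (A : I -> I -> rat) (B : J -> J -> rat) :
  rat_basis e -> rat_basis f -> rat_linear g ->
  (forall i, g (e i) = \sum_k ratD (A i k) *: e k) ->
  (forall j, g (f j) = \sum_k ratD (B j k) *: f k) ->
  \sum_i A i i = \sum_j B j j.
Proof.
move=> eP fP gL Ae Bf.
have /choice[P PE] i := fP.1 (e i); have /choice[Q QE] j := eP.1 (f j).
have substE (L M : finType) (u : L -> rat) (T : L -> M -> rat) (x : L -> V) (y : M -> V) :
    (forall l, x l = \sum_k ratD (T l k) *: y k) ->
    \sum_l ratD (u l) *: x l = \sum_k ratD (\sum_l u l * T l k) *: y k.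
  move=> xE; under eq_bigr => l _ do rewrite xE scaler_sumr.
  rewrite exchange_big; apply: eq_bigr => k _ /=; rewrite rmorph_sum scaler_suml.
  by apply: eq_bigr => l _; rewrite scalerA rmorphM.
have AE i : A i =1 fun k => \sum_l (\sum_j P i j * B j l) * Q l k.
  apply: (rat_basis_inj eP); rewrite -Ae -(substE _ _ _ _ _ _ QE).
  by rewrite PE (rat_linear_sum _ _ gL) (substE _ _ _ _ _ _ Bf).
have QP j l : \sum_i Q j i * P i l = (j == l)%:R.
  move: l; apply: (rat_basis_inj fP); rewrite -(substE _ _ _ _ _ _ PE) -QE.
  rewrite (bigD1 j) //= eqxx rmorph1 scale1r big1 ?addr0 // => l.
  by rewrite eq_sym => /negPf ->; rewrite rmorph0 scale0r.
under eq_bigr do rewrite AE; rewrite exchange_big; apply: eq_bigr => l _ /=.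
under eq_bigr do rewrite mulr_suml; rewrite exchange_big /= (bigD1 l) //=.
under eq_bigr do rewrite mulrAC mulrC [P _ _ * _]mulrC.
rewrite -mulr_sumr QP eqxx mulr1 big1 ?addr0 // => j jl.
under eq_bigr do rewrite mulrAC mulrC [P _ _ * _]mulrC.
by rewrite -mulr_sumr QP eq_sym (negPf jl) mulr0.
Qed.

End RationalScalars.

Section Dimension.
Variables (F : fieldExtType rat) (D : falgType F).

Definition vbasis_prod (p : 'I_(\dim {:F}) * 'I_(\dim {:D})) : D :=
  (vbasis {:F})`_p.1 *: (vbasis {:D})`_p.2.

Lemma sum_vbasis_prod (u : 'I_(\dim {:F}) * 'I_(\dim {:D}) -> rat) :
  \sum_p ratD D (u p) * vbasis_prod p =
  \sum_d (\sum_c u (c, d) *: (vbasis {:F})`_c) *: (vbasis {:D})`_d.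
Proof.
transitivity (\sum_c \sum_d ratD D (u (c, d)) * vbasis_prod (c, d)).
  by rewrite pair_bigA; apply: eq_bigr => -[].
rewrite exchange_big; apply: eq_bigr => d _; rewrite scaler_suml.
by apply: eq_bigr => c _; rewrite mul_ratD /vbasis_prod scalerA mulr_algl.
Qed.

Lemma vbasis_prod_coord (x : D) : x =
  \sum_p ratD D (coord (vbasis {:F}) p.1 (coord (vbasis {:D}) p.2 x)) * vbasis_prod p.
Proof.
rewrite (sum_vbasis_prod (fun p => coord _ _ _)) [LHS](coord_vbasis (memvf x)).
apply: eq_bigr => d _.
by congr (_ *: _); exact: coord_vbasis (memvf _).
Qed.

Lemma vbasis_prod_rat_basis : rat_basis (V := (D^o : lmodType D)) vbasis_prod.
Proof.
split=> [x|u].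
  by exists (fun p => coord (vbasis {:F}) p.1 (coord (vbasis {:D}) p.2 x));
    exact: vbasis_prod_coord.
rewrite -[\sum_p _]/(\sum_p ratD D (u p) * vbasis_prod p) sum_vbasis_prod => u0 [c d].
have := congr1 (coord (vbasis {:D}) d) u0.
rewrite (coord_sum_free _ _ (basis_free (vbasisP _))) linear0.
move/(congr1 (coord (vbasis {:F}) c)).
by rewrite (coord_sum_free _ _ (basis_free (vbasisP _))) linear0.
Qed.

Variable V : lmodType D.

Lemma dbasis_rat_basis (I : finType) (g : I -> D) m (v : 'I_m -> V) :
  rat_basis (V := (D^o : lmodType D)) g -> dbasis v ->
  rat_basis (fun p : 'I_m * I => g p.2 *: v p.1).
Proof.
move=> [g_gen g_free] [v_gen v_free].
have sumE (u : 'I_m * I -> rat) : \sum_p ratD D (u p) *: (g p.2 *: v p.1) =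
    \sum_i (\sum_k ratD D (u (i, k)) * g k) *: v i.
  transitivity (\sum_i \sum_k ratD D (u (i, k)) *: (g k *: v i)).
    by rewrite pair_bigA; apply: eq_bigr => -[].
  apply: eq_bigr => i _; rewrite scaler_suml.
  by apply: eq_bigr => k _; rewrite scalerA.
split=> [x|u]; last by rewrite sumE => /v_free u0 [i k]; exact: (g_free _ (u0 i)).
have [a ->] := v_gen x; have /choice[u uE] i := g_gen (a i).
by exists (fun p => u p.1 p.2); rewrite sumE; apply: eq_bigr => i _; rewrite {1}uE.
Qed.

Let dimE m : #|{: 'I_m * ('I_(\dim {:F}) * 'I_(\dim {:D}))}| = (m * dimQ D)%N.
Proof. by rewrite !card_prod !card_ord. Qed.

Lemma has_dim_rank_le m : has_dim V m -> rank_le (m * dimQ D) [set: V].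
Proof.
move=> [v vP]; rewrite -dimE.
exact: rat_basis_rank_le (dbasis_rat_basis vbasis_prod_rat_basis vP).
Qed.

Lemma dimQ_gt0 : (0 < dimQ D)%N.
Proof. by rewrite muln_gt0 (adim_gt0 {:F}%AS) (adim_gt0 {:D}%AS). Qed.

Lemma has_dim_unique m p : has_dim V m -> has_dim V p -> m = p.
Proof.
have le a b : has_dim V a -> has_dim V b -> (a <= b)%N.
  move=> [v vP] /has_dim_rank_le rk.
  have := rat_basis_zfree (dbasis_rat_basis vbasis_prod_rat_basis vP).
  by move/(rk _ _ (fun=> I)); rewrite dimE leq_pmul2r ?dimQ_gt0.
by move=> hm hp; apply/eqP; rewrite eqn_leq !le.
Qed.

Lemma rank_le_dimQ : rank_le (dimQ D) [set: D].
Proof.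
have := rat_basis_rank_le vbasis_prod_rat_basis.
by rewrite card_prod !card_ord.
Qed.

End Dimension.

Section EndoTrace.
Variables (F : fieldExtType rat) (D : falgType F).
Local Notation b := (vbasis {:D}).

Definition endo_trace (g : D -> D) : F := \sum_i coord b i (g b`_i).

Lemma endo_traceC (g h : {linear D -> D}) : endo_trace (g \o h) = endo_trace (h \o g).
Proof.
have expand (k : {linear D -> D}) x : k x = \sum_j coord b j x *: k b`_j.
  rewrite {1}(coord_vbasis (memvf x)) linear_sum.
  by apply: eq_bigr => j _; rewrite linearZ.
rewrite /endo_trace /=.
under eq_bigr => i _ do rewrite (expand g) linear_sum.
under [RHS]eq_bigr => i _ do rewrite (expand h) linear_sum.
rewrite exchange_big; apply: eq_bigr => i _; apply: eq_bigr => j _ /=.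
by rewrite !linearZ; exact: mulrC.
Qed.

Definition bimul (r s x : D) : D := r * x * s.

Lemma bimul_is_linear r s : linear (bimul r s).
Proof. by move=> a x y; rewrite /bimul mulrDr mulrDl -scalerAr -scalerAl. Qed.

HB.instance Definition _ r s := GRing.isLinear.Build F D D _ (bimul r s) (bimul_is_linear r s).

Lemma bimul_comp r r' s s' : bimul (r * r') (s' * s) = bimul r s \o bimul r' s'.
Proof. by apply/funext => x; rewrite /bimul /= !mulrA. Qed.

Lemma endo_trace_bimulPl (a : F) (x y s : D) :
  endo_trace (bimul (a *: x + y) s) = a * endo_trace (bimul x s) + endo_trace (bimul y s).
Proof.
rewrite mulr_sumr -big_split; apply: eq_bigr => i _.
by rewrite /bimul !mulrDl -!scalerAl linearP.
Qed.

Lemma endo_trace_bimulPr (a : F) (r x y : D) :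
  endo_trace (bimul r (a *: x + y)) = a * endo_trace (bimul r x) + endo_trace (bimul r y).
Proof.
rewrite mulr_sumr -big_split; apply: eq_bigr => i _.
by rewrite /bimul !mulrDr -scalerAr linearP.
Qed.

Lemma endo_trace_mull (x : D) : endo_trace (bimul x 1) = alg_trace x.
Proof. by apply: eq_bigr => i _; rewrite mxE /bimul mulr1. Qed.

Lemma endo_trace_bimul (r s : D) : quaternion_algebra D ->
  endo_trace (bimul r s) = trd r * trd s.
Proof.
move=> qD; have trd2 (x : D) : 2%:R * trd x = alg_trace x.
  by rewrite /trd alg_degree_quaternion // mulVKf // natF_neq0.
apply: (@quaternion_trace F F D (idfun : {rmorphism F -> F})
  (fun r => endo_trace (bimul r s)) (fun r => trd r * trd s)) => //=.
- by move=> a x y; rewrite endo_trace_bimulPl.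
- move=> x y; rewrite -{1}[s]mul1r -{2}[s]mulr1 !bimul_comp.
  by rewrite -[bimul x s]/(bimul x s : D -> D) endo_traceC.
- by move=> a x y; rewrite [trd _]raddfD /= trdZ mulrDl -mulrA.
- by move=> x y; rewrite trdC.
rewrite trd1_quaternion // trd2.
apply: (@quaternion_trace F F D (idfun : {rmorphism F -> F})
  (fun s => endo_trace (bimul 1 s)) (@alg_trace F D)) => //=.
- by move=> a x y; rewrite endo_trace_bimulPr.
- by move=> x y; rewrite -{1 2}[1]mul1r !bimul_comp endo_traceC.
- exact: alg_traceP.
- exact: alg_traceC.
- exact: endo_trace_mull.
Qed.

Lemma alg_trace_endo_trace (g : {linear D -> D}) :
  alg_trace (endo_trace g) =
  \sum_p coord (vbasis {:F}) p.1 (coord b p.2 (g (vbasis_prod p))).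
Proof.
transitivity (\sum_d \sum_c
    coord (vbasis {:F}) c (coord b d (g (vbasis_prod (c, d))))).
  rewrite raddf_sum; apply: eq_bigr => d _; rewrite /alg_trace /mxtrace /=.
  by apply: eq_bigr => c _; rewrite mxE /vbasis_prod !linearZ mulrC.
by rewrite exchange_big pair_bigA; apply: eq_bigr => -[].
Qed.

Lemma lattice_endo_trace_int (O : set D) n (rho : 'I_n -> D)
    (g : {linear D -> D}) :
  zbasis O rho -> (forall x, inQ O x) -> (forall x, O x -> O (g x)) ->
  alg_trace (endo_trace g) \is a Num.int.
Proof.
move=> rhoP OQ gO; rewrite alg_trace_endo_trace.
have /choice[A AE] i : exists z : 'I_n -> int, g (rho i) = zcomb rho z.
  by apply/rhoP.1/gO; exact: (zbasis_mem rhoP).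
have g_ratL : rat_linear (V := (D^o : lmodType D)) g.
  by move=> q x y; have := linearP g q%:A x y; rewrite -!mul_ratD.
pose T p p' := coord (vbasis {:F}) p'.1 (coord b p'.2 (g (vbasis_prod p))).
rewrite (rat_trace_basis_indep (A := T) (B := fun i j => (A i j)%:~R)
  (vbasis_prod_rat_basis D) (zbasis_rat_basis (V := (D^o : lmodType D)) rhoP OQ) g_ratL)
  => [|p|i].
- by rewrite -rmorph_sum intr_int.
- exact: vbasis_prod_coord.
- by rewrite AE; apply: eq_bigr => j _; rewrite rmorph_int scaler_int.
Qed.

End EndoTrace.

(** * Orders *)

Definition is_order (F : fieldExtType rat) (D : falgType F) (O : set D) : Prop :=
  [/\ subgroup O, O 1, forall x y, O x -> O y -> O (x * y), in_zspan O
    & forall x, inQ O x].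

Lemma span_over_subgroup (D : nzRingType) (V : lmodType D) (A : set D) m (v : 'I_m -> V) :
  subgroup A -> subgroup (span_over A v).
Proof.
move=> sA; split=> [|x x' [a [Aa ->]] [a' [Aa' ->]]].
  exists (fun=> 0); split=> [i|]; first exact: (subgroup0 sA).
  by rewrite big1 // => i _; rewrite scale0r.
exists (fun i => a i - a' i); split=> [i|]; first exact: (subgroupB sA).
by rewrite -sumrB; apply: eq_bigr => i _; rewrite scalerBl.
Qed.

Section Stabilizer.
Variables (F : fieldExtType rat) (D : falgType F) (V : lmodType D).
Variables (m n : nat) (L : set V) (b : 'I_n -> V).
Hypothesis m_gt0 : (0 < m)%N.
Hypothesis dimV : has_dim V m.
Hypothesis bL : zbasis L b.
Hypothesis LQ : forall x, inQ L x.

Let sL := zbasis_subgroup bL.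

Lemma stab_inQ d : inQ (stab L) d.
Proof.
have [K K0 KL] := inQ_family sL (fun i => LQ (d *: b i)).
exists K => // x /bL.1[z ->]; rewrite scaler_sumr; apply: (subgroup_sum sL) => i _.
by rewrite -scalerMzr -scalerMnl; exact: subgroupMz.
Qed.

Lemma stab_in_zspan : in_zspan (stab L).
Proof.
have [v [gen ind]] := dimV; pose i0 := Ordinal m_gt0.
have /choice[a aE] := gen.
have inj (u w : 'I_m -> D) : \sum_i u i *: v i = \sum_i w i *: v i -> u i0 = w i0.
  move=> e; apply/eqP; rewrite -subr_eq0; apply/eqP.
  apply: (ind (fun i => u i - w i)); under eq_bigr do rewrite scalerBl.
  by rewrite sumrB e subrr.
have [K K0 KL] := LQ (v i0).
exists n, (fun i => ratD D K%:R^-1 * a (b i) i0) => r Sr.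
have /bL.1[z zE] : L (r *: (v i0 *+ K)) by exact: Sr.
exists z; have e : r *+ K = \sum_i a (b i) i0 *~ z i.
  have := @inj (fun i => if i == i0 then r *+ K else 0)
               (fun j => \sum_i a (b i) j *~ z i); rewrite eqxx; apply.
  rewrite (bigD1 i0) //= big1 ?addr0 => [|j /negPf ->]; last exact: scale0r.
  rewrite -scalerMnl scalerMnr zE.
  under [RHS]eq_bigr do rewrite scaler_suml.
  rewrite exchange_big; apply: eq_bigr => i _ /=; rewrite {1}(aE (b i)) mulrz_suml.
  by apply: eq_bigr => j _; rewrite scalerMzl.
rewrite -[LHS]mul1r -(ratD_natV D K0) -mulrA mulr_natl e mulr_sumr.
by apply: eq_bigr => i _; rewrite mulrzAr.
Qed.

Lemma stab_is_order : is_order (stab L).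
Proof.
split; [split=> [x Lx|x y Sx Sy z Lz]|move=> x Lx|move=> x y Sx Sy z Lz| |].
- by rewrite scale0r; exact: subgroup0.
- by rewrite scalerBl; apply: (subgroupB sL); [exact: Sx|exact: Sy].
- by rewrite scale1r.
- by rewrite -scalerA; apply/Sx/Sy.
- exact: stab_in_zspan.
- exact: stab_inQ.
Qed.

End Stabilizer.
(** * Positive involutions *)

Lemma dim_center (F : fieldType) (D : falgType F) : is_center D -> \dim {:D} = 1%N.
Proof.
move=> cD; suff -> : fullv = <[1 : D]>%VS by rewrite dim_vline oner_eq0.
apply/eqP; rewrite eqEsubv subvf andbT; apply/subvP => x _.
by have [a ->] := cD x; rewrite memvZ ?memv_line.
Qed.

Lemma center_not_quaternion (F : fieldExtType rat) (D : falgType F) :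
  is_center D -> ~ quaternion_algebra D.
Proof. by move=> cD qD; have := dim_quaternion qD; rewrite dim_center. Qed.

Section PositiveInvolution.
Variables (R : realType) (F : fieldExtType rat) (D : falgType F) (dag : D -> D).
Variable sig : 'I_(\dim {:F}) -> {rmorphism F -> R}.
Hypothesis sigP : real_embeddings sig.
Hypothesis caseD : is_center D \/ quaternion_algebra D.
Hypothesis pos : positive_involution dag.

Lemma trd_alg (a : F) : trd (a%:A : D) = (alg_degree D)%:R * a.
Proof.
case: caseD => hD; last by rewrite trd_alg_quaternion // alg_degree_quaternion.
by rewrite trd_center // /alg_degree dim_center // mul1r.
Qed.

Lemma trdQ_alg (a : F) : trdQ (a%:A : D) = (alg_degree D)%:R * alg_trace a.
Proof. by rewrite /trdQ trd_alg alg_trace_natl. Qed.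

Lemma dagK : involutive dag. Proof. by case: pos.1. Qed.

Lemma dagM x y : dag (x * y) = dag y * dag x. Proof. by case: pos.1. Qed.

Lemma dag_is_zmod_morphism : zmod_morphism dag.
Proof.
case: pos.1 => dagP _ _ x y; have := dagP (-1) y x.
by rewrite !scaleN1r addrC => ->; rewrite addrC.
Qed.

HB.instance Definition _ := GRing.isZmodMorphism.Build D D dag dag_is_zmod_morphism.

Lemma dag1 : dag 1 = 1.
Proof. by have := dagM 1 (dag 1); rewrite mul1r dagK mul1r. Qed.

Definition dform (x y : D) : rat := trdQ (x * dag y).

Definition dsqr (x : D) : rat := dform x x.

Lemma dsqr_gt0 x : x != 0 -> 0 < dsqr x. Proof. exact: pos.2. Qed.

Lemma dsqr0 : dsqr 0 = 0. Proof. by rewrite /dsqr /dform mul0r raddf0. Qed.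

Lemma dsqr_ge0 x : 0 <= dsqr x.
Proof. by have [->|/dsqr_gt0/ltW//] := eqVneq x 0; rewrite dsqr0. Qed.

Lemma dsqr_eq0 x : dsqr x <= 0 -> x = 0.
Proof. by move=> x0; apply/eqP/negPn/negP => /dsqr_gt0; rewrite ltNge x0. Qed.

Lemma trdQ_nondeg (x : D) : (forall y : D, trdQ (x * y) = 0) -> x = 0.
Proof. by move=> x0; apply: dsqr_eq0; rewrite /dsqr /dform x0. Qed.

(* In the quaternion case [c - trd c / 2] is orthogonal to [D] for the trace form. *)
Lemma central_alg (c : D) : (forall x, c * x = x * c) -> exists a : F, c = a%:A.
Proof.
case: caseD => [cD _|qD cC]; first exact: cD.
exists (trd c / 2%:R); apply/eqP; rewrite -subr_eq0; apply/eqP.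
apply: trdQ_nondeg => x; rewrite /trdQ mulrBl mulr_algl [trd _]raddfB /= trdZ.
by rewrite mulrAC -(trd_central_mul qD) // mulrAC mulfV ?natF_neq0 // mul1r subrr raddf0.
Qed.

Lemma dag_alg (a : F) : dag a%:A = a%:A.
Proof.
have [c cE] : exists c : F, dag a%:A = c%:A.
  by apply: central_alg => x; rewrite -[x]dagK -!dagM mulr_algl mulr_algr.
apply/eqP; rewrite -subr_eq0 cE -scalerBl; apply/negPn/negP => f0.
have := dsqr_gt0 f0; set f := c - a in f0 *.
rewrite /dsqr /dform; have -> : dag f%:A = - f%:A.
  by rewrite /f scalerBl raddfB /= -cE dagK opprB cE.
rewrite mulrN in_algM raddfN /= trdQ_alg oppr_gt0 ltNge mulr_ge0 //.
apply/ltW/(alg_trace_sqr_gt0 sigP); apply: contraNneq f0 => ->.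
by rewrite scale0r.
Qed.

Lemma dagZ (a : F) x : dag (a *: x) = a *: dag x.
Proof. by rewrite -[a *: x]mulr_algl dagM dag_alg mulr_algr. Qed.

Lemma trd_dag (x : D) : trd (dag x) = trd x.
Proof.
case: caseD => hD; first by have [a ->] := hD x; rewrite dag_alg.
apply: (@quaternion_trace F F D (idfun : {rmorphism F -> F}) (fun x => trd (dag x))
  (@trd F D)) => //=.
- by move=> a u v; rewrite [dag (_ + _)]raddfD /= dagZ [trd _]raddfD /= trdZ.
- by move=> u v; rewrite !dagM trdC.
- by move=> a u v; rewrite [trd _]raddfD /= trdZ.
- exact: trdC.
- by rewrite dag1.
Qed.

Lemma dform_symmetric : symmetric_form dform.
Proof.
apply: symmetric_formI => [x x' y|x y].
  by rewrite /dform mulrDl [trdQ _]raddfD.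
by rewrite /dform -{1}[x]dagK -dagM /trdQ trd_dag.
Qed.

Lemma dsqr_dag x : dsqr (dag x) = dsqr x.
Proof. by rewrite /dsqr /dform dagK trdQC. Qed.

Lemma dsqrN x : dsqr (- x) = dsqr x.
Proof. by rewrite /dsqr /dform raddfN mulrNN. Qed.

Lemma dsqrMn x n : dsqr (x *+ n) = n%:R ^+ 2 * dsqr x.
Proof. exact: form_mulrn dform_symmetric.1. Qed.

Lemma dsqr_sum n (g : 'I_n -> D) : dsqr (\sum_i g i) <= n%:R * \sum_i dsqr (g i).
Proof. by apply: form_sum_le dform_symmetric _; exact: dsqr_ge0. Qed.

Lemma dsqrD x y : dsqr (x + y) <= 2%:R * (dsqr x + dsqr y).
Proof.
have := dsqr_sum (fun i : 'I_2 => if i == ord0 then x else y).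
by rewrite !big_ord_recl !big_ord0 /= !addr0.
Qed.

Lemma dsqr_alg (a : F) : dsqr a%:A = (alg_degree D)%:R * alg_trace (a * a).
Proof. by rewrite /dsqr /dform dag_alg in_algM trdQ_alg. Qed.

Lemma trd_mul_dag_ge0 (x : D) s : 0 <= sig s (trd (x * dag x)).
Proof.
apply: (embeddings_ge0 sigP) => f; have := dsqr_ge0 (f *: x).
by rewrite /dsqr /dform dagZ -scalerAl -scalerAr scalerA /trdQ trdZ.
Qed.

(* With [nm u = trd (u * dag u)], nonnegative at every place, one has
   [nm (x y) + nm (z y) = nm x nm y] for [z = dag (quaternion_conj x)]. *)
Lemma dsqrM x y : dsqr (x * y) <= dsqr x * dsqr y.
Proof.
pose nm u := trd (u * dag u); suff [z zE] : exists z, nm (x * y) + nm z = nm x * nm y.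
  apply: (@le_trans _ _ (alg_trace (nm x * nm y))).
    rewrite -zE raddfD lerDl; apply: (alg_trace_ge0 sigP) => s.
    exact: trd_mul_dag_ge0.
  by apply: (alg_trace_mul_le sigP) => s; exact: trd_mul_dag_ge0.
rewrite /nm; case: caseD => hD.
  exists 0; rewrite mul0r [trd 0]raddf0 addr0.
  have [a ->] := hD x; have [b ->] := hD y.
  by rewrite !in_algM !dag_alg !in_algM !trd_center // mulrACA.
set xc := quaternion_conj x; have dag_xc : dag xc = quaternion_conj (dag x).
  by rewrite /quaternion_conj raddfB /= dag_alg trd_dag.
exists (dag xc * y); rewrite !dagM dagK.
have -> : trd (dag xc * y * (dag y * xc)) = trd (xc * dag xc * (y * dag y)).
  by rewrite mulrA trdC !mulrA.
have -> : trd (x * y * (dag y * dag x)) = trd (dag x * x * (y * dag y)).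
  by rewrite !mulrA trdC !mulrA.
rewrite dag_xc -quaternion_conjM // -raddfD -mulrDl addrC subrK /=.
by rewrite mulr_algl trdZ (trdC (dag x)).
Qed.

Section Skew.
Hypothesis quatD : quaternion_algebra D.

Lemma skew_sqr x : dag x = - x -> x != 0 ->
  exists2 a : F, x * x = - a%:A & forall s, 0 < sig s a.
Proof.
move=> sx x0; have [a aE] := mul_quaternion_conj quatD x.
have tx : trd x = 0.
  apply/eqP; have /eqP : trd x *+ 2 = 0.
    by rewrite mulr2n -{1}trd_dag sx [trd _]raddfN addNr.
  by rewrite -mulr_natl mulf_eq0 (negPf (natF_neq0 F _)).
rewrite /quaternion_conj tx scale0r sub0r mulrN in aE.
exists a => [|s]; first by rewrite -aE opprK.
rewrite lt_neqAle eq_sym fmorph_eq0; apply/andP; split.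
  apply: contraTneq (dsqr_gt0 x0) => a0.
  by rewrite /dsqr /dform sx mulrN aE a0 scale0r raddf0 ltxx.
have := trd_mul_dag_ge0 x s; rewrite sx mulrN aE trd_alg_quaternion //.
by rewrite rmorphM rmorph_nat pmulr_rge0.
Qed.

Lemma skew_unit x : dag x = - x -> x != 0 -> x \is a GRing.unit.
Proof.
move=> sx x0; have [a xx /embeddings_gt0_neq0 a0] := skew_sqr sx x0.
apply/unitrP; exists ((- a^-1) *: x); rewrite -scalerAl -scalerAr xx.
by rewrite scalerN scaleNr opprK scalerA mulVf // scale1r.
Qed.

Lemma no_definite_anticommute (x y : D) (p q : F) :
  totally_indefinite R D -> x * x = - p%:A -> y * y = - q%:A ->
  (forall s, 0 < sig s p) -> (forall s, 0 < sig s q) -> ~ anticommute x y.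
Proof.
move=> indef xx yy pp qp xy; have d0 : (0 < \dim {:F})%N by exact: (adim_gt0 {:F}%AS).
have [phi [phiZ _]] := indef (sig (Ordinal d0)).
apply: (mx2_no_definite_anticommute (X := phi x) (Y := phi y) (pp _) (qp _)).
- by rewrite -rmorphM xx rmorphN phiZ rmorph1.
- by rewrite -rmorphM yy rmorphN phiZ rmorph1.
- by rewrite /anticommute -!rmorphM xy rmorphN.
Qed.

(* Otherwise the component [z] of [y] orthogonal to [x] would anticommute with [x]. *)
Lemma skew_line x y : totally_indefinite R D ->
  dag x = - x -> x != 0 -> dag y = - y -> exists f : F, y = f *: x.
Proof.
move=> indef sx x0 sy; have [a xx ap] := skew_sqr sx x0.
have a0 := embeddings_gt0_neq0 ap.
have sqr_alg z : dag z = - z -> exists c : F, z * z = c%:A.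
  move=> sz; have [->|z0] := eqVneq z 0; first by exists 0; rewrite mul0r scale0r.
  by have [c -> _] := skew_sqr sz z0; exists (- c); rewrite scaleNr.
have [c cE] : exists c : F, x * y + y * x = c%:A.
  have [|u uE] := sqr_alg (x + y); first by rewrite raddfD /= sx sy opprD.
  have [[v vE] [w wE]] := (sqr_alg x sx, sqr_alg y sy).
  exists (u - (v + w)); rewrite scalerBl scalerDl -uE -vE -wE mulrDl !mulrDr.
  by rewrite [y * x + _]addrC addrACA [RHS]addrC addKr.
pose g := - (c / (2%:R * a)); pose z := y - g *: x.
have xz : anticommute x z.
  have ga : g * a + g * a = - c.
    by rewrite /g; field; rewrite a0 natF_neq0.
  apply/eqP; rewrite -addr_eq0 /z mulrBr mulrBl -scalerAl -scalerAr addrACA cE xx.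
  by rewrite scalerN scalerA opprK -scalerDl -scalerDl ga subrr scale0r.
have [z0|z0] := eqVneq z 0; first by exists g; move/eqP: z0; rewrite subr_eq0 => /eqP.
have sz : dag z = - z by rewrite /z raddfB /= dagZ sx sy scalerN -opprB opprK addrC opprB.
have [b zz bp] := skew_sqr sz z0.
by case: (no_definite_anticommute indef xx zz ap bp xz).
Qed.

End Skew.

Section Order.
Variable O : set D.
Hypothesis OP : is_order O.

Let sO : subgroup O. Proof. by case: OP. Qed.
Let O1 : O 1. Proof. by case: OP. Qed.
Let OM x y : O x -> O y -> O (x * y). Proof. by case: OP => _ _ OM _ _; exact: OM. Qed.
Let OQ x : inQ O x. Proof. by case: OP. Qed.

Local Notation n := (dimQ D).
Local Notation H := ((hermite_const n)%:R : rat).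

Lemma order_zlattice : zlattice n O.
Proof. by split=> //; [case: OP|apply: rank_le_sub (@rank_le_dimQ F D)]. Qed.

Lemma order_reduced_basis : exists r (rho : 'I_r -> D),
  [/\ (r <= n)%N, zbasis O rho, forall i, 0 < dsqr (rho i) & hermite_reduced dform H rho].
Proof.
by apply: (hermite_basis dform_symmetric order_zlattice) => x _; exact: dsqr_gt0.
Qed.

Lemma order_trQ_int x : O x -> trQ x \is a Num.int.
Proof.
move=> Ox; have [r [rho [_ rhoP _ _]]] := order_reduced_basis.
rewrite /trQ -endo_trace_mull; apply: (lattice_endo_trace_int rhoP OQ) => y Oy.
by rewrite /= /bimul mulr1; exact: OM.
Qed.

Lemma order_trd_mul_int x y : quaternion_algebra D -> O x -> O y ->
  alg_trace (trd x * trd y) \is a Num.int.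
Proof.
move=> qD Ox Oy; have [r [rho [_ rhoP _ _]]] := order_reduced_basis.
rewrite -endo_trace_bimul //; apply: (lattice_endo_trace_int rhoP OQ) => u Ou.
by rewrite /= /bimul; apply: (OM) => //; exact: OM.
Qed.

Lemma trQ_mul_biadditive : biadditive (fun x y : D => trQ (x * y)).
Proof.
by split=> [y x x'|x y y']; rewrite !trQ_trdQ ?mulrBl ?mulrBr [trdQ _]raddfB mulrBr.
Qed.

Lemma order_trQ_nondeg x : (forall y, O y -> trQ (x * y) = 0) -> x = 0.
Proof.
move=> x0; apply: trdQ_nondeg => y; have [K K0 /x0] := OQ y.
rewrite (biaddMnr trQ_mul_biadditive) trQ_trdQ => /eqP.
by rewrite mulrn_eq0 mulf_eq0 pnatr_eq0 !eqn0Ngt K0 alg_degree_gt0 => /eqP.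
Qed.

(* The integer [k] maps the dual of [O] for the trace form into [O]. *)
Definition codifferent_exponent (k : nat) : Prop :=
  forall c, (forall x, O x -> trQ (x * c) \is a Num.int) -> O (c *+ k).

Lemma disc_order_codifferent_exponent :
  exists k : nat, [/\ (0 < k)%N, `|disc_order O| = k%:R & codifferent_exponent k].
Proof.
have EB := trQ_mul_biadditive; have [r [rho [_ rhoP _ _]]] := order_reduced_basis.
have [||k [k0 kE dual]] := gram_disc_dual_exponent EB _ _ rhoP.
- by move=> x y Ox Oy; apply: order_trQ_int; exact: OM.
- by move=> x _; exact: order_trQ_nondeg.
exists k; split=> // c c_int; pose lam x := Num.floor (trQ (x * c)).
have lamE x : O x -> (lam x)%:~R = trQ (x * c) by move=> /c_int; exact: floorK.
have [x y Ox Oy|w Ow wE] := dual lam.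
  apply: (@intr_inj rat); rewrite rmorphD /= !lamE ?(biaddDl EB) //.
  exact: subgroupD.
suff -> : c *+ k = w by [].
apply/eqP; rewrite -subr_eq0; apply/eqP/order_trQ_nondeg => x Ox.
rewrite (biaddBl EB) wE // lamE // (biaddMnl EB) !trQ_trdQ (trdQC x).
by rewrite -[_ *+ k]mulr_natl subrr.
Qed.

Section LeftMultiplication.
Variables (r : nat) (rho : 'I_r -> D) (a : D) (A : 'M[int]_r).
Hypothesis rhoP : zbasis O rho.
Hypothesis a_unit : a \is a GRing.unit.
Hypothesis aE : forall i, a * rho i = \sum_j rho j *~ A i j.

Lemma mul_zcomb (v : 'rV_r) :
  a * (\sum_i rho i *~ v 0 i) = \sum_j rho j *~ (v *m A) 0 j.
Proof.
rewrite mulr_sumr; under eq_bigr => i _ do rewrite mulrzAr aE mulrz_suml.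
rewrite exchange_big; apply: eq_bigr => j _ /=; rewrite mxE mulrz_sumr.
by apply: eq_bigr => i _; rewrite -mulrzA mulrC.
Qed.

Lemma det_mul_neq0 : \det A != 0.
Proof.
apply/det0P => -[v /rV0Pn[i vi] vA]; move/eqP: vi; apply.
apply: (zbasis_free rhoP (z := fun i => v 0 i)); apply: (mulrI a_unit).
by rewrite mul_zcomb vA mulr0 big1 // => j _; rewrite mxE.
Qed.

Lemma inv_mul_det_mem : O (a^-1 *~ \det A).
Proof.
have [u uE] : exists u, 1 = zcomb rho u by apply/rhoP.1.
pose v := (\row_i u i) *m \adj A.
suff -> : a^-1 *~ \det A = \sum_i rho i *~ v 0 i by apply/rhoP.1; exists (v 0).
apply: (mulrI a_unit); rewrite mulrzAr divrr // mul_zcomb -mulmxA mul_adj_mx.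
rewrite uE mulrz_suml; apply: eq_bigr => j _.
by rewrite mul_mx_scalar !mxE mulrC mulrzA.
Qed.

End LeftMultiplication.

Lemma order_inverse_bound a : O a -> a \is a GRing.unit ->
  exists M : nat, [/\ (0 < M)%N, M%:R <= n`!%:R * (1 + H * dsqr a) ^+ n & O (a^-1 *+ M)].
Proof.
move=> Oa a_unit; have [r [rho [rn rhoP rho0 red]]] := order_reduced_basis.
have /choice[A AE] i : exists z : 'I_r -> int, a * rho i = zcomb rho z.
  by apply/rhoP.1/OM => //; exact: (zbasis_mem rhoP).
have aE i : a * rho i = \sum_j rho j *~ (\matrix_(i, j) A i j) i j.
  by rewrite AE; apply: eq_bigr => j _; rewrite mxE.
exists `|\det (\matrix_(i, j) A i j)|%N; split.
- by rewrite absz_gt0 (det_mul_neq0 rhoP a_unit aE).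
- rewrite natr_absz; have Ha0 : 0 <= H * dsqr a by rewrite mulr_ge0 ?dsqr_ge0.
  have B1 : 1 <= 1 + H * dsqr a by rewrite lerDl.
  apply: (le_trans (int_det_le B1 rho0 _)) => [i j|].
    rewrite mxE; apply: (le_trans (red (A i) j)); rewrite -AE mulrDl mul1r -mulrA.
    apply: ler_wpDl; first exact/ltW/rho0.
    by apply: ler_wpM2l => //; exact: dsqrM.
  have B0 := le_trans ler01 B1.
  by apply: ler_pM => //; rewrite ?exprn_ge0 ?ler_nat ?leq_fact ?ler_weXn2l.
- exact: subgroup_absz (inv_mul_det_mem rhoP a_unit aE).
Qed.

Section Center.
Variable k : nat.
Hypothesis quatD : quaternion_algebra D.
Hypothesis k_gt0 : (0 < k)%N.
Hypothesis kP : codifferent_exponent k.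

Let h (x y : F) : rat := alg_trace (x * y).
Let T : set F := [set a | exists2 x, O x & a = trd x].

Let hS : symmetric_form h.
Proof. by apply: symmetric_formI => *; [rewrite /h mulrDl raddfD|rewrite /h mulrC]. Qed.

Let hZl q x y : h (q *: x) y = q * h x y.
Proof. by rewrite /h -scalerAl alg_traceZ. Qed.

Let h_gt0 x : x != 0 -> 0 < h x x. Proof. exact: (alg_trace_sqr_gt0 sigP). Qed.

Let h_int : integral_on h T.
Proof. by move=> _ _ [u Ou ->] [v Ov ->]; exact: order_trd_mul_int. Qed.

Lemma trd_order_zlattice : zlattice n T.
Proof.
have [r [rho [_ rhoP _ _]]] := order_reduced_basis; split.
- split; first by exists 0; [exact: subgroup0|rewrite [trd 0]raddf0].
  move=> _ _ [x Ox ->] [y Oy ->]; exists (x - y); first exact: subgroupB.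
  by rewrite [trd (_ - _)]raddfB.
- exists r, (fun i => trd (rho i)) => _ [x /rhoP.1[z ->] ->]; exists z.
  by rewrite [trd _]raddf_sum; apply: eq_bigr => i _; rewrite raddfMz.
- apply: (rank_le_inj (f := in_alg D)) (@rank_le_dimQ F D) => // x /eqP.
  by rewrite fmorph_eq0 => /eqP.
Qed.

Lemma trd_order_nondeg y : (forall x, T x -> h y x = 0) -> y = 0.
Proof.
move=> y0; have [K K0 OK] := OQ y%:A.
have : h y (y *+ (2 * K)) = 0.
  apply: y0; exists (y%:A *+ K) => //; rewrite -scaler_nat trdZ trd_alg_quaternion //.
  by rewrite mulrnA mulr_natl mulr_natl.
rewrite (biaddMnr hS.1) => /eqP; rewrite mulrn_eq0 muln_eq0 /= eqn0Ngt K0 => /eqP hy.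
by apply/eqP/negPn/negP => /h_gt0; rewrite hy ltxx.
Qed.

(* The dual vectors of a reduced basis [t] of [T], which are short because [h] is
   integral on [T], so that [h (t j) (t j) >= 1]. *)
Lemma center_dual_basis : exists e (t f : 'I_e -> F),
  [/\ (e <= n)%N, forall j, O ((f j)%:A *+ k), forall j, h (f j) (f j) <= H
    & forall x : F, x = \sum_j h x (t j) *: f j].
Proof.
have [hB hC] := hS; have TL := trd_order_zlattice.
have [e [t [e_le tP t0 red]]] := hermite_basis hS TL (fun x _ => @h_gt0 x).
have Tt i : T (t i) := zbasis_mem tP i.
have [|q [q0 _ dual]] := gram_det_dual_exponent hB h_int _ tP.
  by move=> x Tx hx; apply/eqP/negPn/negP => /h_gt0; rewrite hx ?ltxx.
have [u uP] := dual_exponent_basis tP dual.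
have q_neq0 : q%:R != 0 :> rat by rewrite pnatr_eq0 -lt0n.
pose f i := q%:R^-1 *: u i.
have hf i (z : 'I_e -> int) : h (f i) (zcomb t z) = (z i)%:~R by rewrite hZl (uP i).2 mulKf.
have ut i l : h (u i) (t l) = q%:R * (i == l)%:R.
  by have := (uP i).2 (fun j => (j == l)%:R); rewrite zcomb_delta rmorph_nat.
exists e, t, f; split=> // [j|j|x].
- apply: kP => x Ox; rewrite mulr_algr trQ_trdQ /trdQ trdZ rpredM ?rpred_nat //.
  have /tP.1[z xz] : T (trd x) by exists x.
  by rewrite -[alg_trace _]/(h _ _) xz hf intr_int.
- have t1 : 1 <= h (t j) (t j).
    by have /intrP[z zE] := h_int (Tt j) (Tt j); have := t0 j; rewrite zE ltr0z ler1z.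
  have u_ge0 x : 0 <= h x x.
    by have [->|/h_gt0/ltW//] := eqVneq x 0; rewrite (biadd0l hB).
  have u_short : h (u j) (u j) * h (t j) (t j) <= H * q%:R ^+ 2.
    have /tP.1[z uj] := (uP j).1.
    by rewrite {1 2}uj; apply: (hermite_reduced_dual_le hB) => // l; rewrite -uj.
  have q2 : 0 < q%:R ^+ 2 :> rat by rewrite exprn_gt0 ?ltr0n.
  rewrite -(ler_pM2l q2) [leRHS]mulrC; apply: le_trans u_short.
  have -> : q%:R ^+ 2 * h (f j) (f j) = h (u j) (u j) by rewrite hZl hC hZl; field.
  by rewrite -[leLHS]mulr1 ler_wpM2l.
apply/eqP; rewrite -subr_eq0; apply/eqP/trd_order_nondeg => _ /tP.1[z ->].
rewrite (biadd_sumr hB) big1 // => l _; rewrite (biaddMzr hB) (biaddBl hB) (biadd_suml hB).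
rewrite (bigD1 l) //= big1 => [|j /negPf jl]; rewrite !hZl ut.
  by rewrite eqxx mulr1 mulVf // mulr1 addr0 subrr mul0rz.
by rewrite jl !mulr0.
Qed.

(* Round the coordinates of [f] in a dual basis to multiples of [k]. *)
Lemma order_center_approx (f : F) : exists2 s : F, O s%:A
  & dsqr ((f + s)%:A : D) <= (2 * n ^ 2 * hermite_const n)%:R * k%:R ^+ 2.
Proof.
have [e [t [g [e_le Og g_short gE]]]] := center_dual_basis.
have k0 : 0 < k%:R :> rat by rewrite ltr0n.
pose a j := h f (t j); pose z j := Num.floor (a j / k%:R).
pose w j := a j - k%:R * (z j)%:~R; exists (- \sum_j g j *+ k *~ z j).
  rewrite scaleNr scaler_suml; apply/(subgroupN sO)/(subgroup_sum sO) => i _.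
  by rewrite -scalerMzl -scalerMnl; exact: (subgroupMz sO).
have w_le j : w j ^+ 2 <= k%:R ^+ 2.
  have := floor_le (a j / k%:R); have := floorD1_gt (a j / k%:R).
  rewrite ler_pdivlMr // ltr_pdivrMr // intrD mulrDl mul1r -/(z j) => h1 h2.
  by rewrite ler_sqr ?nnegrE /w; lra.
have -> : f - \sum_j g j *+ k *~ z j = \sum_j w j *: g j.
  rewrite {1}(gE f) -sumrB; apply: eq_bigr => j _; rewrite scalerBl; congr (_ - _).
  by rewrite -scaler_int -scaler_nat scalerA mulrC.
have term j : dsqr ((w j *: g j)%:A : D) <= 2%:R * H * k%:R ^+ 2.
  rewrite dsqr_alg alg_degree_quaternion // -scalerAl -scalerAr scalerA -expr2 alg_traceZ.
  rewrite -mulrA ler_wpM2l // mulrC ler_pM ?sqr_ge0 //; last exact: g_short.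
  by have [->|/h_gt0/ltW//] := eqVneq (g j) 0; rewrite mul0r raddf0.
rewrite scaler_suml (le_trans (dsqr_sum _)) //.
apply: (@le_trans _ _ (e%:R * \sum_(j < e) 2%:R * H * k%:R ^+ 2)).
  by rewrite ler_wpM2l // ler_sum.
rewrite sumr_const card_ord -[X in _ * X <= _]mulr_natl [leLHS]mulrA natrM (natrM _ 2) natrX.
have -> : 2%:R * n%:R ^+ 2 * H * k%:R ^+ 2 = n%:R * n%:R * (2%:R * H * k%:R ^+ 2).
  by ring.
rewrite ler_wpM2r ?mulr_ge0 ?sqr_ge0 //.
by rewrite -!natrM ler_nat leq_mul.
Qed.

End Center.

End Order.

(** * Skew-Hermitian forms with monomial Gram matrix *)

Section Form.
Variables (V : lmodType D) (psi : V -> V -> D).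
Hypothesis psiP : skew_hermitian_form dag psi.
Local Notation E := (fun x y : V => trdQ (psi x y)).
Local Notation n := (dimQ D).

Lemma psi_biadditive : biadditive psi.
Proof.
have [psiDl psiDr _ _] := psiP; split=> [y x x'|x y y'].
  by apply/eqP; rewrite eq_sym subr_eq -psiDl subrK.
by apply/eqP; rewrite eq_sym subr_eq -psiDr subrK.
Qed.

Let psiB := psi_biadditive.

Lemma psiZl a x y : psi (a *: x) y = a * psi x y.
Proof. by case: psiP => _ _ psiZ _; rewrite -[y in LHS]scale1r psiZ dag1 mulr1. Qed.

Lemma psiZr a x y : psi x (a *: y) = psi x y * dag a.
Proof. by case: psiP => _ _ psiZ _; rewrite -[x in LHS]scale1r psiZ mul1r. Qed.

Lemma psiC x y : psi y x = - dag (psi x y). Proof. by case: psiP. Qed.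

Lemma psi_eq0C x y : psi x y = 0 -> psi y x = 0.
Proof. by move=> e; rewrite psiC e raddf0 oppr0. Qed.

Lemma skew_psi x : dag (psi x x) = - psi x x.
Proof. by rewrite [in RHS]psiC opprK. Qed.

Lemma trace_form_biadditive : biadditive E.
Proof. by split=> [y x x'|x y y']; rewrite ?(biaddBl psiB) ?(biaddBr psiB) raddfB. Qed.

Definition nondeg (S : set V) : Prop :=
  forall x, S x -> x != 0 -> exists2 y, S y & psi x y != 0.

Definition stable (A : set D) (S : set V) : Prop :=
  forall a x, A a -> S x -> S (a *: x).

(* The Gram matrix of [v] is supported on the graph of the involution [tau] and its
   entries there are invertible: an orthogonal family for [tau = id], a family of
   hyperbolic planes when [tau] exchanges the indices in pairs. *)
Definition gram_monomial p (v : 'I_p -> V) (tau : 'I_p -> 'I_p) : Prop :=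
  [/\ involutive tau, forall i j, j != tau i -> psi (v i) (v j) = 0
    & forall i, psi (v i) (v (tau i)) \is a GRing.unit].

Definition gram_coef p (v : 'I_p -> V) (tau : 'I_p -> 'I_p) (x : V) (i : 'I_p) : D :=
  psi x (v (tau i)) / psi (v i) (v (tau i)).

Definition gram_proj p (v : 'I_p -> V) (tau : 'I_p -> 'I_p) (x : V) : V :=
  \sum_i gram_coef v tau x i *: v i.

Definition perp p (v : 'I_p -> V) (S : set V) : set V :=
  [set x | S x /\ forall i, psi x (v i) = 0].

Definition perp_trivial p (v : 'I_p -> V) (S : set V) : Prop :=
  forall x, perp v S x -> x = 0.

Section GramMonomial.
Variables (p : nat) (v : 'I_p -> V) (tau : 'I_p -> 'I_p).
Hypothesis vP : gram_monomial v tau.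

Lemma psi_gram_sum (a : 'I_p -> D) j :
  psi (\sum_i a i *: v i) (v j) = a (tau j) * psi (v (tau j)) (v j).
Proof.
have [tauK orth _] := vP; rewrite (biadd_suml psiB) (bigD1 (tau j)) //= psiZl.
rewrite big1 ?addr0 // => i ij; rewrite psiZl orth ?mulr0 //.
by apply: contra_neq ij => ->; rewrite tauK.
Qed.

Lemma psi_gram_proj x j : psi (gram_proj v tau x) (v j) = psi x (v j).
Proof.
have [tauK _ /(_ (tau j))] := vP; rewrite psi_gram_sum /gram_coef tauK => u.
by rewrite divrK.
Qed.

Lemma gram_monomial_free (a : 'I_p -> D) : \sum_i a i *: v i = 0 -> forall i, a i = 0.
Proof.
have [tauK _ u] := vP => a0 i; have := psi_gram_sum a (tau i).
by rewrite a0 (biadd0l psiB) tauK => /esym e; apply: (mulIr (u i)); rewrite e mul0r.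
Qed.

Lemma gram_proj_is_zmod_morphism : zmod_morphism (gram_proj v tau).
Proof.
move=> x y; rewrite -sumrB; apply: eq_bigr => i _.
by rewrite /gram_coef (biaddBl psiB) mulrBl scalerBl.
Qed.

Lemma gram_proj_perp S x : perp v S x -> gram_proj v tau x = 0.
Proof. by move=> [_ ox]; apply: big1 => i _; rewrite /gram_coef ox mul0r scale0r. Qed.

Lemma perp_rank S s :
  (0 < p)%N -> (forall i, S (v i)) -> rank_le s.+1 S -> rank_le s (perp v S).
Proof.
have [_ _ u] := vP => p0 Sv rk l f Sf f_free; pose i0 := Ordinal p0.
have Sv0f : forall i, S (fam_cons (v i0) f i).
  by apply: fam_consP => // i; case: (Sf i).
apply: (rk _ _ Sv0f) => z; rewrite zcomb_cons => zE.
have z0 : z ord0 = 0.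
  apply/eqP/negPn/negP => z0; have := unitr0 D; rewrite -(_ : psi (v i0) (v (tau i0)) = 0) ?u //.
  apply: (torsion_free_mulrz (@falg_torsion_free F D) z0); rewrite -(biaddMzl psiB).
  have := congr1 (psi^~ (v (tau i0))) zE; rewrite (biaddDl psiB) (biadd0l psiB).
  rewrite (biadd_suml psiB) big1 ?addr0 // => i _.
  by rewrite (biaddMzl psiB) (Sf i).2 mul0rz.
move=> i; case: (unliftP ord0 i) => [j|] -> //; move: j; apply: f_free.
by move: zE; rewrite z0 mulr0z add0r.
Qed.

End GramMonomial.

Lemma perp_sub p (v : 'I_p -> V) S : perp v S `<=` S. Proof. by move=> x []. Qed.

Lemma perp_subgroup p (v : 'I_p -> V) S : subgroup S -> subgroup (perp v S).
Proof.
move=> sS; split=> [|x x' [Sx ox] [Sx' ox']].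
  by split=> [|i]; [exact: subgroup0|rewrite (biadd0l psiB)].
by split=> [|i]; [exact: subgroupB|rewrite (biaddBl psiB) ox ox' subr0].
Qed.

Lemma perp_stable A p (v : 'I_p -> V) S : stable A S -> stable A (perp v S).
Proof. by move=> st a x Aa [Sx ox]; split=> [|i]; [exact: st|rewrite psiZl ox mulr0]. Qed.

Lemma perp_zlattice p (v : 'I_p -> V) tau S s : gram_monomial v tau -> (0 < p)%N ->
  (forall i, S (v i)) -> zlattice s.+1 S -> zlattice s (perp v S).
Proof.
move=> vP p0 Sv [sS [l [b Sb]] rk]; split; first exact: perp_subgroup.
  by exists l, b => x /perp_sub/Sb.
exact: perp_rank vP _ _ _ _ rk.
Qed.

(* Up to the index [M], the group [S] splits as the [A]-span of [v] plus its
   orthogonal complement. *)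
Definition splits (A : set D) (S : set V) p (v : 'I_p -> V) (tau : 'I_p -> 'I_p) (M : nat) :
    Prop :=
  [/\ gram_monomial v tau, forall i, S (v i), (0 < M)%N
    & forall x i, S x -> A (gram_coef v tau x i *+ M)].

Lemma splits0 A S (v : 'I_0 -> V) (tau : 'I_0 -> 'I_0) : splits A S v tau 1.
Proof. by split=> // [|[]|x []] //; split=> -[]. Qed.

Section Split.
Variables (A : set D) (S : set V) (p : nat) (v : 'I_p -> V) (tau : 'I_p -> 'I_p) (M : nat).
Hypothesis sS : subgroup S.
Hypothesis stS : stable A S.
Hypothesis vS : splits A S v tau M.

Definition perp_proj (x : V) : V := (x - gram_proj v tau x) *+ M.

Lemma perp_proj_mem x : S x -> perp v S (perp_proj x).
Proof.
have [vP Sv _ AM] := vS => Sx; split=> [|j]; rewrite /perp_proj.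
  rewrite mulrnBl -sumrMnl; apply: (subgroupB sS); first exact: subgroupMn.
  by apply: (subgroup_sum sS) => i _; rewrite scalerMnl; apply: stS => //; exact: AM.
by rewrite (biaddMnl psiB) (biaddBl psiB) (psi_gram_proj vP) subrr mul0rn.
Qed.

Lemma perp_projD x x' : perp_proj (x + x') = perp_proj x + perp_proj x'.
Proof.
rewrite /perp_proj -mulrnDl addrACA -opprD; congr ((_ - _) *+ M).
apply/eqP; rewrite -subr_eq -gram_proj_is_zmod_morphism ?addrK //; by case: vS.
Qed.

Lemma perp_proj_id x : perp v S x -> perp_proj x = x *+ M.
Proof. by move=> px; rewrite /perp_proj (gram_proj_perp _ px) subr0. Qed.

Lemma psi_perp_proj x x' : perp v S x' -> psi (perp_proj x) x' = psi x x' *+ M.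
Proof.
move=> [_ ox]; rewrite /perp_proj (biaddMnl psiB) (biaddBl psiB) (biadd_suml psiB).
by rewrite big1 ?subr0 // => i _; rewrite psiZl psi_eq0C ?mulr0.
Qed.

Lemma gram_proj_id x : perp_trivial v S -> S x -> gram_proj v tau x = x.
Proof.
have [_ _ M0 _] := vS => perp0 /perp_proj_mem/perp0 e; apply/esym/eqP.
by rewrite -subr_eq0; apply/eqP; exact: lmod_torsion_free e.
Qed.

Lemma perp_nondeg : nondeg S -> nondeg (perp v S).
Proof.
have [_ _ M0 _] := vS => nd x px x0; have [x' Sx' xx'] := nd x px.1 x0.
exists (perp_proj x'); first exact: perp_proj_mem.
apply: contra_neq xx' => /psi_eq0C; rewrite psi_perp_proj //.
by move/(falg_torsion_free M0)/psi_eq0C.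
Qed.

Lemma perp_dual_exponent q :
  dual_exponent E S q -> dual_exponent E (perp v S) (M ^ 2 * q)%N.
Proof.
move=> dS lam lamD; have sP := perp_subgroup v sS.
have [x x' Sx Sx'|w Sw wE] := dS (lam \o perp_proj).
  by rewrite /= perp_projD lamD //; exact: perp_proj_mem.
exists (perp_proj w) => [|x px]; first exact: perp_proj_mem.
rewrite psi_perp_proj // raddfMn /= wE; last exact: perp_sub px.
rewrite /= perp_proj_id // (additive_onMn sP lamD) // -[_ *+ M in LHS]mulr_natl.
by rewrite -[lam x *+ M]mulr_natl rmorphM rmorph_nat natrM natrX; ring.
Qed.

Lemma splits_dbasis :
  (forall x, inQ S x) -> perp_trivial v S -> dbasis v.
Proof.
have [vP _ _ _] := vS => SQ perp0; split=> [x|a]; last exact: (gram_monomial_free vP).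
have [K K0 SK] := SQ x; exists (fun i => ratD D K%:R^-1 * gram_coef v tau (x *+ K) i).
rewrite -{1}(scale_ratD_mulrn x K0) -{1}(gram_proj_id perp0 SK) scaler_sumr.
by apply: eq_bigr => i _; rewrite scalerA.
Qed.

Lemma span_over_sub : span_over A v `<=` S.
Proof.
have [_ Sv _ _] := vS => x [a [Aa ->]].
by apply: (subgroup_sum sS) => i _; exact: stS.
Qed.

Lemma splits_span_over x : perp_trivial v S -> S x ->
  span_over A v (x *+ M).
Proof.
have [_ _ _ AM] := vS => perp0 Sx; exists (fun i => gram_coef v tau x i *+ M).
split=> [i|]; first exact: AM.
rewrite -{1}(gram_proj_id perp0 Sx) -sumrMnl.
by apply: eq_bigr => i _; rewrite scalerMnl.
Qed.

End Split.

Section Concatenation.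
Variables p1 p2 : nat.
Variables (v1 : 'I_p1 -> V) (v2 : 'I_p2 -> V).
Variables (tau1 : 'I_p1 -> 'I_p1) (tau2 : 'I_p2 -> 'I_p2).

Let catE := (fam_catl, fam_catr, tau_catl, tau_catr).

Lemma perp_cat S x : perp (fam_cat v1 v2) S x -> perp v2 (perp v1 S) x.
Proof.
move=> [Sx ox]; split=> [|j]; last by have := ox (rshift p1 j); rewrite catE.
by split=> // j; have := ox (lshift p2 j); rewrite catE.
Qed.

Lemma gram_monomial_cat : gram_monomial v1 tau1 -> gram_monomial v2 tau2 ->
  (forall i j, psi (v2 j) (v1 i) = 0) ->
  gram_monomial (fam_cat v1 v2) (tau_cat tau1 tau2).
Proof.
move=> [tauK1 o1 u1] [tauK2 o2 u2] o12; split.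
- by elim/ord_cat_ind => j; rewrite !catE ?tauK1 ?tauK2.
- elim/ord_cat_ind => k; elim/ord_cat_ind => l; rewrite !catE.
  + by rewrite (inj_eq (@lshift_inj _ _)); exact: o1.
  + by move=> _; exact: psi_eq0C.
  + by [].
  + by rewrite (inj_eq (@rshift_inj _ _)); exact: o2.
- by elim/ord_cat_ind => j; rewrite !catE.
Qed.

Lemma splits_cat A S M1 M2 : subgroup A -> subgroup S -> stable A S ->
  splits A S v1 tau1 M1 -> splits A (perp v1 S) v2 tau2 M2 ->
  splits A S (fam_cat v1 v2) (tau_cat tau1 tau2) (M1 * M2).
Proof.
move=> sA sS stS spl1 [vP2 Sv2 M20 AM2]; have [vP1 Sv1 M10 AM1] := spl1; split.
- by apply: gram_monomial_cat vP1 vP2 _ => i j; exact: (Sv2 j).2.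
- by elim/ord_cat_ind => j; rewrite catE //; exact: perp_sub (Sv2 j).
- by rewrite muln_gt0 M10.
move=> x i Sx; move: i; elim/ord_cat_ind => j; rewrite /gram_coef !catE.
  by rewrite mulrnA; apply: (subgroupMn sA); exact: AM1.
rewrite mulrnA -mulrnAl -(psi_perp_proj tau1 _ _ (Sv2 (tau2 j))).
by apply: AM2; exact: (perp_proj_mem sS stS spl1).
Qed.

End Concatenation.

(** * Normalized frames *)

(* [symp] selects symplectic bases, for a field [D], or unitary ones. *)
Definition albert_type (symp : bool) : Prop :=
  if symp then is_center D else quaternion_algebra D /\ totally_indefinite R D.

Definition pairing (symp : bool) (i : nat) : nat :=
  if symp then (if odd i then i.-1 else i.+1) else i.

Definition pairs_indices (symp : bool) p (tau : 'I_p -> 'I_p) : Prop :=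
  forall i, tau i = pairing symp i :> nat.

Lemma pairs_indices_cat (symp : bool) p (tau1 : 'I_symp.+1 -> 'I_symp.+1) (tau2 : 'I_p -> 'I_p) :
  pairs_indices symp tau1 -> pairs_indices symp tau2 ->
  pairs_indices symp (tau_cat tau1 tau2).
Proof.
move=> sh1 sh2; elim/ord_cat_ind => j; rewrite ?tau_catl ?tau_catr /= ?sh1 ?sh2 //.
rewrite /pairing; clear; case: symp => //=; rewrite !addSn !add0n /= negbK.
by case: (nat_of_ord j) => [|l] //=; case: ifP.
Qed.

Definition elementary_block (symp : bool) (S : set V) (P : D -> Prop) : Prop :=
  exists (v : 'I_symp.+1 -> V) tau,
    [/\ gram_monomial v tau, pairs_indices symp tau, forall i, S (v i)
      & forall i, P (psi (v i) (v (tau i)))].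

Lemma dag_center d : is_center D -> dag d = d.
Proof. by move=> cD; have [a ->] := cD d; rewrite dag_alg. Qed.

Lemma center_unit (d : D) : is_center D -> d != 0 -> d \is a GRing.unit.
Proof.
move=> cD; have [a ->] := cD d => a0; apply/unitrP; exists (a^-1)%:A.
have {}a0 : a != 0 by apply: contraNneq a0 => ->; rewrite scale0r.
by rewrite !in_algM mulVf // mulfV // scale1r.
Qed.

Lemma elementary_block_pair (S : set V) (P : D -> Prop) x z : is_center D ->
  S x -> S z -> psi x z != 0 -> P (psi x z) -> P (- psi x z) -> elementary_block true S P.
Proof.
move=> cD Sx Sz xz Pxz PNxz.
have zx : psi z x = - psi x z by rewrite psiC dag_center.
have alt u : psi u u = 0.
  have /eqP := psiC u u; rewrite dag_center // -addr_eq0 -mulr2n => /eqP.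
  exact: falg_torsion_free.
have xz_unit := center_unit cD xz.
exists (fun i : 'I_2 => if i == ord0 then x else z), (@rev_ord 2); split.
- split; first exact: rev_ordK.
    by case=> -[|[|//]] ? -[[|[|//]] ?]; rewrite -!val_eqE.
  by case=> -[|[|//]] ?; rewrite -!val_eqE //= zx unitrN.
- by case=> -[|[|//]] ?.
- by move=> i; case: ifP.
- by case=> -[|[|//]] ?; rewrite -!val_eqE //= zx.
Qed.

Lemma elementary_block_vector (S : set V) (P : D -> Prop) x : quaternion_algebra D ->
  S x -> psi x x != 0 -> P (psi x x) -> elementary_block false S P.
Proof.
move=> qD Sx xx Pxx; exists (fun=> x), id; split=> //; split=> // [i j|i].
  by rewrite !ord1 eqxx.
exact: skew_unit (skew_psi x) xx.
Qed.

(* If [psi y x + psi x y] vanished for all [y], then [d |-> dag d] would be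
   conjugation by [psi y x], so that [D] would be commutative. *)
Lemma exists_polar_neq0 (A : set D) (S : set V) x :
  quaternion_algebra D -> (forall d, inQ A d) -> stable A S -> nondeg S ->
  S x -> x != 0 -> exists2 y, S y & psi y x + psi x y != 0.
Proof.
move=> qD AQ stS nd Sx x0; apply: contrapT => none.
have [y Sy yx] := nd x Sx x0; have {}yx : psi y x != 0.
  by apply: contra_neq yx; exact: psi_eq0C.
have polar0 z : S z -> psi z x = dag (psi z x).
  move=> Sz; apply/eqP; rewrite -subr_eq0 -psiC; apply/negPn/negP => zx.
  by apply: none; exists z.
set c := psi y x in yx; have symm e : e * c = dag (e * c).
  have [K K0 AK] := AQ e; have := polar0 _ (stS _ _ AK Sy).
  rewrite psiZl mulrnAl [dag _]raddfMn => /eqP; rewrite -subr_eq0 -mulrnBl => /eqP.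
  by move/(falg_torsion_free K0)/eqP; rewrite subr_eq0 => /eqP.
have dagc d : d * c = c * dag d.
  by rewrite symm dagM -/c; congr (_ * _); have := symm 1; rewrite mul1r.
have comm d e : d * e * c = e * d * c.
  by rewrite dagc dagM mulrA -dagc -mulrA -dagc mulrA.
have [i [j [a [b [[a0 b0] ii jj ij _]]]]] := qD; move/eqP: yx; apply.
have iu : i \is a GRing.unit.
  by apply/unitrP; exists (a^-1 *: i); rewrite -scalerAl -scalerAr ii scalerA mulVf ?scale1r.
have ju : j \is a GRing.unit.
  by apply/unitrP; exists (b^-1 *: j); rewrite -scalerAl -scalerAr jj scalerA mulVf ?scale1r.
have : i * j * c *+ 2 = 0 by rewrite mulr2n {2}comm ij mulNr addNr.
move/(falg_torsion_free (isT : 0 < 2)%N); rewrite -mulrA => ijc.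
by apply: (mulrI ju); apply: (mulrI iu); rewrite ijc !mulr0.
Qed.

Lemma exists_anisotropic (A : set D) (S : set V) :
  quaternion_algebra D -> (forall d, inQ A d) -> stable A S -> subgroup S ->
  nondeg S -> (exists2 x, S x & x != 0) -> exists2 x, S x & psi x x != 0.
Proof.
move=> qD AQ stS sS nd [x Sx x0]; apply: contrapT => none.
have isotropic z : S z -> psi z z = 0.
  by move=> Sz; apply/eqP/negPn/negP => ?; apply: none; exists z.
have [y Sy /eqP] := exists_polar_neq0 qD AQ stS nd Sx x0; apply.
have := isotropic _ (subgroupD sS Sy Sx).
by rewrite (biaddDl psiB) !(biaddDr psiB) !isotropic // add0r addr0.
Qed.

Definition frame_const (dim : nat) : nat := 4 * dim.

Definition normalized (c : D) : Prop :=
  dsqr c <= (frame_const n)%:R /\ dsqr c^-1 <= (frame_const n)%:R.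

Lemma dimF_le_dimQ : (\dim {:F} <= dimQ D)%N.
Proof. by rewrite leq_pmulr // (adim_gt0 {:D}%AS). Qed.

Lemma normalized_one : is_center D -> normalized 1.
Proof.
move=> cD; suff d1 : dsqr 1 <= (frame_const n)%:R by split; rewrite ?invr1.
have -> : dsqr 1 = (\dim {:F})%:R.
  rewrite -[1 in LHS]scale1r dsqr_alg mulr1 alg_trace1 /alg_degree dim_center //.
  by rewrite mul1r.
by rewrite ler_nat (leq_trans dimF_le_dimQ) // leq_pmull.
Qed.

Lemma normalizedN c : normalized c -> normalized (- c).
Proof. by rewrite /normalized invrN !dsqrN. Qed.

Lemma skew_dsqr_le c (b : F) : quaternion_algebra D -> dag c = - c -> c * c = - b%:A ->
  (forall s, sig s b <= 2%:R) -> dsqr c <= (frame_const n)%:R.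
Proof.
move=> qD sc cc b_le; rewrite /dsqr /dform sc mulrN cc opprK trdQ_alg_quaternion //.
rewrite (le_trans (ler_wpM2l _ (alg_trace_le sigP b_le))) // -natrM ler_nat.
by have := dimF_le_dimQ; rewrite /frame_const; lia.
Qed.

Lemma skew_normalized c (b : F) : quaternion_algebra D -> dag c = - c -> c * c = - b%:A ->
  (forall s, 2%:R^-1 <= sig s b <= 2%:R) -> normalized c.
Proof.
move=> qD sc cc b_bounds.
have b_gt0 s : 0 < sig s b by case/andP: (b_bounds s) => h _; apply: lt_le_trans h; lra.
have b0 := embeddings_gt0_neq0 b_gt0.
have c0 : c != 0.
  apply: contraNneq b0 => c0; move/eqP: cc.
  by rewrite c0 mul0r eq_sym oppr_eq0 scaler_eq0 oner_eq0 orbF.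
have cV : c^-1 = - (b^-1 *: c).
  apply: (mulrI (skew_unit qD sc c0)); rewrite divrr ?skew_unit //.
  by rewrite mulrN -scalerAr cc scalerN opprK scalerA mulVf ?scale1r.
split; first by apply: (skew_dsqr_le qD sc cc) => s; case/andP: (b_bounds s).
apply: (skew_dsqr_le (b := b^-1)) => // [||s].
- by rewrite cV [dag (- _)]raddfN /= dagZ sc scalerN.
- rewrite cV mulrNN -scalerAl -scalerAr cc scalerA scalerN scalerA.
  by rewrite -mulrA mulVf ?mulr1.
- by rewrite fmorphV invf_ple ?posrE //; case/andP: (b_bounds s).
Qed.

Section AlbertType.
Variable symp : bool.
Hypothesis sympP : albert_type symp.

Lemma normalized_block (W : set V) :
  stable [set: D] W -> subgroup W -> nondeg W -> (exists2 x, W x & x != 0) ->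
  elementary_block symp W normalized.
Proof.
have setQ (d : D) : inQ [set: D] d by exact: sub_inQ.
move: sympP; case: symp => [cD|[qD indef]] stW sW nd nz.
  have [x Wx x0] := nz; have [z Wz xz] := nd x Wx x0.
  have xz_unit := center_unit cD xz.
  have x'z : psi ((psi x z)^-1 *: x) z = 1 by rewrite psiZl mulVr.
  apply: (elementary_block_pair cD (stW (psi x z)^-1 _ I Wx) Wz); rewrite x'z ?oner_eq0 //.
    exact: normalized_one.
  exact/normalizedN/normalized_one.
have [x Wx xx] := exists_anisotropic qD setQ stW sW nd nz.
have [a aE /(approx_fourth_root sigP)[u u_bounds]] := skew_sqr qD (skew_psi x) xx.
have uxE : psi (u%:A *: x) (u%:A *: x) = (u ^+ 2) *: psi x x.
  by rewrite psiZl psiZr dag_alg mulr_algl mulr_algr scalerA.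
have sq : psi (u%:A *: x) (u%:A *: x) * psi (u%:A *: x) (u%:A *: x) = - (u ^+ 4 * a)%:A.
  rewrite uxE -scalerAl -scalerAr aE !scalerN !scalerA; congr (- (_ *: _)).
  by ring.
apply: (elementary_block_vector qD (stW u%:A _ I Wx)); last first.
  exact: skew_normalized (skew_psi _) sq u_bounds.
apply: contraTneq (u_bounds (Ordinal (adim_gt0 {:F}%AS))) => ux0.
move/eqP: sq; rewrite ux0 mul0r eq_sym oppr_eq0 scaler_eq0 oner_eq0 orbF => /eqP ->.
by rewrite rmorph0 invr_le0 lern0.
Qed.

Lemma normalized_frame s (W : set V) :
  subgroup W -> stable [set: D] W -> nondeg W -> rank_le s W ->
  exists p (v : 'I_p -> V) tau,
    [/\ (p <= 2 * s)%N, splits [set: D] W v tau 1, perp_trivial v W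
      & forall i, normalized (psi (v i) (v (tau i)))].
Proof.
elim/ltn_ind: s W => s IHs W sW stW nd rk.
have [nz|none] := pselect (exists2 x, W x & x != 0); last first.
  exists 0, (fun=> 0), id; split=> // [|x [Wx _]|[]//]; first exact: splits0.
  by apply/eqP/negPn/negP => x0; apply: none; exists x.
case: s IHs rk => [_ rk|s IHs rk].
  by have [x /(rank_le0 (@lmod_torsion_free _ _ _) rk) ->] := nz; rewrite eqxx.
have [v [tau [vP _ Wv vN]]] := normalized_block stW sW nd nz.
have vS : splits [set: D] W v tau 1 by split.
have [||||p [w [tau' [ps wS perp0 wN]]]] := IHs s (leqnn _) (perp v W).
- exact: perp_subgroup.
- exact: perp_stable.
- exact: perp_nondeg sW stW vS nd.
- exact: (perp_rank vP isT Wv rk).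
exists (symp.+1 + p)%N, (fam_cat v w), (tau_cat tau tau'); split.
- by rewrite mulnS leq_add //; case: (symp).
- exact: (splits_cat _ sW stW vS wS).
- by move=> x /perp_cat/perp0.
- by elim/ord_cat_ind => j; rewrite ?fam_catl ?fam_catr ?tau_catl ?tau_catr ?fam_catl ?fam_catr //.
Qed.

(** * Compatible forms and short blocks *)

Lemma stable_inQ (A : set D) (S : set V) :
  (forall d, inQ A d) -> stable A S -> stable [set: D] (inQ S).
Proof.
move=> AQ stS a x _ [K K0 Kx]; have [M M0 Ma] := AQ a.
exists (M * K)%N; first by rewrite muln_gt0 M0.
have -> : a *: x *+ (M * K) = (a *+ M) *: (x *+ K).
  by rewrite -scalerMnl -scalerMnr -mulrnA mulnC.
exact: stS.
Qed.

Lemma nondeg_inQ (S : set V) : nondeg S -> nondeg (inQ S).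
Proof.
move=> nd x [K K0 Kx] x0; have [|y Sy xy] := nd _ Kx.
  by apply: contra_neq x0; exact: lmod_torsion_free.
exists y; first exact: sub_inQ.
by apply: contra_neq xy => xy; rewrite (biaddMnl psiB) xy mul0rn.
Qed.

Definition form_const (dim N : nat) : nat := ((2 * N) ^ 2 * frame_const dim)%N.

Definition pair_const (dim N : nat) : nat :=
  (form_const dim N * frame_const dim * hermite_const N ^ 2)%N.

Section CompatibleForm.
Variables (A : set D) (S : set V) (N p : nat) (v : 'I_p -> V) (tau : 'I_p -> 'I_p).
Hypothesis sS : subgroup S.
Hypothesis AQ : forall d, inQ A d.
Hypothesis stS : stable A S.
Hypothesis p_le : (p <= 2 * N)%N.
Hypothesis vS : splits [set: D] (inQ S) v tau 1.
Hypothesis perp0 : perp_trivial v (inQ S).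
Hypothesis normv : forall i, normalized (psi (v i) (v (tau i))).

Local Notation c i := (psi (v i) (v (tau i))).

Definition cform (x x' : V) : rat := \sum_i dform (psi x (v i)) (psi x' (v i)).

Lemma cform_symmetric : symmetric_form cform.
Proof.
have [dB dC] := dform_symmetric; apply: symmetric_formI => [x x' z|x z].
  rewrite -big_split; apply: eq_bigr => i _ /=.
  by rewrite (biaddDl psiB) (biaddDl dB).
by apply: eq_bigr => i _; exact: dC.
Qed.

Lemma cform_ge0 x : 0 <= cform x x.
Proof. by apply: sumr_ge0 => i _; exact: dsqr_ge0. Qed.

Lemma dsqr_le_cform x i : dsqr (psi x (v i)) <= cform x x.
Proof. by rewrite /cform (bigD1 i) //= lerDl sumr_ge0 // => j _; exact: dsqr_ge0. Qed.

Lemma gram_proj_full x : inQ S x -> gram_proj v tau x = x.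
Proof. exact: (gram_proj_id (inQ_subgroup sS) (stable_inQ AQ stS) vS perp0). Qed.

Lemma cform_gt0 x : inQ S x -> x != 0 -> 0 < cform x x.
Proof.
move=> Sx x0; rewrite lt_neqAle cform_ge0 andbT eq_sym; apply: contra_neq x0 => h0.
rewrite -(gram_proj_full Sx); apply: (gram_proj_perp tau (S := inQ S)); split=> // i.
by apply: dsqr_eq0; rewrite -h0 dsqr_le_cform.
Qed.

Lemma psi_expand x x' : inQ S x ->
  psi x x' = \sum_i gram_coef v tau x i * psi (v i) x'.
Proof.
move=> Sx; rewrite -{1}(gram_proj_full Sx) (biadd_suml psiB).
by apply: eq_bigr => i _; rewrite psiZl.
Qed.

Lemma psi_le_cform x x' : inQ S x ->
  dsqr (psi x x') <= (form_const n N)%:R * (cform x x * cform x' x').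
Proof.
move=> Sx; rewrite psi_expand //; apply: (le_trans (dsqr_sum _)).
have term i : dsqr (gram_coef v tau x i * psi (v i) x')
    <= (frame_const n)%:R * (cform x x * cform x' x').
  have coef_le : dsqr (gram_coef v tau x i) <= cform x x * (frame_const n)%:R.
    apply: le_trans (dsqrM _ _) _.
    exact: ler_pM (dsqr_ge0 _) (dsqr_ge0 _) (dsqr_le_cform x _) (normv i).2.
  rewrite psiC mulrN dsqrN mulrA (mulrC (frame_const n)%:R).
  apply: le_trans (dsqrM _ _) _; rewrite dsqr_dag.
  exact: ler_pM (dsqr_ge0 _) (dsqr_ge0 _) coef_le (dsqr_le_cform x' i).
apply: (le_trans (ler_wpM2l (ler0n _ _) (ler_sum _ (fun i _ => term i)))).
rewrite sumr_const card_ord -[X in _ * X <= _]mulr_natl !mulrA -natrM -natrM.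
rewrite ler_wpM2r ?cform_ge0 // ler_wpM2r ?cform_ge0 // ler_nat.
by rewrite leq_mul2r leq_mul ?orbT.
Qed.

(* The vector that represents [E w] through [cform] lies in [inQ S], and [u] is a
   multiple of it that lies in [S]. *)
Lemma cform_represents w : S w -> exists2 K : nat, (0 < K)%N & exists u, [/\ S u,
    forall x, S x -> cform u x = K%:R * E w x
  & K%:R ^+ 2 * cform w w <= (frame_const n)%:R * cform u u].
Proof.
have [vP v_mem _ _] := vS; have [tauK _ u] := vP; have [cB _] := cform_symmetric => Sw.
pose a i := - gram_coef v tau w (tau i) / c i; pose u0 := \sum_i a i *: v i.
have u0v j : psi u0 (v j) = - gram_coef v tau w j.
  by have := u (tau j); rewrite (psi_gram_sum vP) /a tauK => uj; rewrite divrK.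
have [K K0 SK] : inQ S u0.
  by apply: (subgroup_sum (inQ_subgroup sS)) => i _; exact: (stable_inQ AQ stS).
exists K => //; exists (u0 *+ K); split=> // [x Sx|].
  rewrite (biaddMnl cB) -[_ *+ K in LHS]mulr_natl psi_expand; last exact: sub_inQ.
  rewrite [trdQ _]raddf_sum; congr (_ * _); apply: eq_bigr => i _.
  by rewrite /dform u0v [psi (v i) x]psiC mulrN mulNr.
rewrite (form_mulrn _ _ cB) mulrCA ler_wpM2l ?sqr_ge0 // /cform mulr_sumr.
rewrite (reindex_inj (can_inj tauK)); apply: ler_sum => j _; rewrite -!/(dsqr _) u0v dsqrN.
rewrite -[psi w (v (tau j))](divrK (u j)) (le_trans (dsqrM _ _)) // mulrC.
by rewrite ler_wpM2r ?dsqr_ge0 //; exact: (normv j).1.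
Qed.

Lemma dual_vector_short q r (x : 'I_r -> V) i : zbasis S x ->
  hermite_reduced cform (hermite_const N)%:R x -> (0 < q)%N -> dual_exponent E S q ->
  exists w, [/\ S w, w != 0
    & cform w w * cform (x i) (x i) <= (frame_const n * hermite_const N)%:R * q%:R ^+ 2].
Proof.
move=> xP red q0 dS; have [w wP] := dual_exponent_basis xP dS; exists (w i).
have [cB _] := cform_symmetric; have [Sw wE] := wP i.
have wx l : E (w i) (x l) = q%:R * (i == l)%:R.
  by have := wE (fun j => (j == l)%:R); rewrite zcomb_delta rmorph_nat.
split=> //.
  apply: contraTneq q0 => w0; rewrite -eqn0Ngt -(pnatr_eq0 rat) -[q%:R]mulr1.
  by have := wx i; rewrite eqxx w0 (biadd0l trace_form_biadditive) => <-.
have [K K0 [u [/[dup] Su /xP.1[z uz] uE wu]]] := cform_represents Sw.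
have u_le : cform u u * cform (x i) (x i) <= (hermite_const N)%:R * (K%:R * q%:R) ^+ 2.
  rewrite uz; apply: (hermite_reduced_dual_le cB) => // [l|]; last exact: cform_ge0.
  by rewrite -uz uE ?wx ?mulrA //; exact: (zbasis_mem xP).
have K2 : 0 < K%:R ^+ 2 :> rat by rewrite exprn_gt0 ?ltr0n.
rewrite -(ler_pM2l K2) mulrA; apply: (le_trans (ler_wpM2r (cform_ge0 _) wu)).
rewrite -mulrA; apply: (le_trans (ler_wpM2l (ler0n _ _) u_le)).
by rewrite le_eqVlt natrM; apply/orP; left; apply/eqP; ring.
Qed.

End CompatibleForm.

(* The longest vector [x i] of a reduced basis has a short dual vector; hence some
   basis vector [x j] is so short that it has bounded pairings with all the others. *)
Lemma short_partner (A : set D) (S : set V) N q : (forall d, inQ A d) -> stable A S ->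
  nondeg S -> zlattice N S -> (0 < q)%N -> dual_exponent E S q -> (exists2 x, S x & x != 0) ->
  exists r (x : 'I_r -> V) j, zbasis S x /\
    forall l, dsqr (psi (x l) (x j)) <= (pair_const n N)%:R * q%:R ^+ 2.
Proof.
move=> AQ stS nd SL q0 dS [x0 Sx0 x00]; have [sS _ rk] := SL.
have [p [v [tau [p_le vS perp0 normv]]]] := normalized_frame (inQ_subgroup sS)
  (stable_inQ AQ stS) (nondeg_inQ nd) (rank_le_inQ sS rk).
pose h := cform v; have hS : symmetric_form h := cform_symmetric v.
have [|r [x [_ xP hx red]]] := hermite_basis hS SL.
  by move=> x Sx; apply: (cform_gt0 sS AQ stS vS perp0); exact: sub_inQ.
have Sx l : inQ S (x l) by apply/sub_inQ/(zbasis_mem xP).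
have r0 : (0 < r)%N.
  case: r x xP {hx red Sx} => // x [x_gen _]; have /x_gen[z x0E] := Sx0.
  by rewrite x0E big_ord0 eqxx in x00.
have [i imax] : exists i, forall l, h (x l) (x l) <= h (x i) (x i).
  case: (@Order.TotalTheory.arg_maxP _ rat _ (Ordinal r0) xpredT (fun l => h (x l) (x l)) isT).
  by move=> i _ im; exists i => l; exact: im.
have [w [/xP.1[z ->] zx0 w_le]] := dual_vector_short sS AQ stS vS perp0 normv i xP red q0 dS.
have [j j_le] := hermite_reduced_exists_le red (fun l => ltW (hx l)) zx0.
exists r, x, j; split=> // l.
apply: (le_trans (psi_le_cform sS AQ stS p_le vS perp0 normv _ (Sx l))).
have := ler_pM (ltW (hx l)) (ltW (hx j)) (imax l) j_le.
move/(ler_wpM2l (ler0n _ (form_const n N)))/le_trans; apply.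
set hw := h (zcomb x z) (zcomb x z) in w_le *; set hi := h (x i) (x i) in w_le *.
rewrite [leLHS](_ : _ = (form_const n N * hermite_const N)%:R * (hw * hi)); last first.
  by rewrite natrM; ring.
rewrite (le_trans (ler_wpM2l (ler0n _ _) w_le)) // mulrA -natrM ler_wpM2r ?sqr_ge0 //.
by rewrite ler_nat /pair_const; lia.
Qed.

Definition shear_const (dim : nat) : nat := (2 * dim ^ 2 * hermite_const dim).+1.

Definition block_const (dim N : nat) : nat := (4 * shear_const dim * pair_const dim N)%N.

Section ShortBlock.
Variables (O : set D) (k : nat) (S : set V).
Hypothesis OP : is_order O.
Hypothesis k_gt0 : (0 < k)%N.
Hypothesis kP : codifferent_exponent O k.
Hypothesis sS : subgroup S.
Hypothesis stS : stable O S.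

(* The vectors [u] are of the form [y + s x], with [s] central such that [psi u u],
   which is a central multiple of [psi y x + psi x y], is short. *)
Lemma isotropic_shear x y : quaternion_algebra D -> totally_indefinite R D ->
  S x -> S y -> psi x x = 0 -> psi y x + psi x y != 0 ->
  exists u, [/\ S u, psi u u != 0
    & dsqr (psi u u) <= (shear_const n * k ^ 2)%:R * dsqr (psi y x + psi x y)].
Proof.
move=> qD indef Sx Sy xx; set b := psi y x + psi x y => b0.
have sb : dag b = - b.
  by rewrite /b [psi x y]psiC [dag (_ + _)]raddfD /= [dag (- _)]raddfN /= dagK opprD opprK addrC.
have [f fE] := skew_line qD indef sb b0 (skew_psi y).
have psiE t : psi (y + t%:A *: x) (y + t%:A *: x) = (f + t) *: b.
  rewrite (biaddDl psiB) !(biaddDr psiB) !psiZl !psiZr xx mul0r mulr0 addr0 dag_alg.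
  by rewrite fE mulr_algl mulr_algr -addrA -scalerDr -scalerDl.
have [s Os s_le] := order_center_approx OP qD k_gt0 kP f.
suff [t [Ot ft t_le]] : exists t : F, [/\ O t%:A, f + t != 0
    & dsqr ((f + t) *: b) <= (shear_const n * k ^ 2)%:R * dsqr b].
  exists (y + t%:A *: x); rewrite psiE scaler_eq0 negb_or ft; split=> //.
  by apply: (subgroupD sS) => //; exact: stS.
have [sO O1 _ _ _] := OP; have [fs|fs] := eqVneq (f + s) 0.
  exists (s + 1); rewrite scalerDl scale1r addrA fs add0r oner_eq0 scale1r; split=> //.
    exact: (subgroupD sO).
  by rewrite -[leLHS]mul1r ler_wpM2r ?dsqr_ge0 // ler1n muln_gt0 expn_gt0 k_gt0.
exists s; split=> //; rewrite -mulr_algl; apply: (le_trans (dsqrM _ _)).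
rewrite ler_wpM2r ?dsqr_ge0 // (le_trans s_le) // -natrX -natrM ler_nat.
by rewrite leq_mul2r leqnSn orbT.
Qed.

Lemma short_block N q : nondeg S -> zlattice N S -> (0 < q)%N -> dual_exponent E S q ->
  (exists2 x, S x & x != 0) ->
  elementary_block symp S (fun d => dsqr d <= (block_const n N)%:R * (k * q)%:R ^+ 2).
Proof.
have [_ _ _ _ OQ] := OP => nd SL q0 dS nz.
have [r [x [j [xP hx]]]] := short_partner OQ stS nd SL q0 dS nz.
have Sx l : S (x l) := zbasis_mem xP l.
have weaken d a : (a <= 4 * shear_const n * k ^ 2)%N ->
    dsqr d <= a%:R * ((pair_const n N)%:R * q%:R ^+ 2) ->
    dsqr d <= (block_const n N)%:R * (k * q)%:R ^+ 2.
  move=> a_le /le_trans; apply; rewrite -!natrX -!natrM ler_nat expnMn /block_const.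
  by rewrite -(mulnA (4 * _)%N) (mulnCA (pair_const n N)) [leqRHS]mulnA leq_mul2r a_le orbT.
have hxj l : dsqr (psi (x l) (x j)) <= (block_const n N)%:R * (k * q)%:R ^+ 2.
  by apply: (weaken _ 1); rewrite ?mul1r // !muln_gt0 k_gt0.
have [u Su ju] := nd _ (Sx j) (zbasis_neq0 xP j).
move: sympP; case: symp => [cD|[qD indef]].
  have [||l hl] := zbasis_additive_neq0 sS (f := psi^~ (x j)) _ xP.
  - by move=> z z' _ _; rewrite (biaddDl psiB).
  - by exists u => //; apply: contra_neq ju; exact: psi_eq0C.
  by apply: (elementary_block_pair cD (Sx l) (Sx j) hl); rewrite ?dsqrN.
have [jj|jj] := eqVneq (psi (x j) (x j)) 0; last first.
  exact: (elementary_block_vector qD (Sx j)).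
have [||l hl] := zbasis_additive_neq0 sS (f := fun z => psi z (x j) + psi (x j) z) _ xP.
- by move=> z z' _ _; rewrite (biaddDl psiB) (biaddDr psiB) addrACA.
- exact: (exists_polar_neq0 qD OQ stS nd (Sx j) (zbasis_neq0 xP j)).
have [z [Sz zz z_le]] := isotropic_shear qD indef (Sx j) (Sx l) jj hl.
apply: (elementary_block_vector qD Sz zz); apply: (weaken _ (4 * shear_const n * k ^ 2)%N) => //.
have -> : (4 * shear_const n * k ^ 2)%:R = (shear_const n * k ^ 2)%:R * 4%:R :> rat.
  by rewrite -natrM -mulnA mulnC.
apply: (le_trans z_le); rewrite -mulrA ler_wpM2l //.
apply: (le_trans (dsqrD _ _)); rewrite [psi (x j) (x l)]psiC dsqrN dsqr_dag.
by have := hx l; lra.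
Qed.

End ShortBlock.

(** * Induction on the rank *)

Definition mult_const (dim N : nat) : nat :=
  (dim`! * (1 + hermite_const dim * block_const dim N) ^ dim)%N.

Lemma mult_const_gt0 dim N : (0 < mult_const dim N)%N.
Proof. by rewrite muln_gt0 fact_gt0 expn_gt0. Qed.

Lemma block_const_bound dim N X : (0 < dim)%N ->
  (block_const dim N * X ^ 2 <= (mult_const dim N * X) ^ 2)%N.
Proof.
move=> dim0; rewrite expnMn leq_mul2r; apply/orP; right; set B := block_const dim N.
apply: (@leq_trans (mult_const dim N)); last first.
  by rewrite -{1}[mult_const _ _]expn1 leq_pexp2l ?mult_const_gt0.
apply: (@leq_trans ((1 + hermite_const dim * B) ^ dim)); last by rewrite leq_pmull ?fact_gt0.
apply: (@leq_trans (1 + hermite_const dim * B)).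
  by rewrite (leq_trans _ (leq_addl _ _)) // leq_pmull ?hermite_const_gt0.
by rewrite -{1}[(1 + _)%N]expn1 leq_pexp2l.
Qed.

Lemma mult_const_bound dim N k X (d : rat) : (0 < dim)%N -> (0 < k)%N -> (k <= X)%N ->
  0 <= d -> d <= (block_const dim N)%:R * X%:R ^+ 2 ->
  dim`!%:R * (1 + (hermite_const dim)%:R * (k%:R ^+ 2 * d)) ^+ dim
    <= ((mult_const dim N * X) ^ (4 * dim))%:R.
Proof.
move=> dim0 k0 kX d0 d_le; set H := hermite_const dim; set B := block_const dim N in d_le *.
have X1 : 1 <= X%:R :> rat by rewrite ler1n (leq_trans k0).
have base : 1 + H%:R * (k%:R ^+ 2 * d) <= (1 + H * B)%:R * X%:R ^+ 4.
  rewrite natrD mulrDl mul1r lerD ?exprn_ege1 // natrM -mulrA ler_wpM2l //.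
  rewrite (_ : B%:R * _ = X%:R ^+ 2 * (B%:R * X%:R ^+ 2)); last by ring.
  by rewrite ler_pM ?sqr_ge0 // ler_sqr ?nnegrE // ler_nat.
have base0 : 0 <= 1 + H%:R * (k%:R ^+ 2 * d) by rewrite addr_ge0 // !mulr_ge0 ?sqr_ge0.
apply: (@le_trans _ _ (dim`!%:R * ((1 + H * B)%:R * X%:R ^+ 4) ^+ dim)).
  by rewrite ler_wpM2l // lerXn2r ?nnegrE // (le_trans base0).
rewrite exprMn mulrA -!natrX -!natrM ler_nat -expnM expnMn leq_mul //.
by rewrite -/(mult_const dim N) -{1}[mult_const _ _]expn1 leq_pexp2l ?mult_const_gt0 ?muln_gt0.
Qed.

Section ReducedFamily.
Variables (O : set D) (N k : nat).
Hypothesis OP : is_order O.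
Hypothesis k_gt0 : (0 < k)%N.
Hypothesis kP : codifferent_exponent O k.

Let sO : subgroup O. Proof. by case: OP. Qed.

Lemma psi_order (S : set V) x y :
  stable O S -> integral_on E S ->
  S x -> S y -> O (psi x y *+ k).
Proof.
move=> stS Eint Sx Sy; apply: kP => a Oa.
by rewrite trQ_trdQ -psiZl rpredM ?rpred_nat // Eint //; exact: stS.
Qed.

(* [M] is the product of the denominators of the [(psi (v i) (v (tau i)))^-1]. *)
Lemma gram_monomial_splits (S : set V) q p (v : 'I_p -> V) tau :
  stable O S -> integral_on E S -> (0 < q)%N -> (p <= 2)%N ->
  gram_monomial v tau -> (forall i, S (v i)) ->
  (forall i, dsqr (psi (v i) (v (tau i))) <= (block_const n N)%:R * (k * q)%:R ^+ 2) ->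
  exists2 M, splits O S v tau M & (M <= (mult_const n N * (k * q)) ^ (8 * n))%N.
Proof.
move=> stS Eint q0 p2 vP Sv v_le; have [_ _ c_unit] := vP; have [_ _ OM _ _] := OP.
set Y := (mult_const n N * (k * q))%N.
have Y0 : (0 < Y)%N by rewrite muln_gt0 mult_const_gt0 muln_gt0 k_gt0.
have k_unit : (k%:R : D) \is a GRing.unit.
  by rewrite -(rmorph_nat (ratD D)) rmorph_unit // unitfE pnatr_eq0 -lt0n.
have /choice[M MP] i : exists M : nat, [/\ (0 < M)%N, (M <= Y ^ (4 * n))%N
    & forall x, S x -> O (gram_coef v tau x i *+ M)].
  set c := psi (v i) (v (tau i)).
  have ck_unit : c *+ k \is a GRing.unit by rewrite -mulr_natr unitrMl ?c_unit.
  have Oc : O (c *+ k) := psi_order stS Eint (Sv i) (Sv _).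
  have [M [M0 M_le OM']] := order_inverse_bound OP Oc ck_unit.
  exists M; split=> // [|x Sx].
    rewrite -(ler_nat rat) (le_trans M_le) // dsqrMn.
    by apply: mult_const_bound; rewrite ?dimQ_gt0 ?dsqr_ge0 ?leq_pmulr //; exact: v_le.
  suff -> : gram_coef v tau x i = psi x (v (tau i)) *+ k / (c *+ k).
    by rewrite -mulrnAr; apply: OM => //; exact: (psi_order stS Eint Sx (Sv _)).
  apply: (mulIr ck_unit); rewrite divrK // /gram_coef -/c -[c *+ k]mulr_natr mulrA.
  by rewrite divrK ?c_unit // mulr_natr.
exists (\prod_i M i)%N; first split=> //.
- by rewrite prodn_gt0 // => i; case: (MP i).
- move=> x i Sx; rewrite (bigD1 i) //= mulrnA; apply: (subgroupMn sO).
  by have [_ _] := MP i; apply.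
apply: (@leq_trans (\prod_(i < p) Y ^ (4 * n))).
  by apply: leq_prod => i _; case: (MP i).
rewrite prod_nat_const card_ord -expnM leq_pexp2l //.
by rewrite (leq_trans (leq_mul (leqnn _) p2)) // mulnAC.
Qed.

(* Splitting off a block of index [M] replaces [q] by [M ^ 2 * q]. *)
Fixpoint family_exponent (dim s : nat) : nat :=
  if s is s'.+1 then
    (8 * dim + 2 + (2 * (8 * dim + 2)).+1 * family_exponent dim s')%N
  else 0.

Definition family_bound (dim N s X : nat) : nat :=
  ((mult_const dim N * X) ^ family_exponent dim s)%N.

Lemma family_exponent_step dim s Y M : (0 < Y)%N -> (M <= Y ^ (8 * dim))%N ->
  ((Y * M ^ 2) ^ family_exponent dim s
    <= Y ^ ((2 * (8 * dim + 2)).+1 * family_exponent dim s))%N.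
Proof.
move=> Y0 M_le; rewrite expnM; case: (posnP (family_exponent dim s)) => [->//|e0].
rewrite leq_exp2r // [leqRHS]expnS leq_mul2l mulnC expnM leq_exp2r //.
by rewrite (leq_trans M_le) ?orbT // leq_pexp2l // leq_addr.
Qed.

Theorem reduced_family s (S : set V) q : (s <= N)%N ->
  stable O S -> nondeg S -> zlattice s S ->
  integral_on E S -> (0 < q)%N -> dual_exponent E S q ->
  exists p (v : 'I_p -> V) tau M,
    [/\ splits O S v tau M, perp_trivial v S, pairs_indices symp tau,
        forall i, dsqr (psi (v i) (v (tau i))) <= (family_bound n N s (k * q))%:R
      & (M <= family_bound n N s (k * q))%N].
Proof.
elim/ltn_ind: s S q => s IHs S q sN stS nd SL Eint q0 dS; rewrite /family_bound.
set Y := (_ * (k * q))%N.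
have Y0 : (0 < Y)%N by rewrite muln_gt0 mult_const_gt0 muln_gt0 k_gt0.
have [nz|none] := pselect (exists2 x, S x & x != 0); last first.
  exists 0, (fun=> 0), id, 1%N; split=> [|x [Sx _]|[]//|[]//|]; first exact: splits0.
    by apply/eqP/negPn/negP => x0; apply: none; exists x.
  by rewrite expn_gt0 Y0.
have [sS _ rk] := SL; case: s IHs sN SL rk => [_ _ _ rk|s IHs sN SL rk].
  by have [x /(rank_le0 (@lmod_torsion_free _ _ _) rk) ->] := nz; rewrite eqxx.
have [v [tau [vP pv Sv v_le]]] :=
  short_block OP k_gt0 kP sS stS nd (zlattice_le sN SL) q0 dS nz.
have [|M1 vS M1_le] := gram_monomial_splits stS Eint q0 _ vP Sv v_le; first by case: (symp).
have M10 : (0 < M1)%N by case: vS.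
have [|||||p [w [tau' [M2 [wS perp0 pw w_le M2_le]]]]] :=
  IHs s (leqnn _) (perp v S) (M1 ^ 2 * q)%N (ltnW sN) (perp_stable stS).
- exact: perp_nondeg sS stS vS nd.
- exact: (perp_zlattice vP isT Sv SL).
- by move=> x y /perp_sub Sx /perp_sub; exact: Eint.
- by rewrite muln_gt0 expn_gt0 M10.
- exact: perp_dual_exponent sS stS vS q dS.
have YM : (mult_const n N * (k * (M1 ^ 2 * q)) = Y * M1 ^ 2)%N by rewrite /Y; ring.
have := family_exponent_step s Y0 M1_le; rewrite -YM => bound_step.
exists (symp.+1 + p)%N, (fam_cat v w), (tau_cat tau tau'), (M1 * M2)%N; split.
- exact: splits_cat sO sS stS vS wS.
- by move=> x /perp_cat/perp0.
- exact: pairs_indices_cat.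
- elim/ord_cat_ind => j; rewrite ?tau_catl ?tau_catr ?fam_catl ?fam_catr.
    apply: (le_trans (v_le j)); rewrite -natrX -natrM ler_nat.
    apply: (leq_trans (block_const_bound _ _ (dimQ_gt0 D))).
    by rewrite leq_pexp2l //= -addnA addnCA leq_addr.
  apply: (le_trans (w_le j)); rewrite ler_nat (leq_trans bound_step) // leq_pexp2l //.
  exact: leq_addl.
- rewrite /= expnD leq_mul ?(leq_trans M2_le) //.
  by rewrite (leq_trans M1_le) // leq_pexp2l // leq_addr.
Qed.

End ReducedFamily.

(** * Reduced bases of full lattices *)

Section Lattice.
Variables (m : nat) (L : set V).
Hypothesis m_gt0 : (0 < m)%N.
Hypothesis dimV : has_dim V m.
Hypothesis psi_nondeg : nondegenerate_form psi.
Hypothesis fullL : full_lattice m L.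
Hypothesis Eint : integral_on E L.

Lemma full_lattice_inQ x : inQ L x.
Proof. by have [b bL] := fullL; apply: (zbasis_full bL); exact: has_dim_rank_le. Qed.

Lemma full_lattice_zlattice : zlattice (m * n) L.
Proof.
have [b bL] := fullL; split; [exact: zbasis_subgroup bL|exact: zbasis_in_zspan bL|].
exact: rank_le_sub (has_dim_rank_le dimV).
Qed.

Lemma full_lattice_nondeg : nondeg L.
Proof.
move=> x _ /psi_nondeg[y xy]; have [K K0 LK] := full_lattice_inQ y; exists (y *+ K) => //.
by rewrite (biaddMnr psiB); apply: contra_neq xy; exact: falg_torsion_free.
Qed.

Lemma trace_form_nondeg x : (forall y, L y -> E x y = 0) -> x = 0.
Proof.
move=> Ex; apply/eqP/negPn/negP => /psi_nondeg[y /eqP]; apply.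
apply: trdQ_nondeg => d; have [K K0 LK] := full_lattice_inQ (dag d *: y).
have /eqP := Ex _ LK; rewrite (biaddMnr trace_form_biadditive) psiZr dagK.
by rewrite mulrn_eq0 eqn0Ngt K0 => /eqP.
Qed.

Lemma disc_lattice_dual_exponent :
  exists q : nat, [/\ (0 < q)%N, `|disc_lattice psi L| = q%:R & dual_exponent E L q].
Proof.
have [b bL] := fullL.
apply: (gram_disc_dual_exponent trace_form_biadditive Eint _ bL) => x _.
exact: trace_form_nondeg.
Qed.

Theorem reduced_basis : exists k q : nat,
  [/\ (0 < k)%N, (0 < q)%N, `|disc_order (stab L)| = k%:R, `|disc_lattice psi L| = q%:R
    & exists (v : 'I_m -> V) tau,
      [/\ dbasis v /\ (forall i, L (v i)), gram_monomial v tau, pairs_indices symp tau,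
          forall i, dsqr (psi (v i) (v (tau i)))
            <= (family_bound n (m * n) (m * n) (k * q))%:R
        & exists2 K, has_index L (span_over (stab L) v) K
          & (K <= family_bound n (m * n) (m * n) (k * q) ^ (m * n))%N]].
Proof.
have [b bL] := fullL; have sL := zbasis_subgroup bL.
have stL : stable (stab L) L by move=> a x; apply.
have OP := stab_is_order m_gt0 dimV bL full_lattice_inQ; have [sO _ _ _ _] := OP.
have [k [k0 kE kP]] := disc_order_codifferent_exponent OP.
have [q [q0 qE dL]] := disc_lattice_dual_exponent.
exists k, q; split=> //.
have [p [v [tau [M [vS perp0 pv v_le M_le]]]]] := reduced_family OP k0 kP (leqnn _) stL
  full_lattice_nondeg full_lattice_zlattice Eint q0 dL.
have vD := splits_dbasis sL stL vS full_lattice_inQ perp0.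
have mp : m = p by apply: has_dim_unique dimV _; exists v.
subst p; have [vP Lv M0 _] := vS.
have [K KI K_le] := has_index_le bL (span_over_subgroup v sO) (span_over_sub sL stL vS) M0
  (fun x => splits_span_over sL stL vS (x := x) perp0).
exists v, tau; split=> //; exists K => //; apply: (leq_trans K_le).
by case: (posnP (m * n)) => [->|N0]; rewrite ?expn0 // leq_exp2r.
Qed.

End Lattice.

End AlbertType.

Lemma gram_monomial_symplectic p (v : 'I_p -> V) tau :
  gram_monomial v tau -> pairs_indices true tau -> weakly_symplectic psi v.
Proof.
move=> [_ orth _] pv i j nij; apply: orth; apply/eqP => e; apply: nij.
exists i./2; rewrite e pv /pairing; have := odd_double_half i.
by case: (odd i) => /= h; [right|left]; split; lia.
Qed.

Lemma gram_monomial_unitary p (v : 'I_p -> V) tau :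
  gram_monomial v tau -> pairs_indices false tau -> weakly_unitary psi v.
Proof.
move=> [_ orth _] pv i j ij; apply: orth; rewrite eq_sym; apply: contra_neq ij => e.
by apply: ord_inj; rewrite -e pv.
Qed.

End Form.

Lemma dnorm_le (x : D) (B : nat) : dsqr x <= B%:R -> dnorm R dag x <= B%:R.
Proof.
move=> xB; rewrite /dnorm -[leRHS]ger0_norm // -sqrtr_sqr; apply: ler_wsqrtr.
rewrite (@le_trans _ _ (ratr B%:R)) ?ler_rat // ratr_nat -natrX ler_nat.
by case: B {xB} => // B; rewrite leq_pmulr.
Qed.

End PositiveInvolution.

Lemma expn_le_powR (R : realType) (C k q e : nat) : (0 < k)%N -> (0 < q)%N ->
  ((C * (k * q)) ^ e)%:R <= (C ^ e)%:R * powR k%:R e.+1%:R * powR q%:R e.+1%:R :> R.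
Proof.
move=> k0 q0; rewrite !powR_mulrn // -mulrA -exprMn -natrM -natrX -natrM ler_nat.
by rewrite expnMn leq_mul2l leq_pexp2l ?orbT // muln_gt0 k0.
Qed.

Theorem theorem1p2 (R : realType) (m n : nat) (m_gt0 : (0 < m)%N) :
  exists c1 c2 c3 c4 c5 c6 : R,
    ((0 < c1) /\ (0 < c2) /\ (0 < c3) /\ (0 < c4) /\ (0 < c5) /\ (0 < c6)) /\
    forall (F : fieldExtType rat) (D : falgType F) (dag : D -> D)
           (V : lmodType D) (psi : V -> V -> D) (L : set V),
      totally_real R F ->
      is_center D \/ (quaternion_algebra D /\ totally_indefinite R D) ->
      dimQ D = n ->
      positive_involution dag ->
      has_dim V m ->
      skew_hermitian_form dag psi ->
      nondegenerate_form psi ->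
      full_lattice m L ->
      (forall x y, L x -> L y -> trdQ (psi x y) \is a Num.int) ->
      exists v : 'I_m -> V,
        dbasis v /\
        (forall i, L (v i)) /\
        (is_center D -> weakly_symplectic psi v) /\
        (quaternion_algebra D -> weakly_unitary psi v) /\
        (exists k : nat,
           has_index L (span_over (stab L) v) k /\
           k%:R <= c1 * powR (ratr `|disc_order (stab L)|) c2
                      * powR (ratr `|disc_lattice psi L|) c3) /\
        (forall i j : 'I_m,
           dnorm R dag (psi (v i) (v j))
             <= c4 * powR (ratr `|disc_order (stab L)|) c5
                   * powR (ratr `|disc_lattice psi L|) c6).
Proof.
pose C := mult_const n (m * n); pose e := family_exponent n (m * n).
exists (C ^ (e * (m * n)))%:R, (e * (m * n)).+1%:R, (e * (m * n)).+1%:R.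
exists (C ^ e)%:R, e.+1%:R, e.+1%:R.
split; first by rewrite !ltr0n !expn_gt0 mult_const_gt0.
move=> F D dag V psi L realF typeD dimD pos dimV psiP nd fullL Eint.
have [sig sigP] := exists_real_embeddings realF.
have [symp sympP] : exists symp, albert_type R D symp.
  by case: typeD => ?; [exists true|exists false].
have caseD : is_center D \/ quaternion_algebra D by case: typeD => [|[]]; [left|right].
have [k [q [k0 q0 -> -> [v [tau [[vD Lv] vP pv v_le [K KI K_le]]]]]]] :=
  reduced_basis sigP caseD pos psiP sympP m_gt0 dimV nd fullL Eint.
rewrite dimD in v_le K_le; rewrite !ratr_nat; exists v; do 2?split=> //; split; [|split; [|split]].
- move=> cD; move: sympP pv; case: symp => [_|[/(center_not_quaternion cD)//]].
  exact: gram_monomial_symplectic.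
- move=> qD; move: sympP pv; case: symp => [/center_not_quaternion/(_ qD)//|_].
  exact: gram_monomial_unitary.
- exists K; split=> //; apply: le_trans (expn_le_powR R C _ k0 q0).
  by rewrite ler_nat (leq_trans K_le) // /family_bound -expnM.
- move=> i j; apply: le_trans (expn_le_powR R C e k0 q0).
  have [->|ij] := eqVneq j (tau i); first exact: dnorm_le.
  by have [_ orth _] := vP; rewrite orth // dnorm_le ?dsqr0.
Qed.
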